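(* Let $A$ be a regular domain containing a field of characteristic $p>0$, let $m\ge 1$, and let $R=A[X_1,\ldots,X_m]$ be standard graded with $\deg A=0$ and $\deg X_i=1$ for all $i$. Let $I$ be a homogeneous ideal of $R$ with $I\cap A\neq 0$. If $H^i_I(R)_c\neq 0$ (for some $i\ge 0$ and $c\in\mathbb{Z}$), then $H^i_I(R)_c$ is not finitely generated as an $A$-module.
   Context: $H^i_I(R)$ is the $i$-th local cohomology module of $R$ with support in $I$ with its natural grading $H^i_I(R)=\bigoplus_{n\in\mathbb{Z}}H^i_I(R)_n$; each $H^i_I(R)_n$ is an $A$-module. *)

(* Defs.v *)
From HB Require Import structures.
From mathcomp Require Import all_boot all_order all_algebra.
From mathcomp Require Import boolp classical_sets.
From mathcomp Require Import mpoly.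

Set Implicit Arguments.
Unset Strict Implicit.
Unset Printing Implicit Defensive.

Import GRing.Theory.
Local Open Scope classical_set_scope.
Local Open Scope ring_scope.

(* Ideals are arbitrary classical sets, possibly the whole ring: the ideals of
   ring_quotient.v are boolean and always proper. *)
Section Ideals.
Variable B : comNzRingType.
Implicit Types (G J K P : set B) (d n : nat).

Definition is_ideal J :=
  [/\ J 0, forall x y, J x -> J y -> J (x + y) & forall a x, J x -> J (a * x)].

Definition is_prime_ideal P :=
  [/\ is_ideal P, ~ P 1 & forall x y, P (x * y) -> P x \/ P y].

Definition is_maximal_ideal K :=
  [/\ is_ideal K, ~ K 1 & forall J, is_ideal J -> ~ J 1 -> K `<=` J -> J = K].

Definition ideal_span G : set B :=
  [set x | exists n (a g : 'I_n -> B),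
     (forall j, G (g j)) /\ x = \sum_j a j * g j].

Definition ideal_power J n : set B :=
  ideal_span [set \prod_j g j | g in [set g : 'I_n -> B | forall j, J (g j)]].

Definition generated_by J d := exists g : 'I_d -> B, J = ideal_span (range g).

Definition is_noetherian := forall J, is_ideal J -> exists d, generated_by J d.

Definition has_prime_chain n := exists Q : nat -> set B,
  (forall j, (j <= n)%N -> is_prime_ideal (Q j)) /\
  (forall j, (j < n)%N -> Q j `<` Q j.+1).

Definition has_krull_dim d :=
  has_prime_chain d /\ forall n, has_prime_chain n -> (n <= d)%N.

(* Noetherian local, with maximal ideal K minimally generated by dim B
   elements. *)
Definition is_regular_local := is_noetherian /\
  exists K, [/\ is_maximal_ideal K,
    forall J, is_maximal_ideal J -> J = K &
    exists d, [/\ has_krull_dim d, generated_by K d &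
                  forall n, generated_by K n -> (d <= n)%N]].

End Ideals.

(* The localization A_P of a domain, inside its field of fractions. *)
Section Localization.
Variables (A : idomainType) (P : set A) (P_prime : is_prime_ideal P).
Local Notation "x %:F" := (FracField.tofrac x).

Definition loc_pred : {pred {fraction A}} :=
  fun x => `[< exists a s, ~ P s /\ x = a%:F / s%:F >].

Lemma loc_subring : subring_closed loc_pred.
Proof.
have [[P0 _ _] P1 PM] := P_prime.
have nz s : ~ P s -> s%:F != 0 :> {fraction A}.
  by move=> Ps; rewrite tofrac_eq0; apply: contra_notN Ps => /eqP ->.
have PN s t : ~ P s -> ~ P t -> ~ P (s * t) by move=> Ps Pt /PM[].
split.
- by apply/asboolP; exists 1, 1; rewrite tofrac1 divr1.
- move=> _ _ /asboolP[a [s [Ps ->]]] /asboolP[b [t [Pt ->]]].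
  apply/asboolP; exists (a * t - b * s), (s * t); split; first exact: PN.
  by rewrite -mulNr addf_div ?nz // -!tofracN -!tofracM -tofracD mulNr.
- move=> _ _ /asboolP[a [s [Ps ->]]] /asboolP[b [t [Pt ->]]].
  apply/asboolP; exists (a * b), (s * t); split; first exact: PN.
  by rewrite mulf_div -!tofracM.
Qed.

Record localization (hP : is_prime_ideal P) :=
  Localization { loc_val : {fraction A}; _ : loc_val \in loc_pred }.

Local Notation A_P := (localization P_prime).

HB.instance Definition _ := [isSub of A_P for @loc_val P_prime].
HB.instance Definition _ := [Choice of A_P by <:].
HB.instance Definition _ :=
  GRing.SubChoice_isSubComNzRing.Build {fraction A} loc_pred A_P loc_subring.

End Localization.

Definition is_regular_ring (A : idomainType) :=
  is_noetherian A /\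
  forall (P : set A) (hP : is_prime_ideal P), is_regular_local (localization hP).

Section GradedModules.
Variables (S : comNzRingType) (Sdeg : int -> set S).

Definition is_homogeneous_ideal (I : set S) :=
  is_ideal I /\ I = ideal_span (I `&` [set a | exists n, Sdeg n a]).

Record gradedModule := GradedModule {
  gm_sort :> lmodType S;
  gm_piece : int -> set gm_sort;
  gm_piece0 : forall n, gm_piece n 0;
  gm_pieceB : forall n x y, gm_piece n x -> gm_piece n y -> gm_piece n (x - y);
  gm_pieceZ : forall k n a x,
    Sdeg k a -> gm_piece n x -> gm_piece (k + n) (a *: x);
  gm_span : forall x, exists (s : seq int) (f : int -> gm_sort),
    (forall n, gm_piece n (f n)) /\ x = \sum_(n <- s) f n;
  gm_indep : forall (s : seq int) (f : int -> gm_sort), uniq s ->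
    (forall n, gm_piece n (f n)) -> \sum_(n <- s) f n = 0 ->
    forall n, n \in s -> f n = 0
}.

Definition is_graded (M N : gradedModule) (f : M -> N) :=
  forall n x, gm_piece n x -> gm_piece n (f x).

(* Injective object of the category of graded modules and degree-preserving
   linear maps. *)
Definition is_graded_injective (E : gradedModule) :=
  forall (M N : gradedModule) (j : {linear M -> N}) (f : {linear M -> E}),
    is_graded j -> injective j -> is_graded f ->
    exists g : {linear N -> E}, is_graded g /\ forall x, g (j x) = f x.

Record injectiveResolution (M : gradedModule) := InjectiveResolution {
  ir_obj :> nat -> gradedModule;
  ir_aug : {linear M -> ir_obj 0};
  ir_diff : forall i, {linear ir_obj i -> ir_obj i.+1};
  ir_injective : forall i, is_graded_injective (ir_obj i);
  ir_aug_graded : is_graded ir_aug;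
  ir_diff_graded : forall i, is_graded (ir_diff i);
  ir_aug_inj : injective ir_aug;
  ir_exact0 : forall x, ir_diff 0 x = 0 <-> exists y, ir_aug y = x;
  ir_exactS : forall i x, ir_diff i.+1 x = 0 <-> exists y, ir_diff i y = x
}.

Definition torsion (I : set S) (M : gradedModule) : set M :=
  [set x | exists n, forall a, ideal_power I n a -> a *: x = 0].

(* The local cohomology H^i_I(M), as right derived functor of the I-torsion
   functor on graded modules: the i-th cohomology of the complex
   torsion I (E 0) -> torsion I (E 1) -> ..., that is, the quotient
   lc_cocycle / lc_boundary; its degree c component is the image of
   lc_cocycle_deg c in this quotient.  Up to a canonical graded isomorphism
   this does not depend on the resolution E. *)
Section LocalCohomology.
Variables (I : set S) (M : gradedModule) (E : injectiveResolution M) (i : nat).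

Definition lc_cocycle : set (E i) :=
  [set x | torsion I x /\ ir_diff E i x = 0].

Definition lc_boundary : set (E i) :=
  match i return set (E i) with
  | 0 => [set 0]
  | j.+1 => [set ir_diff E j y | y in @torsion I (E j)]
  end.

Definition lc_cocycle_deg (c : int) : set (E i) := lc_cocycle `&` gm_piece c.

Definition lc_neq0 (c : int) := exists2 x, lc_cocycle_deg c x & ~ lc_boundary x.

(* Finite generation of the degree c component over a ring A acting through
   phi, which is meant to take its values in degree 0. *)
Definition lc_fin_gen (A : comNzRingType) (phi : {rmorphism A -> S}) (c : int) :=
  exists d (z : 'I_d -> E i), (forall j, lc_cocycle_deg c (z j)) /\
    forall x, lc_cocycle_deg c x ->
      exists a : 'I_d -> A, lc_boundary (x - \sum_j phi (a j) *: z j).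

End LocalCohomology.
End GradedModules.

Section PolynomialRing.
Variables (A : idomainType) (m : nat).
Local Notation R := {mpoly A[m]}.

Definition mpoly_piece (n : int) : set R :=
  match n with
  | Posz d => [set f | f \is d.-homog]
  | Negz _ => [set 0]
  end.

Local Notation piece := (mpoly_piece : int -> set R^o).

Lemma mpoly_piece0 n : piece n 0.
Proof. by case: n => n //=; exact: rpred0. Qed.

Lemma mpoly_pieceB n f g : piece n f -> piece n g -> piece n (f - g).
Proof.
case: n => n /=; first exact: rpredB.
by move=> -> ->; rewrite subr0.
Qed.

Lemma mpoly_pieceZ k n (a : R) (f : R^o) :
  mpoly_piece k a -> piece n f -> piece (k + n) (a *: f).
Proof.
case: k => k /= ka; last by rewrite ka scale0r => _; exact: mpoly_piece0.
case: n => n /= nf; last by rewrite nf scaler0; exact: mpoly_piece0.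
exact: dhomogM.
Qed.

Lemma mpoly_span (f : R^o) : exists (s : seq int) (g : int -> R^o),
  (forall n, piece n (g n)) /\ f = \sum_(n <- s) g n.
Proof.
exists (map Posz (index_iota 0 (mmeasure mdeg f))).
exists (fun n => if n is Posz d then pihomog mdeg d f else 0); split.
  by case=> n //=; exact: pihomogP.
rewrite big_map big_mkord.
exact: pihomog_partitionE.
Qed.

Lemma mpoly_indep (s : seq int) (g : int -> R^o) : uniq s ->
  (forall n, piece n (g n)) -> \sum_(n <- s) g n = 0 ->
  forall n, n \in s -> g n = 0.
Proof.
move=> us gP sum0 n ns; case: n ns => d ds; last exact: (gP (Negz d)).
have := congr1 (pihomog mdeg d) sum0; rewrite raddf0 raddf_sum (bigD1_seq (Posz d)) //=.
rewrite (pihomog_dE (gP (Posz d))) big1 ?addr0 // => -[e|e] ne.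
  by rewrite (pihomog_ne0 _ (gP (Posz e))) //; apply: contra_neq ne => ->.
by rewrite (gP (Negz e) : g _ = 0) raddf0.
Qed.

Definition mpoly_module : gradedModule mpoly_piece :=
  @GradedModule R mpoly_piece R^o piece mpoly_piece0 mpoly_pieceB
    mpoly_pieceZ mpoly_span mpoly_indep.

End PolynomialRing.

(* Main.v *)
Require Import Defs.
From HB Require Import structures.
From mathcomp Require Import all_boot all_order all_algebra.
From mathcomp Require Import boolp classical_sets.
From mathcomp Require Import mpoly.
From mathcomp Require Import zify ring.

(** Let R = A[X_1, ..., X_m], q = p^e, and F the Frobenius map. Suppose that
    H^i_I(R)_c is finitely generated over A, and pick a nonzero a in I and A. As
    local cohomology is I-torsion, some a^N kills H^i_I(R)_c; this alone forces
    H^i_I(R)_c = 0, as follows.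

    The Frobenius map of A is flat ([kunz]), hence so is that of R
    ([frob_flat_mpoly]). If G is a graded free resolution of R/I, raising the
    entries of its matrices to the power q gives a resolution F^e(G) of R/I^[q]
    ([resolves_frob]), and H^i_I(R) is the limit over e of the groups
    H^i(Hom(F^e(G), R)). This limit is compared with the complex of I-torsion
    elements of a graded injective resolution by staircases in a double complex
    ([zigzag], [represents]). Flatness has two consequences.
    - If H^i_I(R)_c is not zero then, for all large e, there are a degree t, a
      monomial X^b with all b_j < q and a nonzero class w in H^i_I(R)_t, coming
      from H^i(Hom(G, R)), with q t + |b| = c ([seed_exists]).
    - In that situation, if an element s of A kills H^i_I(R)_c, it kills X^b F^e(w),
      and then s lies in the ideal J^[q], where J is the annihilator of w in A
      ([seed_annihilator]); this holds for every such class w of degree t.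

    The equation q t + |b| = c confines t to a finite set that does not depend on e.
    Fix such a class in each of these degrees, when there is one; its annihilator
    J_t is a proper ideal. So for all large e the element a^N lies in J_t^q for some
    t in the finite set, which for e large contradicts Krull's intersection theorem
    in the domain A ([krull_domain]).

    Kunz's theorem is proved by Noetherian induction on ideals, in terms of relations
    between q-th powers ([frob_flat]); this reduces it to the maximal ideals of
    the local rings of A, that is, to the fact that the q-th powers of a regular
    system of parameters x_1, ..., x_d form a regular sequence ([powers_regular]).
    The latter follows from the independence of the monomials in the x_i
    ([regular_irredundant]), which in turn comes from counting lengths: a chain of
    d+1 primes makes the length of B/K^n grow at least like n^d
    ([prime_chain_growth]), whereas one redundant monomial would bound it by a
    multiple of n^(d-1) ([redundant_chain]). *)

Set Implicit Arguments.
Unset Strict Implicit.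
Unset Printing Implicit Defensive.

Import Order.TTheory GRing.Theory.
Local Open Scope classical_set_scope.
Local Open Scope ring_scope.
(** * Ideals and Noetherian rings *)

Section IdealTheory.
Variable B : comNzRingType.
Implicit Types (G J K : set B).

(** With arbitrary index types, combinations are added and substituted by means
    of sums and sigma types. *)
Lemma ideal_spanP G x : ideal_span G x <->
  exists (T : finType) (a g : T -> B),
    (forall j, G (g j)) /\ x = \sum_j a j * g j.
Proof.
split=> [[n [a [g [gG ->]]]]|[T [a [g [gG ->]]]]]; first by exists 'I_n, a, g.
exists #|T|, (a \o enum_val), (g \o enum_val); split=> [j|]; first exact: gG.
rewrite (reindex (@enum_val T predT)) //=.
exact: onW_bij (enum_val_bij T).
Qed.

Lemma ideal_sum J (T : finType) (P : pred T) (F : T -> B) : is_ideal J ->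
  (forall j, P j -> J (F j)) -> J (\sum_(j | P j) F j).
Proof. by move=> [J0 JD _] JF; apply: big_ind. Qed.

Lemma idealB J x y : is_ideal J -> J x -> J y -> J (x - y).
Proof. by move=> [_ JD JM] Jx Jy; rewrite -mulN1r; apply/JD/JM. Qed.

Lemma ideal_span_ideal G : is_ideal (ideal_span G).
Proof.
split=> [|x y|b x].
- by apply/ideal_spanP; exists void, (fun=> 0), (fun=> 0); rewrite big1 => [|[]]; split => // -[].
- move=> /ideal_spanP[T [a [g [gG ->]]]] /ideal_spanP[U [b [h [hG ->]]]].
  apply/ideal_spanP; exists (T + U)%type.
  exists (fun j => match j with inl j => a j | inr j => b j end).
  exists (fun j => match j with inl j => g j | inr j => h j end).
  by rewrite big_sumType; split => // -[].
- move=> /ideal_spanP[T [a [g [gG ->]]]]; apply/ideal_spanP.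
  exists T, (fun j => b * a j), g; split=> //.
  by rewrite mulr_sumr; apply: eq_bigr => j _; rewrite mulrA.
Qed.

Lemma ideal_span_le G J : is_ideal J -> G `<=` J -> ideal_span G `<=` J.
Proof.
move=> Ji GJ _ [n [a [g [gG ->]]]]; apply: ideal_sum => // j _.
by case: Ji => _ _; apply; apply/GJ.
Qed.

Lemma ideal_span_gen G : G `<=` ideal_span G.
Proof.
move=> x Gx; apply/ideal_spanP; exists unit, (fun=> 1), (fun=> x).
by split=> //; rewrite big_const card_unit /= mul1r addr0.
Qed.

Lemma ideal_span_mono G K : G `<=` K -> ideal_span G `<=` ideal_span K.
Proof.
move=> GK; apply: ideal_span_le; first exact: ideal_span_ideal.
by move=> x /GK; apply: ideal_span_gen.
Qed.

Lemma range_span (T : finType) (g : T -> B) x :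
  ideal_span (range g) x <-> exists a : T -> B, x = \sum_j a j * g j.
Proof.
split; last first.
  by move=> [a ->]; apply/ideal_spanP; exists T, a, g; split=> // j; exists j.
apply: (@ideal_span_le _ [set x | exists a : T -> B, x = \sum_j a j * g j]).
  split=> [|_ _ [a ->] [b ->]|c _ [a ->]] /=.
  - by exists (fun=> 0); rewrite big1 // => j _; rewrite mul0r.
  - by exists (fun j => a j + b j); rewrite -big_split; apply: eq_bigr => j _; rewrite mulrDl.
  - by exists (fun j => c * a j); rewrite mulr_sumr; apply: eq_bigr => j _; rewrite mulrA.
move=> _ [i _ <-] /=; exists (fun j => (j == i)%:R).
by rewrite (bigD1 i) //= eqxx mul1r big1 ?addr0 // => j /negPf ->; rewrite mul0r.
Qed.

Definition ideal_add J K : set B := [set z | exists x y, [/\ J x, K y & z = x + y]].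

Lemma ideal_add_ideal J K : is_ideal J -> is_ideal K -> is_ideal (ideal_add J K).
Proof.
move=> [J0 JD JM] [K0 KD KM]; split=> [|_ _ [x [y [Jx Ky ->]]] [x' [y' [Jx' Ky' ->]]]|c _ [x [y [Jx Ky ->]]]].
- by exists 0, 0; rewrite addr0.
- by exists (x + x'), (y + y'); rewrite addrACA; split=> //; [apply: JD|apply: KD].
- by exists (c * x), (c * y); rewrite mulrDr; split=> //; [apply: JM|apply: KM].
Qed.

Lemma ideal_addl J K : is_ideal K -> J `<=` ideal_add J K.
Proof. by move=> [K0 _ _] x Jx; exists x, 0; rewrite addr0. Qed.

Lemma ideal_addr J K : is_ideal J -> K `<=` ideal_add J K.
Proof. by move=> [J0 _ _] x Jx; exists 0, x; rewrite add0r. Qed.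

Definition principal (u : B) : set B := [set z | exists c, z = c * u].

Lemma principal_ideal u : is_ideal (principal u).
Proof.
split=> [|_ _ [c ->] [c' ->]|a _ [c ->]]; first by exists 0; rewrite mul0r.
  by exists (c + c'); rewrite mulrDl.
by exists (a * c); rewrite mulrA.
Qed.

Lemma prime_expr (P : set B) (x : B) n : is_prime_ideal P -> P (x ^+ n) -> P x.
Proof.
move=> [_ P1 PM]; elim: n => [|n IH]; first by rewrite expr0.
by rewrite exprS => /PM[].
Qed.

Section Noetherian.
Hypothesis nB : is_noetherian B.

(** Each of finitely many generators of the span is a finite combination of
    elements of G; collect those elements. *)
Lemma noeth_fin_gen G : exists (T : finType) (g : T -> B),
  (forall j, G (g j)) /\ forall x, G x -> exists a : T -> B, x = \sum_j a j * g j.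
Proof.
have [d [h hE]] := nB (ideal_span_ideal G).
have /choice[w wP] i : exists w : {T : finType & T -> B * B},
    (forall j, G (projT2 w j).2) /\ h i = \sum_j (projT2 w j).1 * (projT2 w j).2.
  have : ideal_span (range h) (h i) by apply: ideal_span_gen; exists i.
  rewrite -hE => /ideal_spanP[T [a [g [gG e]]]].
  by exists (existT _ T (fun j => (a j, g j))).
exists {i : 'I_d & projT1 (w i)}, (fun u => (projT2 (w (tag u)) (tagged u)).2).
split=> [[i j]|x Gx] /=; first exact: (wP i).1.
have : ideal_span (range h) x by rewrite -hE; apply: ideal_span_gen.
move=> /range_span[a ->].
exists (fun u => a (tag u) * (projT2 (w (tag u)) (tagged u)).1).
rewrite -(sig_big_dep (fun=> true) (fun _ _ => true)
  (fun i j => a i * (projT2 (w i) j).1 * (projT2 (w i) j).2)) /=.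
apply: eq_bigr => i _; rewrite (wP i).2 mulr_sumr.
by apply: eq_bigr => j _; rewrite mulrA.
Qed.

(** The ideal of all the a i is generated by finitely many of them; take N
    beyond their indices. *)
Lemma noeth_seq (a : nat -> B) :
  exists N, ideal_span [set a i | i in [set i | (i < N)%N]] (a N).
Proof.
have [T [g [gG gs]]] := noeth_fin_gen (range a).
have /choice[f fP] j : exists i, a i = g j by case: (gG j) => i _ <-; exists i.
pose N := (\max_j (f j).+1)%N; exists N.
have [c ->] := gs _ (ex_intro2 _ _ N I erefl : range a (a N)).
apply/ideal_spanP; exists T, c, g; split=> // j.
by exists (f j) => //=; rewrite /N (bigD1 j) //= leq_max ltnSn.
Qed.

(** A counterexample would start a strictly increasing sequence of ideals, and an
    element chosen in each step contradicts [noeth_seq]. *)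
Lemma noeth_ind (P : set B -> Prop) :
  (forall J, is_ideal J -> (forall K, is_ideal K -> J `<` K -> P K) -> P J) ->
  forall J, is_ideal J -> P J.
Proof.
move=> step J0 J0i; apply: contrapT => nP.
pose bad := {J : set B | is_ideal J /\ ~ P J}.
have /choice[nxt nxtP] (J : bad) : exists K : bad, sval J `<` sval K.
  case: J => J [Ji nPJ] /=; apply: contrapT => nK; apply: nPJ; apply: step => //.
  move=> K Ki JK; apply: contrapT => nPK; apply: nK.
  by exists (exist _ K (conj Ki nPK)).
pose c n := iter n nxt (exist _ J0 (conj J0i nP)).
have cS n : sval (c n) `<` sval (c n.+1) by apply: nxtP.
have cle i j : (i <= j)%N -> sval (c i) `<=` sval (c j).
  elim: j => [|j IH]; first by rewrite leqn0 => /eqP ->.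
  rewrite leq_eqVlt => /orP[/eqP -> //|/IH ij].
  by apply: subset_trans ij _; case: (cS j).
have /choice[x xP] n : exists x, sval (c n.+1) x /\ ~ sval (c n) x.
  apply: contrapT => nx; case: (cS n) => _; apply=> y cy.
  by apply: contrapT => ny; apply: nx; exists y.
have [N /ideal_span_le H] := noeth_seq x.
apply: (xP N).2; apply: H; first by case: (svalP (c N)).
by move=> _ [i /= iN <-]; apply: (cle i.+1) => //; case: (xP i).
Qed.

(** By induction on the rank r: finitely many elements of G span its last
    coordinates, and the induction hypothesis applies to the elements of G
    corrected so as to have last coordinate 0. *)
Lemma noeth_fin_module r (G : set (nat -> B)) :
  exists (T : finType) (g : T -> nat -> B), (forall j, G (g j)) /\
    forall v, G v -> exists a : T -> B,
      forall k, (k < r)%N -> v k = \sum_j a j * g j k.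
Proof.
elim: r G => [|r IH] G; first by exists void, (fun=> fun=> 0); split=> [[]|v _]; exists (fun=> 0).
have [T [c [cG cs]]] := noeth_fin_gen [set v r | v in G].
have /choice[g gP] j : exists v, G v /\ v r = c j.
  by case: (cG j) => v Gv <-; exists v.
have /choice[a aP] (v : nat -> B) : exists a : T -> B, G v -> v r = \sum_j a j * g j r.
  case: (pselect (G v)) => Gv; last by exists (fun=> 0).
  have [|a e] := cs (v r); first by exists v.
  by exists a => _; rewrite e; apply: eq_bigr => j _; rewrite (gP j).2.
pose red v k := v k - \sum_j a v j * g j k.
have [U [h [hG hs]]] := IH [set red v | v in G].
have /choice[w wP] j : exists v, G v /\ red v = h j.
  by case: (hG j) => v Gv <-; exists v.
exists (T + U)%type, (fun t => match t with inl j => g j | inr j => w j end).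
split=> [[j|j]|v Gv]; [by case: (gP j)|by case: (wP j)|].
have [b bP] := hs _ (ex_intro2 _ _ v Gv erefl).
exists (fun t => match t with
  | inl j => a v j - \sum_i b i * a (w i) j | inr i => b i end) => k kr.
rewrite big_sumType /=.
have -> : v k = red v k + \sum_j a v j * g j k by rewrite subrK.
have -> : red v k = \sum_i b i * red (w i) k.
  move: kr; rewrite ltnS leq_eqVlt => /orP[/eqP ->|/bP ->]; last first.
    by apply: eq_bigr => i _; rewrite (wP i).2.
  rewrite /red (aP v Gv) subrr big1 // => i _.
  by rewrite (aP _ (wP i).1) subrr mulr0.
have -> : \sum_i b i * red (w i) k =
    \sum_i b i * w i k - \sum_j (\sum_i b i * a (w i) j) * g j k.
  under eq_bigr do rewrite /red mulrBr.
  rewrite sumrB; congr (_ - _); under [RHS]eq_bigr do rewrite mulr_suml.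
  rewrite exchange_big; apply: eq_bigr => i _; rewrite mulr_sumr.
  by apply: eq_bigr => j _; rewrite mulrA.
under [in RHS]eq_bigr do rewrite mulrBl.
by rewrite sumrB; ring.
Qed.

End Noetherian.
End IdealTheory.

Lemma noeth_surj (B C : comNzRingType) (f : {rmorphism B -> C}) :
  (forall y, exists x, f x = y) -> is_noetherian B -> is_noetherian C.
Proof.
move=> fs nB J Ji.
have Ki : is_ideal (f @^-1` J).
  case: Ji => [J0 JD JM]; split=> [|x y|a x] /=.
  - by rewrite rmorph0.
  - by rewrite rmorphD; apply: JD.
  - by rewrite rmorphM; apply: JM.
have [d [g gE]] := nB _ Ki; exists d, (f \o g).
apply/seteqP; split=> [y Jy|].
  have [x xy] := fs y; move: Jy; rewrite -xy => Jx.
  have : (f @^-1` J) x by [].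
  rewrite gE => /range_span[a ->]; apply/range_span; exists (f \o a).
  by rewrite rmorph_sum; apply: eq_bigr => j _; rewrite rmorphM.
apply: ideal_span_le => // _ [j _ <-] /=.
suff : (f @^-1` J) (g j) by [].
by rewrite gE; apply: ideal_span_gen; exists j.
Qed.

(** Hilbert's basis theorem, by minimal degrees: if J is not finitely generated,
    pick f_0, f_1, ... in J, each of least degree outside the ideal of the
    previous ones; the leading coefficient of some f_N is a combination of the
    previous ones, so that f_N can be lowered. *)
Lemma noeth_poly (B : comNzRingType) : is_noetherian B -> is_noetherian {poly B}.
Proof.
move=> nB J Ji; apply: contrapT => nfg.
pose good (s : seq {poly B}) f := [/\ J f, ~ ideal_span [set g | g \in s] f &
  forall g, J g -> ~ ideal_span [set g | g \in s] g -> (size f <= size g)%N].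
have step (s : seq {poly B}) : exists f, {in s, forall f, J f} -> good s f.
  case: (pselect {in s, forall f, J f}) => sJ; last by exists 0.
  suff [f0 [Jf0 nf0]] : exists f, J f /\ ~ ideal_span [set g | g \in s] f.
    pose Q n := `[< exists f, [/\ J f, ~ ideal_span [set g | g \in s] f & size f = n] >].
    have exQ : exists n, Q n by exists (size f0); apply/asboolP; exists f0.
    case: (ex_minnP exQ) => n /asboolP[f [Jf nf sf]] nmin.
    exists f => _; split=> // g Jg ng; rewrite sf; apply: nmin.
    by apply/asboolP; exists g.
  apply: contrapT => nf; apply: nfg.
  exists (size s), (fun i => s`_i); apply/seteqP; split=> [f Jf|].
    have : ideal_span [set g | g \in s] f.
      by apply: contrapT => nsf; apply: nf; exists f.
    apply: ideal_span_mono => g /= gs.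
    have gi : (index g s < size s)%N by rewrite index_mem.
    by exists (Ordinal gi) => //=; rewrite nth_index.
  by apply: ideal_span_le => // _ [i _ <-]; apply: sJ; rewrite mem_nth.
have [nxt nxtP] := choice step.
pose s k := iter k (fun s => rcons s (nxt s)) [::].
pose f k := nxt (s k).
have memS k g : g \in s k -> exists2 i, (i < k)%N & g = f i.
  elim: k => //= k IH; rewrite mem_rcons in_cons => /orP[/eqP ->|/IH[i ik ->]].
    by exists k.
  by exists i => //; rewrite (leq_trans ik).
have memF i k : (i < k)%N -> f i \in s k.
  elim: k => //= k IH; rewrite ltnS leq_eqVlt mem_rcons in_cons => /orP[/eqP ->|/IH ->].
    by rewrite eqxx.
  by rewrite orbT.
have sJ k : {in s k, forall f, J f}.
  elim: k => //= k IH g; rewrite mem_rcons in_cons => /orP[/eqP ->|/IH //].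
  by have [] := nxtP _ IH.
have fP k : good (s k) (f k) by exact: nxtP (sJ k).
have fle i k : (i <= k)%N -> (size (f i) <= size (f k))%N.
  move=> ik; have [_ _] := fP i; apply; have [Jk nk _] := fP k => // sp.
  apply: nk; apply: ideal_span_mono sp => g /= /memS[j ji ->].
  by apply: memF; apply: leq_trans ik.
have [N /ideal_spanP[T [c [a [aG aE]]]]] := noeth_seq nB (fun k => lead_coef (f k)).
have /choice[u uP] j : exists i, (i < N)%N /\ lead_coef (f i) = a j.
  by case: (aG j) => i iN <-; exists i.
pose h := \sum_j (c j *: 'X^(size (f N) - size (f (u j)))) * f (u j).
have hs : ideal_span [set g | g \in s N] h.
  apply/ideal_spanP; exists T, (fun j => c j *: 'X^(size (f N) - size (f (u j)))), (f \o u).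
  by split=> // j /=; apply: memF; case: (uP j).
have [JN nN Nmin] := fP N.
have spi := ideal_span_ideal [set g | g \in s N].
have fN0 : f N != 0 by apply: contra_notN nN => /eqP ->; case: spi.
have nh : ~ ideal_span [set g | g \in s N] (f N - h).
  by move=> H; apply: nN; rewrite -(subrK h (f N)); case: spi => _ + _; apply.
have Jh : J (f N - h).
  apply: idealB => //; apply: ideal_span_le hs => //; exact: sJ.
have := Nmin _ Jh nh; rewrite leqNgt => /negP[].
have sN : (0 < size (f N))%N by rewrite size_poly_gt0.
rewrite -[X in (_ < X)%N](prednK sN) ltnS; apply/leq_sizeP => k.
rewrite leq_eqVlt coefB coef_sum => /orP[/eqP <-|].
  rewrite -/(lead_coef (f N)) aE; apply/eqP; rewrite subr_eq0; apply/eqP.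
  apply: eq_bigr => j _; rewrite -scalerAl coefZ coefXnM.
  have [jN <-] := uP j; have := fle _ _ (ltnW jN); move: (size (f N)) sN => n n0 le.
  have [l0|l0] := posnP (size (f (u j))).
    have /eqP -> : f (u j) == 0 by rewrite -size_poly_eq0 l0.
    by rewrite lead_coef0 coef0; case: ifP.
  have -> : (n.-1 < n - size (f (u j)))%N = false by lia.
  by congr (_ * (f _)`_ _); lia.
rewrite prednK // => kN; rewrite nth_default // big1 ?subrr // => j _.
rewrite -scalerAl coefZ coefXnM; case: ifP => _; rewrite ?mulr0 //.
have [jN _] := uP j; have := fle _ _ (ltnW jN) => le.
rewrite nth_default ?mulr0 //; move: le kN.
by move: (size (f N)) (size (f (u j))) => a1 a2; clear; lia.
Qed.

(** Send the variable of the univariate polynomials over the n first variables to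
    the last one. *)
Lemma noeth_mpoly (B : comNzRingType) n : is_noetherian B -> is_noetherian {mpoly B[n]}.
Proof.
move=> nB; elim: n => [|n IH].
  have sf (y : {mpoly B[0]}) : exists x, mpolyC 0 x = y by exists (y@_0); rewrite -nvar0_mpolyC.
  exact: (noeth_surj sf nB).
pose f : {rmorphism {poly {mpoly B[n]}} -> {mpoly B[n.+1]}} :=
  (horner_eval ('X_ord_max : {mpoly B[n.+1]}) \o (@mpwiden n B))%FUN.
have fE p : f p = (mpwiden p).['X_ord_max] by [].
apply: (@noeth_surj _ _ f); last exact: noeth_poly.
move=> y; exists (muni y); rewrite fE muniE.
rewrite [mpwiden _]raddf_sum horner_sum [RHS]mpolyE; apply: eq_bigr => m _.
rewrite [X in X.[_]]mpwidenZ hornerZ mwidenZ mwidenX rmorphXn /= mpwidenX hornerXn.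
rewrite -scalerAl mpolyXn -mpolyXD; congr (_ *: 'X_[_]).
apply/mnmP => i; rewrite mnmDE mulmnE mnm1E.
case: (unliftP ord_max i) => [j|] ->; last by rewrite mnmwiden_ordmax eqxx mul1n.
have -> : lift ord_max j = widen_ord (leqnSn n) j by apply: val_inj; rewrite /= /bump leqNgt ltn_ord.
rewrite mnmwiden_widen mnmE; case: eqP => [/(congr1 val)/= jn|]; last by rewrite addn0.
by have := ltn_ord j; rewrite -jn ltnn.
Qed.
(** * Powers of an ideal: Artin-Rees and Krull's intersection theorem *)

Lemma pihomogMr n (R : comNzRingType) d e (a g : {mpoly R[n]}) :
  g \is d.-homog -> pihomog mdeg (e + d) (a * g) = pihomog mdeg e a * g.
Proof.
move=> gd; pose k := maxn (msize a) e.+1.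
rewrite {1}(@pihomog_partitionE _ _ mdeg k a) ?leq_maxl // mulr_suml raddf_sum /=.
have ek : (e < k)%N by rewrite leq_maxr.
rewrite (bigD1 (Ordinal ek)) //= big1 ?addr0 => [|i ie].
  by rewrite pihomog_dE //; apply: dhomogM => //; apply: pihomogP.
apply: (@pihomog_ne0 _ _ _ (i + d)%N); first by rewrite eqn_add2r.
by apply: dhomogM => //; apply: pihomogP.
Qed.

Section Powers.
Variables (B : comNzRingType) (d : nat) (x : 'I_d -> B).

(** The n-th power of the ideal of the x i. Writing its elements as values of
    forms is what makes Hilbert's theorem, for the ring of these forms, yield
    Artin-Rees. *)
Definition kpow n : set B := [set f.@[x] | f in [set f : {mpoly B[d]} | f \is n.-homog]].

Lemma kpow_ideal n : is_ideal (kpow n).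
Proof.
split=> [|_ _ [f fn <-] [g gn <-]|a _ [f fn <-]].
- by exists 0; rewrite ?meval0 //=; apply: rpred0.
- by exists (f + g); rewrite ?mevalD //=; apply: rpredD.
- by exists (a *: f); rewrite ?mevalZ //=; apply: rpredZ.
Qed.

Lemma kpow0 v : kpow 0 v.
Proof.
exists v%:MP; last by rewrite mevalC.
by rewrite /= -[v%:MP]mulr1 mul_mpolyC; apply/rpredZ/dhomog1.
Qed.

Lemma kpowM m n u v : kpow m u -> kpow n v -> kpow (m + n) (u * v).
Proof. by move=> [f fm <-] [g gn <-]; exists (f * g); [apply: dhomogM|rewrite mevalM]. Qed.

Lemma kpow_mon_deg a : kpow (mdeg a) ('X_[a]).@[x].
Proof. by exists 'X_[a] => //=; rewrite dhomogX. Qed.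

Lemma kpowS n : kpow n.+1 `<=` kpow n.
Proof.
move=> _ [f fn <-]; rewrite [f]mpolyE raddf_sum big_seq /=.
have [K0 KD KM] := kpow_ideal n.
apply: (big_ind (kpow n)) => // a af; rewrite mevalZ; apply: KM => {K0 KD}.
have dega : mdeg a = n.+1 by exact: (dhomog_mf fn).
have [i ai] : exists i, a i != 0%N.
  apply: contrapT => na; move: dega; rewrite mdegE big1 // => i _.
  by apply/eqP; apply: contra_notT na => ?; exists i.
have le : (U_(i) <= a)%MM by rewrite lep1mP.
rewrite -(submK le) mpolyXD mevalM mulrC.
apply: (let: And3 _ _ H := kpow_ideal n in H).
have -> : n = mdeg (a - U_(i))%MM.
  by have := congr1 (@mdeg d) (submK le); rewrite mdegD mdeg1 dega; lia.
exact: kpow_mon_deg.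
Qed.

Lemma kpow_le m n : (m <= n)%N -> kpow n `<=` kpow m.
Proof.
elim: n => [|n IH]; first by rewrite leqn0 => /eqP ->.
rewrite leq_eqVlt => /orP[/eqP -> //|mn]; apply: subset_trans (@kpowS n) _.
exact: IH.
Qed.

Lemma kpow_mon n a : (n <= mdeg a)%N -> kpow n ('X_[a]).@[x].
Proof. by move=> /kpow_le; apply; exact: kpow_mon_deg. Qed.

Lemma kpow1 : kpow 1 = ideal_span (range x).
Proof.
apply/seteqP; split; last first.
  apply: ideal_span_le; first exact: kpow_ideal.
  by move=> _ [i _ <-]; exists (mpolyX B U_(i)); [rewrite /= dhomogX /= mdeg1|rewrite mevalXU].
move=> _ [f fn <-]; rewrite [f]mpolyE raddf_sum big_seq /=.
have [K0 KD KM] := ideal_span_ideal (range x).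
apply: (big_ind (ideal_span (range x))) => // a af; rewrite mevalZ; apply: KM.
have /eqP/mdeg1P[i /eqP ->] := dhomog_mf fn af.
by rewrite mevalXU; apply: ideal_span_gen; exists i.
Qed.

Lemma ideal_powerS J n u v : @ideal_power B J n u -> J v -> ideal_power J n.+1 (u * v).
Proof.
move=> /ideal_spanP[T [a [g [gJ ->]]]] Jv; apply/ideal_spanP.
exists T, a, (fun j => g j * v); rewrite mulr_suml; split=> [j|]; last first.
  by apply: eq_bigr => j _; rewrite mulrA.
have [h hJ <-] := gJ j.
exists (fun i => if unlift ord_max i is Some i' then h i' else v) => [i /=|].
  by case: unliftP.
rewrite big_ord_recr /= unlift_none; congr (_ * _); apply: eq_bigr => i _.
have -> : widen_ord (leqnSn n) i = lift ord_max i.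
  by apply: val_inj; rewrite /= /bump leqNgt ltn_ord.
by rewrite liftK.
Qed.

Lemma ideal_power_kpow n : ideal_power (ideal_span (range x)) n = kpow n.
Proof.
apply/seteqP; split.
  apply: ideal_span_le; first exact: kpow_ideal.
  move=> _ [g gJ <-]; elim: n g gJ => [|n IH] g gJ; first exact: kpow0.
  rewrite big_ord_recr /= -[X in kpow X]addn1; apply: kpowM; last by rewrite kpow1; apply: gJ.
  by apply: IH => j; apply: gJ.
move=> _ [f fn <-]; rewrite [f]mpolyE raddf_sum big_seq /=.
have [K0 KD KM] := ideal_span_ideal [set \prod_j g j | g in [set g : 'I_n -> B | forall j, ideal_span (range x) (g j)]].
apply: (big_ind (ideal_power _ n)) => // a af; rewrite mevalZ; apply: KM.
have {fn af} := dhomog_mf fn af; move=> /= an.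
elim: n a an {K0 KD} => [|n IH] a an.
  have /eqP -> : a == 0%MM by rewrite -mdeg_eq0 an.
  rewrite mpolyX0 meval1; apply: ideal_span_gen.
  by exists (fun=> 0); [case|rewrite big_ord0].
have [i ai] : exists i, a i != 0%N.
  apply: contrapT => na; move: an; rewrite mdegE big1 // => i _.
  by apply/eqP; apply: contra_notT na => ?; exists i.
have le : (U_(i) <= a)%MM by rewrite lep1mP.
rewrite -(submK le) mpolyXD mevalM; apply: ideal_powerS.
  by apply: IH; have := congr1 (@mdeg d) (submK le); rewrite mdegD mdeg1 an; lia.
by rewrite mevalXU; apply: ideal_span_gen; exists i.
Qed.

Hypothesis nB : is_noetherian B.

(** Artin-Rees: the forms whose value lies in N generate an ideal of the
    polynomial ring, hence the one generated by finitely many such forms; c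
    bounds their degrees. *)
Lemma artin_rees N : is_ideal N -> exists c, forall n v, (c <= n)%N ->
  kpow n v -> N v -> exists (T : finType) (h b : T -> B),
    (forall j, kpow (n - c) (h j) /\ N (b j)) /\ v = \sum_j h j * b j.
Proof.
move=> Ni; pose G := [set f : {mpoly B[d]} | exists n, f \is n.-homog /\ N f.@[x]].
have [T [g [gG gs]]] := noeth_fin_gen (noeth_mpoly (n := d) nB) G.
have [e eP] := choice gG.
pose c := (\max_j e j)%N; exists c => n v cn [f fn <-] Nf.
have [|a fE] := gs f; first by exists n.
have ec j : (e j <= c)%N by rewrite /c (bigD1 j) //= leq_maxl.
exists T, (fun j => (pihomog mdeg (n - e j) (a j)).@[x]), (fun j => (g j).@[x]).
split=> [j|].
  split; last by case: (eP j).
  apply: (@kpow_le _ (n - e j)); first by rewrite leq_sub2l.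
  by exists (pihomog mdeg (n - e j) (a j)) => //; apply: pihomogP.
rewrite -{1}(pihomog_dE fn) fE [pihomog _ _ _]raddf_sum [LHS]raddf_sum; apply: eq_bigr => j _ /=.
rewrite -mevalM -(pihomogMr _ _ (eP j).1).
by rewrite subnK // (leq_trans (ec j)).
Qed.

(** Krull's intersection theorem. By Artin-Rees for N + (v), the part of v in
    K^(c+1) lies in K (N + (v)), so that v lies in K v modulo N. *)
Lemma krull_intersection N v : is_ideal N ->
  (forall n, ideal_add N (kpow n) v) -> exists2 k, kpow 1 k & N ((1 - k) * v).
Proof.
move=> Ni Hv; have vi := principal_ideal v.
have [c cP] := artin_rees (ideal_add_ideal Ni vi).
have [a [k [Na Kk e]]] := Hv c.+1.
have [|T [h [b [hb kE]]]] := cP _ k (leqnSn c) Kk.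
  have -> : k = v - a by rewrite e; ring.
  apply: idealB; [exact: ideal_add_ideal|apply: ideal_addr|exact: ideal_addl] => //.
  by exists 1; rewrite mul1r.
have /choice[w wP] j : exists w : B * B, N w.1 /\ b j = w.1 + w.2 * v.
  by case: (hb j) => _ [a' [_ [Na' [q ->] ->]]]; exists (a', q).
have Kc j : kpow 1 (h j) by have [] := hb j; rewrite subSnn.
exists (\sum_j h j * (w j).2).
  apply: ideal_sum; first exact: kpow_ideal.
  by move=> j _; rewrite mulrC; case: (kpow_ideal 1) => _ _; apply.
have -> : (1 - \sum_j h j * (w j).2) * v = a + \sum_j h j * (w j).1.
  rewrite mulrBl mul1r {1}e kE mulr_suml.
  under eq_bigr do rewrite (wP _).2 mulrDr mulrA.
  by rewrite big_split addrA addrK.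
case: (Ni) => _ ND NM; apply: (ND) => //; apply: ideal_sum => // j _.
by apply: NM; case: (wP j).
Qed.

(** Artin-Rees for (y) + Q: on the domain B/Q, an element of K^n divisible by y is
    y times an element of K^(n-c). *)
Lemma artin_rees_colon Q y : is_prime_ideal Q -> ~ Q y ->
  exists c, forall n z, (c <= n)%N -> ideal_add Q (kpow n) (y * z) ->
    ideal_add Q (kpow (n - c)) z.
Proof.
move=> [Qi Q1 QM] Qy; have yi := principal_ideal y.
have [c cP] := artin_rees (ideal_add_ideal Qi yi).
exists c => n z cn [q [v [Qq Kv e]]].
have [|T [h [b [hb vE]]]] := cP n v cn Kv.
  have -> : v = y * z - q by rewrite e; ring.
  apply: idealB; [exact: ideal_add_ideal|apply: ideal_addr|exact: ideal_addl] => //.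
  by exists z; rewrite mulrC.
have /choice[w wP] j : exists w : B * B, Q w.1 /\ b j = w.1 + w.2 * y.
  by case: (hb j) => _ [a' [_ [Qa' [t ->] ->]]]; exists (a', t).
pose k := \sum_j h j * (w j).2.
exists (z - k), k; split; last by rewrite subrK.
  suff : Q (y * (z - k)) by case/QM.
  have -> : y * (z - k) = q + \sum_j h j * (w j).1.
    rewrite mulrBr e vE /k mulr_sumr; under eq_bigr do rewrite (wP _).2.
    have -> : \sum_j y * (h j * (w j).2) = \sum_j (h j * ((w j).2 * y)).
      by apply: eq_bigr => j _; ring.
    by under eq_bigr do rewrite mulrDr; rewrite big_split /=; ring.
  case: (Qi) => _ QD QMl; apply: QD => //; apply: ideal_sum => // j _.
  by apply: QMl; case: (wP j).
apply: ideal_sum; first exact: kpow_ideal.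
move=> j _; rewrite mulrC; case: (kpow_ideal (n - c)) => _ _; apply.
by case: (hb j).
Qed.

End Powers.
(** * Lengths in a Noetherian local ring *)

Section Chains.
Variable B : comNzRingType.
Implicit Types (J : set B) (L : nat).

(** J < C_1 < ... < C_L <= J'. The length of J'/J enters only through the number
    of steps of such chains. *)
Fixpoint ideal_chain L (J J' : set B) : Prop :=
  if L is L'.+1 then
    exists C, [/\ is_ideal C, J `<=` C, ~ (C `<=` J) & ideal_chain L' C J']
  else J `<=` J'.

Lemma chain_cat L1 L2 J1 J2 J3 :
  ideal_chain L1 J1 J2 -> ideal_chain L2 J2 J3 -> ideal_chain (L1 + L2) J1 J3.
Proof.
elim: L1 J1 => [|L IH] J1 /=; last first.
  by move=> [C [Ci J1C CJ1 CJ2]] /(IH _ CJ2) H; exists C.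
case: L2 => [|L] J12 /=; first exact: subset_trans.
by move=> [C [Ci J2C CJ2 H]]; exists C; split=> // [|CJ1]; [apply: subset_trans J2C|apply: CJ2; apply: subset_trans J12].
Qed.

Lemma chain_mono L J1 J2 J3 J4 : J1 `<=` J2 -> J3 `<=` J4 ->
  ideal_chain L J2 J3 -> ideal_chain L J1 J4.
Proof.
move=> J12 J34 H; have := @chain_cat 0 L _ _ _ J12 H; rewrite add0n => {}H.
by have := @chain_cat L 0 _ _ _ H J34; rewrite addn0.
Qed.

End Chains.

Section LocalRing.
Variables (B : comNzRingType) (d : nat) (x : 'I_d -> B).
Hypothesis nB : is_noetherian B.
Local Notation K := (kpow x).
Hypothesis K1 : ~ K 1 1.
Hypothesis Kloc : forall u, ~ K 1 u -> exists v, v * u = 1.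

Lemma prime_sub_max Q : is_prime_ideal Q -> Q `<=` K 1.
Proof.
move=> [[_ _ QM] Q1 _] u Qu; apply: contrapT => /Kloc[v vu]; apply: Q1.
by rewrite -vu; apply: QM.
Qed.

Local Notation len Q n L := (ideal_chain L (ideal_add Q (K n)) setT).

(** Choose y in Q' outside Q. Multiplication by y carries chains above Q + K^(n-c)
    to chains between Q + K^n and Q' + K^n, strictness surviving by Artin-Rees;
    these are continued by chains above Q' + K^n. *)
Lemma chain_step Q Q' : is_prime_ideal Q -> is_prime_ideal Q' -> Q `<` Q' ->
  exists c, forall n L L', (c <= n)%N ->
    len Q (n - c) L -> len Q' n L' -> len Q n (L + L').
Proof.
move=> Qp Q'p [QQ' Q'Q].
have [y Q'y Qy] : exists2 y, Q' y & ~ Q y.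
  apply: contrapT => ny; apply: Q'Q => y Q'y; apply: contrapT => Qy.
  by apply: ny; exists y.
have [c cP] := artin_rees_colon x nB Qp Qy; exists c => n L L' cn.
have [Qi Q'i] : is_ideal Q /\ is_ideal Q' by case: Qp; case: Q'p.
have Ki := kpow_ideal x.
pose M := ideal_add Q (K n); have Mi : is_ideal M by exact: ideal_add_ideal.
pose im J : set B := ideal_add [set y * z | z in J] M.
have im_ideal J : is_ideal J -> is_ideal (im J).
  move=> [J0 JD JM]; apply: ideal_add_ideal => //; split.
  - by exists 0; rewrite ?mulr0.
  - by move=> _ _ [a Ja <-] [b Jb <-]; exists (a + b); rewrite ?mulrDr //; apply: JD.
  - by move=> r _ [a Ja <-]; exists (r * a); [apply: JM|ring].
have map_chain l J J' : is_ideal J -> ideal_add Q (K (n - c)) `<=` J ->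
    ideal_chain l J J' -> ideal_chain l (im J) (im J').
  elim: l J => [|l IH] J Ji QJ /=.
    by move=> JJ' _ [_ [t [[z Jz <-] Mt ->]]]; exists (y * z), t; split=> //; exists z => //; exact: JJ'.
  move=> [C [Ci JC CJ H]]; exists (im C); split.
  - exact: im_ideal.
  - by move=> _ [_ [t [[z Jz <-] Mt ->]]]; exists (y * z), t; split=> //; exists z => //; exact: JC.
  - move=> CimJ; apply: CJ => z Cz.
    have [|_ [t [[w Jw <-] Mt e]]] := CimJ (y * z).
      by exists (y * z), 0; split; [exists z| case: Mi|rewrite addr0].
    have : J (z - w).
      by apply/QJ/cP => //; rewrite mulrBr e addrC addKr.
    by move=> Jzw; rewrite -(subrK w z); case: Ji => _ + _; apply.
  - by apply: IH => //; apply: subset_trans JC.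
move=> Hc H2.
have H1 := map_chain _ _ _ (ideal_add_ideal Qi (Ki (n - c)%N)) (fun _ H => H) Hc.
apply: (chain_cat (J2 := ideal_add Q' (K n))) => //.
apply: chain_mono H1.
  move=> z Mz; exists 0, z; split=> //; last by rewrite add0r.
  by exists 0; rewrite ?mulr0 //; case: (ideal_add_ideal Qi (Ki (n - c)%N)).
move=> _ [_ [t [[z _ <-] [a [k [Qa Kk ->]]] ->]]].
exists (y * z + a), k; rewrite addrA; split=> //.
case: Q'i => _ Q'D Q'M; apply: Q'D; last exact: QQ'.
by rewrite mulrC; apply: Q'M.
Qed.

(** Induction on t. By [chain_step] the length for Q 0 at n is at least the sum,
    over j < k, of the lengths for Q 1 at n - j a, and each of these is at least
    k^t. Thus the length of B / K^n grows at least like n^t. *)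
Lemma prime_chain_growth t (Q : nat -> set B) :
  (forall j, (j <= t)%N -> is_prime_ideal (Q j)) ->
  (forall j, (j < t)%N -> Q j `<` Q j.+1) ->
  exists2 c, (0 < c)%N & forall k, (0 < k)%N -> len (Q 0%N) (c * k) (k ^ t)%N.
Proof.
elim: t Q => [|t IH] Q Qp Qlt.
  exists 1%N => // k k0; rewrite mul1n expn0; exists setT; split=> // H.
  apply: K1; have [//|a [b [/(prime_sub_max (Qp 0%N isT)) Ka Kb ->]]] := H 1.
  by case: (kpow_ideal x 1) => _ KD _; apply: KD => //; apply: kpow_le Kb.
have [||c c0 cP] := IH (Q \o S) => [j jt|j jt|]; [exact: Qp|exact: Qlt|].
have [a aP] := chain_step (Qp 0%N isT) (Qp 1%N isT) (Qlt 0%N isT).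
exists (a + c)%N => [|k k0]; first by rewrite addn_gt0 c0 orbT.
suff H j n : (j * a + c * k <= n)%N -> len (Q 0%N) n (j * k ^ t)%N.
  by rewrite expnS; apply: H; rewrite mulnDl mulnC.
(* each of the j steps lowers n by a, keeping it above c k *)
elim: j n => [|j IHj] n le; first by rewrite mul0n.
rewrite mulSn addnC; apply: aP; first by apply: leq_trans le; rewrite mulSn -addnA leq_addr.
  by apply: IHj; rewrite leq_subRL; move: le; rewrite mulSn; lia.
apply: chain_mono (cP k k0) => // _ [u [v [Qu Kv ->]]]; exists u, v; split=> //.
by apply: kpow_le Kv; apply: leq_trans le; rewrite leq_addl.
Qed.

Implicit Types (S : pred 'X_{1..d}) (a b : 'X_{1..d}).
Local Notation mon a := (('X_[a] : {mpoly B[d]}).@[x]).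

Definition mon_span S : set B :=
  [set f.@[x] | f in [set f : {mpoly B[d]} | {subset msupp f <= S}]].

Local Notation above S a := [pred b : 'X_{1..d} | ((a : 'X_{1..d}) < b)%O && S b].
Local Notation gt a := (mon_span (above xpredT a)).

Lemma mon_span_ideal S : is_ideal (mon_span S).
Proof.
split=> [|_ _ [f fS <-] [g gS <-]|c _ [f fS <-]].
- by exists 0; rewrite ?meval0 // => a; rewrite msupp0.
- exists (f + g); rewrite ?mevalD // => a /msuppD_le.
  by rewrite mem_cat => /orP[/fS|/gS].
- by exists (c *: f); rewrite ?mevalZ // => a /msuppZ_le/fS.
Qed.

Lemma mon_span_sub S S' : {subset S <= S'} -> mon_span S `<=` mon_span S'.
Proof. by move=> SS' _ [f fS <-]; exists f => // a /fS/SS'. Qed.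

Lemma mon_span_mon S a : S a -> mon_span S (mon a).
Proof. by move=> Sa; exists 'X_[a] => // b; rewrite msuppX inE => /eqP ->. Qed.

(** Split off the least monomial. Exponents are ordered by degree first, so that
    removing least monomials climbs the K-adic filtration. *)
Lemma mon_spanP S v : mon_span S v -> v = 0 \/ exists b c w,
  [/\ S b, mon_span (above S b) w & v = c * mon b + w].
Proof.
move=> [f fS <-]; case: (eqVneq f 0) => [->|f0]; [by left; rewrite meval0|right].
have bf := mlast_supp f0; set b := mlast f in bf.
exists b, f@_b, (f - f@_b *: 'X_[b]).@[x]; split; first exact: fS.
  exists (f - f@_b *: 'X_[b]) => // a af.
  have ab : a != b.
    by apply: contraTneq af => ->; rewrite mcoeff_msupp mcoeffB mcoeffZ mcoeffX eqxx mulr1 subrr eqxx.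
  have {}af : a \in msupp f.
    by move: af; rewrite !mcoeff_msupp mcoeffB mcoeffZ mcoeffX [b == a]eq_sym (negPf ab) mulr0 subr0.
  by rewrite inE lt_neqAle eq_sym ab mlast_lemc //=; apply: fS.
by rewrite -mevalZ -mevalD addrC subrK.
Qed.

Lemma kpow_mon_span n S : (forall a, mdeg a = n -> S a) -> K n `<=` mon_span S.
Proof. by move=> nS _ [f fn <-]; exists f => // a af; apply: nS; apply: dhomog_mf af. Qed.

Lemma mon_span_kpow n S : (forall a, S a -> (n <= mdeg a)%N) -> mon_span S `<=` K n.
Proof.
move=> Sn _ [f fS <-]; rewrite [f]mpolyE raddf_sum big_seq /=.
case: (kpow_ideal x n) => K0 KD KM; apply: (big_ind (K n)) => // a /fS/Sn na.
by rewrite mevalZ; apply: KM; apply: kpow_mon.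
Qed.

Lemma monD a b : mon (a + b)%MM = mon a * mon b.
Proof. by rewrite mpolyXD mevalM. Qed.

Lemma monU i n : mon (U_(i) *+ n)%MM = x i ^+ n.
Proof. by rewrite -mpolyXn rmorphXn /= mevalXU. Qed.

Lemma mon_span_mulmon S S' b v : (forall a, S a -> S' (a + b)%MM) ->
  mon_span S v -> mon_span S' (v * mon b).
Proof.
move=> SS' [f fS <-]; exists (f * 'X_[b]); last by rewrite mevalM.
move=> a; rewrite (perm_mem (msuppMX _ _)) => /mapP[a' /fS Sa' ->]; rewrite addmC; exact: SS'.
Qed.

Lemma lt_addm a i : (a < (a + U_(i))%MM)%O.
Proof. by apply: lt_mdeg_ltmc; rewrite mdegD mdeg1 addn1. Qed.

Lemma mon_span_K S a c : (forall a i, S a -> S (a + U_(i))%MM) -> S a ->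
  K 1 c -> mon_span (above S a) (c * mon a).
Proof.
move=> Sup Sa; rewrite kpow1 => /range_span[e ->]; rewrite mulr_suml.
apply: ideal_sum; first exact: mon_span_ideal.
move=> i _; rewrite -mulrA -[x i]expr1 -(monU i 1) mulm1n -monD.
case: (mon_span_ideal (above S a)) => _ _; apply; apply: mon_span_mon.
by rewrite /= addmC lt_addm Sup.
Qed.

(** The leading exponents of elements outside K^n have degree less than n, so
    that there are finitely many. *)
Lemma max_lead S n (V : set B) : V !=set0 ->
  (forall v, V v -> mon_span S v /\ ~ K n v) ->
  exists v b c w, [/\ V v, S b, v = c * mon b + w, mon_span (above S b) w &
    forall v', V v' -> ~ mon_span (above S b) v'].
Proof.
move=> [v0 Vv0] VP.
pose rep v b := exists c w, [/\ S b, v = c * mon b + w & mon_span (above S b) w].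
pose P (b : 'X_{1..d < n}) := `[< exists2 v, V v & rep v b >].
have repP v : V v -> forall S0, {subset S0 <= S} -> mon_span S0 v ->
    exists2 b : 'X_{1..d < n}, S0 b & rep v b.
  move=> Vv S0 S0S S0v; have nKv := (VP v Vv).2.
  have [v00|[b [c [w [Sb Sw vE]]]]] := mon_spanP S0v.
    by case: nKv; rewrite v00; case: (kpow_ideal x n).
  have bn : (mdeg b < n)%N.
    rewrite ltnNge; apply/negP => nb; apply: nKv; rewrite vE.
    case: (kpow_ideal x n) => _ KD KM; apply: KD; first by apply: KM; apply: kpow_mon.
    apply: mon_span_kpow Sw => a /= /andP[/ltW/lemc_mdeg ba _].
    exact: leq_trans ba.
  exists (BMultinom bn) => //; exists c, w; split=> //; first exact: S0S.
  by apply: mon_span_sub Sw => a; rewrite !inE => /andP[-> /S0S].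
have [b0 _ r0] := repP v0 Vv0 S (fun _ H => H) (VP v0 Vv0).1.
have Pb0 : P b0 by apply/asboolP; exists v0.
have [b /asboolP[v Vv [c [w [Sb vE Sw]]]] bmax] := arg_maxP (fun b : 'X_{1..d < n} => (b : 'X_{1..d})) Pb0.
exists v, b, c, w; split=> // v' Vv' Sv'.
have [|b' /andP[bb' _] r'] := repP v' Vv' _ _ Sv'; first by move=> a; rewrite !inE => /andP[].
have : ((b' : 'X_{1..d}) <= b)%O by apply: bmax; apply/asboolP; exists v'.
by rewrite leNgt bb'.
Qed.

Lemma kpow_gt n a : (mdeg a < n)%N -> K n `<=` gt a.
Proof.
move=> an; apply: kpow_mon_span => b bn; rewrite /= andbT.
by apply: lt_mdeg_ltmc; rewrite bn.
Qed.

(** Call an exponent redundant if its monomial is a combination of larger ones;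
    multiples of redundant exponents are redundant. For an ideal C count the
    irredundant exponents of degree less than n that lead an element of C: this
    number increases strictly with C, and bounds the chain. *)
Lemma redundant_chain a n J L : gt a (mon a) -> is_ideal J -> K n `<=` J ->
  ideal_chain L J setT ->
  (L <= #|[pred b : 'X_{1..d < n} | ~~ (a <= b)%MM]|)%N.
Proof.
move=> red Ji nJ.
have redD b : (a <= b)%MM -> gt b (mon b).
  move=> ab; rewrite -(submK ab) addmC monD.
  apply: mon_span_mulmon red => c; rewrite /= !andbT => ac.
  by rewrite addmC [X in (_ < X)%O]addmC ltmc_add2r.
pose lam (C : set B) := [pred b : 'X_{1..d < n} |
  `[< ~ gt b (mon b) >] && `[< exists2 c, C c & gt b (mon b - c) >]].
have lam_lt C C' : is_ideal C -> is_ideal C' -> K n `<=` C -> C `<=` C' ->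
    ~ (C' `<=` C) -> (#|lam C| < #|lam C'|)%N.
  move=> Ci C'i nC CC' C'C; apply: proper_card; apply/fintype.properP; split.
    apply/fintype.subsetP => b; rewrite !inE => /andP[-> /asboolP[c Cc H]].
    by apply/asboolP; exists c => //; apply: CC'.
  have [||v [b [c [w [[C'v Cv] _ vE bw vmax]]]]] := @max_lead xpredT n [set v | C' v /\ ~ C v].
  - by apply: contrapT => V0; apply: C'C => v C'v; apply: contrapT => Cv; apply: V0; exists v.
  - move=> v [_ Cv]; split; last by move/nC.
    by apply: (mon_span_sub (S := [pred a | mdeg a == 0%N])) => //; apply: kpow_mon_span (kpow0 x v) => a' /= ->.
  have gti := mon_span_ideal (above xpredT b).
  have nb : ~ gt b (mon b).
    move=> bb; apply: (vmax v) => //; rewrite vE; case: gti => _ GD GM.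
    by apply: GD => //; apply: GM.
  have nKc : ~ K 1 c.
    move=> Kc; apply: (vmax v) => //; rewrite vE; case: (gti) => _ GD _; apply: GD => //.
    exact: mon_span_K.
  have bn : (mdeg b < n)%N.
    rewrite ltnNge; apply/negP => nb'; apply: Cv; apply: nC; rewrite vE.
    case: (kpow_ideal x n) => _ KD KM; apply: KD; first by apply: KM; apply: kpow_mon.
    apply: mon_span_kpow bw => a' /= /andP[/ltW/lemc_mdeg ba _].
    exact: leq_trans ba.
  have [u uc] := Kloc nKc.
  exists (BMultinom bn).
    rewrite !inE; apply/andP; split; apply/asboolP => //=; exists (u * v).
      by case: C'i => _ _; apply.
    rewrite vE mulrDr mulrA uc mul1r opprD addrA subrr add0r -mulN1r mulrA.
    by case: gti => _ _; apply.
  rewrite !inE; apply/negP => /andP[_ /asboolP[c0 Cc0 /= Gc0]].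
  apply: (vmax (v - c * c0)); last first.
    rewrite vE addrAC -mulrBr; case: gti => _ GD GM.
    by apply: GD => //; apply: GM.
  have Ccc : C (c * c0) by case: Ci => _ _; apply.
  split; first by apply: idealB => //; apply: CC'.
  by move=> /(let: And3 _ H _ := Ci in H _ (c * c0)) /(_ Ccc); rewrite subrK.
suff H C' : is_ideal C' -> ideal_chain L J C' -> (#|lam J| + L <= #|lam C'|)%N.
  move=> HL; have STi : is_ideal [set: B] by [].
  apply: leq_trans (leq_addl #|lam J| L) _; apply: leq_trans (H _ STi HL) _.
  apply: subset_leq_card; apply/fintype.subsetP => b; rewrite !inE.
  by case/andP => /asboolP nb _; apply: contra_notN nb => /redD.
elim: L J Ji nJ C' => [|L IH] J Ji nJ C' C'i /=.
  move=> JC; rewrite addn0; apply: subset_leq_card; apply/fintype.subsetP => b.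
  rewrite !inE => /andP[-> /asboolP[c Jc ?]] /=; apply/asboolP; exists c => //; exact: JC.
move=> [C [Ci JC CJ H]]; rewrite addnS -addSn.
apply: leq_trans (IH C Ci (subset_trans nJ JC) _ C'i H).
by rewrite leq_add2r; apply: lam_lt.
Qed.

End LocalRing.
(** * Regular local rings *)

(** An exponent b outside the cone of a has some b i < a i <= mdeg a; it is
    determined by i, b i and its other coordinates, which are less than n. *)
Lemma card_not_ge d (a : 'X_{1..d}) n :
  (#|[pred b : 'X_{1..d < n} | ~~ (a <= b)%MM]| <= d * mdeg a * n ^ d.-1)%N.
Proof.
case: d a => [|d] a.
  rewrite eq_card0 // => b; rewrite !inE; apply/negbTE; rewrite negbK.
  by apply/mnm_lepP => -[].
case: (posnP n) => [->|n0].
  by rewrite eq_card0 // => b; have := bmdeg b.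
have n0' : n = n.-1.+1 by rewrite prednK.
have small (b : 'X_{1..d.+1 < n}) i : (b i < n.-1.+1)%N.
  by rewrite -n0'; apply: leq_ltn_trans (bmdeg b); rewrite mdegE (bigD1 i) //= leq_addr.
pose wit (b : 'X_{1..d.+1 < n}) : 'I_d.+1 := odflt ord0 [pick i | (b i < a i)%N].
have witP b : ~~ (a <= (b : 'X_{1..d.+1 < n}))%MM -> (b (wit b) < a (wit b))%N.
  rewrite /wit; case: pickP => //= nb; case/negP; apply/mnm_lepP => i.
  by rewrite leqNgt nb.
case: (posnP (mdeg a)) => [a0|a0].
  rewrite eq_card0 // => b; rewrite !inE; apply/negbTE; rewrite negbK.
  by move/eqP: a0; rewrite mdeg_eq0 => /eqP ->; apply/mnm_lepP => i; rewrite mnm0E.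
have a0' : mdeg a = (mdeg a).-1.+1 by rewrite prednK.
pose code b : 'I_d.+1 * 'I_(mdeg a).-1.+1 * {ffun 'I_d -> 'I_n.-1.+1} :=
  (wit b, inord (b (wit b)), [ffun j => inord (b (lift (wit b) j))]).
have -> : (d.+1 * mdeg a * n ^ d = #|{: 'I_d.+1 * 'I_(mdeg a).-1.+1 * {ffun 'I_d -> 'I_n.-1.+1}}|)%N.
  by rewrite !card_prod !card_ord card_ffun !card_ord -a0' -n0'.
rewrite -(card_in_imset (f := code)); first exact: max_card.
move=> b c; rewrite !inE => /witP nb /witP nc [] => e1 e2 e3.
apply: val_inj; apply/mnmP => i.
have lta (b' : 'X_{1..d.+1 < n}) : (b' (wit b') < a (wit b'))%N -> (b' (wit b') < (mdeg a).-1.+1)%N.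
  rewrite -a0' => /leq_trans; apply; rewrite mdegE (bigD1 (wit b')) //= leq_addr.
  by [].
have e4 : b (wit b) = c (wit c).
  by have := congr1 val e2; rewrite /= !inordK //; apply: lta.
case: (unliftP (wit b) i) => [j|] ->; last by rewrite e4 e1.
have := congr1 (fun f : {ffun 'I_d -> 'I_n.-1.+1} => val (f j)) e3.
by rewrite /= !ffunE !inordK // e1.
Qed.

Section RegularLocalRing.
Variables (B : comNzRingType) (d : nat) (x : 'I_d -> B).
Hypothesis nB : is_noetherian B.
Local Notation K := (kpow x).
Hypothesis K1 : ~ K 1 1.
Hypothesis Kloc : forall u, ~ K 1 u -> exists v, v * u = 1.
Hypothesis dimB : has_prime_chain B d.

Local Notation mon a := (('X_[a] : {mpoly B[d]}).@[x]).
Local Notation above S a := [pred b : 'X_{1..d} | ((a : 'X_{1..d}) < b)%O && S b].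
Local Notation gt a := (mon_span x (above xpredT a)).

(** Otherwise the length of B / K^n would be O(n^(d-1)), against the growth n^d
    given by a chain of d+1 primes. This says that the graded ring of B along K
    is a polynomial ring. *)
Lemma regular_irredundant a : ~ gt a (mon a).
Proof.
move=> red; have [Q [Qp Qlt]] := dimB.
have [c c0 cP] := prime_chain_growth nB K1 Kloc Qp Qlt.
have H k : (0 < k)%N -> (k ^ d <= d * mdeg a * (c * k) ^ d.-1)%N.
  move=> k0; apply: leq_trans (card_not_ge a (c * k)).
  have [Q0i _ _] := Qp 0%N isT.
  apply: (redundant_chain Kloc red) (cP k k0).
    exact: ideal_add_ideal (kpow_ideal _ _).
  exact: ideal_addr.
(* this k exceeds the ratio of the upper bound to k^(d-1) *)
have := H (d * mdeg a * c ^ d.-1).+1 isT; case: d a {red H} => [|e] a.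
  by rewrite !mul0n.
rewrite /= expnMn mulnA expnS leq_mul2r ltnn orbF expn_eq0 /=.
by [].
Qed.

Variable q : nat.

Local Notation xq j := (ideal_span [set x i ^+ q | i in [set i : 'I_d | (i < j)%N]]).
Local Notation mult j := [pred b : 'X_{1..d} | [exists i : 'I_d, (i < j)%N && (q <= b i)%N]].

Lemma mult_up j b b' : mult j b -> mult j (b + b')%MM.
Proof.
move=> /existsP[i /andP[ij qb]]; apply/existsP; exists i.
by rewrite ij mnmDE (leq_trans qb) ?leq_addr.
Qed.

Lemma span_powers j : xq j = mon_span x (mult j).
Proof.
apply/seteqP; split.
  apply: ideal_span_le; first exact: mon_span_ideal.
  move=> _ [i /= ij <-]; rewrite -monU; apply: mon_span_mon.
  by apply/existsP; exists i; rewrite ij mulmnE mnm1E eqxx mul1n leqnn.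
move=> _ [f fS <-]; rewrite [f]mpolyE raddf_sum big_seq /=.
have [J0 JD JM] := ideal_span_ideal [set x i ^+ q | i in [set i : 'I_d | (i < j)%N]].
apply: (big_ind (xq j)) => // a /fS/existsP[i /andP[ij qa]]; rewrite mevalZ; apply: (JM).
have le : (U_(i) *+ q <= a)%MM.
  apply/mnm_lepP => l; rewrite mulmnE mnm1E; case: eqP => [<-|_]; last by rewrite mul0n.
  by rewrite mul1n.
rewrite -(submK le) monD monU; apply: JM; apply: ideal_span_gen.
by exists i.
Qed.

(** Write the element with exponents in S and compare the two leading terms: if
    the exponents differed, the smaller one would be redundant. *)
Lemma mon_span_lead (S : pred 'X_{1..d}) a c w :
  (forall b i, S b -> S (b + U_(i))%MM) ->
  mon_span x S (c * mon a + w) -> ~ K 1 c -> gt a w -> S a.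
Proof.
move=> Sup Sv nKc aw; set v := c * mon a + w in Sv.
have [u uc] := Kloc nKc.
have lead (b : 'X_{1..d}) c' w' : ~ K 1 c' -> v = c' * mon b + w' -> gt b w' -> ~ gt b v.
  move=> /Kloc[u' u'c'] -> bw' bv; apply: (@regular_irredundant b).
  have bi := mon_span_ideal x (above xpredT b).
  rewrite -[mon b]mul1r -u'c' -mulrA; case: (bi) => _ _; apply.
  by rewrite -[_ * mon b](addrK w'); apply: idealB.
have sub (b : 'X_{1..d}) : {subset above S b <= above xpredT b}.
  by move=> e; rewrite !inE => /andP[->].
have [||_ [b [c' [w' [-> Sb vE bw' vmax]]]]] := @max_lead _ _ x S (mdeg a).+1 [set v].
- by exists v.
- by move=> _ ->; split=> // /kpow_gt-/(_ a (leqnn _)); apply: lead nKc erefl aw.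
have nKc' : ~ K 1 c'.
  move=> Kc'; apply: (vmax v erefl); rewrite vE.
  case: (mon_span_ideal x (above S b)) => _ GD _; apply: GD => //.
  exact: mon_span_K.
have gtb (e e' : 'X_{1..d}) (c1 w1 : B) : (e < e')%O -> v = c1 * mon e' + w1 -> gt e' w1 -> gt e v.
  move=> ee' -> w1e'; case: (mon_span_ideal x (above xpredT e)) => _ GD GM.
  apply: GD; first by apply/GM/mon_span_mon; rewrite /= ee'.
  by apply: mon_span_sub w1e' => e''; rewrite !inE !andbT; apply: lt_trans.
have bw'' : gt b w' by apply: mon_span_sub bw'; exact: sub.
case: (ltgtP a b) => [ab|ba|-> //].
  by case: (lead _ _ _ nKc erefl aw); apply: gtb ab vE bw''.
by case: (lead _ _ _ nKc' vE bw''); apply: gtb ba erefl aw.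
Qed.

(** The x i ^ q form a regular sequence. By Krull's theorem it suffices to place u
    in the ideal modulo every K^n; otherwise take an element of u + (x_i^q, i < j)
    with the largest leading exponent b. Multiplied by x_j^q it has leading exponent
    b + q e_j, which by [mon_span_lead] is at least q in some coordinate i < j;
    so is b, and the leading term can be removed. *)
Lemma powers_regular (j : 'I_d) u : xq j (u * x j ^+ q) -> xq j u.
Proof.
rewrite span_powers => ux.
have Ji := mon_span_ideal x (mult j).
suff H n : ideal_add (mon_span x (mult j)) (K n) u.
  have [k Kk Jk] := krull_intersection nB Ji H.
  have [|v v1] := Kloc (u := 1 - k).
    move=> K1k; apply: K1; rewrite -(subrK k 1).
    by case: (kpow_ideal x 1) => _ + _; apply.
  by rewrite -[u]mul1r -v1 -mulrA; case: Ji => _ _; apply.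
apply: contrapT => nu.
pose V := [set v | exists2 a, mon_span x (mult j) a & v = u + a].
have [||_ [b [c [w [[a Ja ->] _ vE bw vmax]]]]] := @max_lead _ _ x xpredT n V.
- by exists u, 0; [case: Ji|rewrite addr0].
- move=> _ [a Ja ->]; split; last first.
    move=> Ku; apply: nu; exists (- a), (u + a); split=> //; last by ring.
    by rewrite -mulN1r; case: Ji => _ _; apply.
  apply: (mon_span_sub (S := [pred a | mdeg a == 0%N])) => //.
  by apply: kpow_mon_span (kpow0 x _) => a' /= ->.
have nKc : ~ K 1 c.
  move=> Kc; apply: (vmax (u + a)); first by exists a.
  rewrite vE; case: (mon_span_ideal x (above xpredT b)) => _ GD _; apply: GD => //.
  exact: mon_span_K.
case: (boolP (mult j b)) => [Sb|nSb].
  apply: (vmax w) => //; exists (a - c * mon b); last by rewrite addrA vE addrC addKr.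
  apply: idealB => //; case: Ji => _ _; apply; exact: mon_span_mon.
have : mult j (b + U_(j) *+ q)%MM.
  apply: (@mon_span_lead _ _ c (w * x j ^+ q)) => //.
  - by move=> b' i; apply: mult_up.
  - rewrite monD monU mulrA -mulrDl -vE mulrDl.
    case: Ji => _ JD JM; apply: JD => //; rewrite mulrC; exact: JM.
  - rewrite -monU; apply: mon_span_mulmon bw => e; rewrite /= !andbT => be.
    by rewrite ltmc_add2l.
case/existsP => i /andP[ij]; rewrite mnmDE mulmnE mnm1E.
case: eqP => [e|_]; first by rewrite -e ltnn in ij.
by rewrite mul0n addn0 => qb; case/negP: nSb; apply/existsP; exists i; rewrite ij.
Qed.

End RegularLocalRing.
(** * Flatness of the Frobenius map, ideal by ideal *)

Lemma big_option (V : zmodType) (I : finType) (F : option I -> V) :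
  \sum_o F o = F None + \sum_i F (Some i).
Proof.
rewrite (bigD1 None) //=; congr (_ + _).
rewrite (reindex_omap Some id) /=; first by apply: eq_bigl => i; rewrite eqxx.
by case.
Qed.

Section FrobeniusFlat.
Variables (B : comNzRingType) (q : nat).
Hypothesis q0 : (0 < q)%N.
Hypothesis qD : forall a b : B, (a + b) ^+ q = a ^+ q + b ^+ q.

Lemma frobN (a : B) : (- a) ^+ q = - a ^+ q.
Proof. by apply/eqP; rewrite -subr_eq0 opprK -qD addNr expr0n eqn0Ngt q0. Qed.

Lemma frob_sum (I : Type) (s : seq I) (P : pred I) (F : I -> B) :
  (\sum_(i <- s | P i) F i) ^+ q = \sum_(i <- s | P i) F i ^+ q.
Proof.
apply: (big_morph (fun a => a ^+ q)) => //.
by rewrite expr0n eqn0Ngt q0.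
Qed.

(** For a submodule S of the free module B^I: the image in B^I of the base change of
    S along x |-> x ^ q. *)
Definition frob_span (I : Type) (S : set (I -> B)) (y : I -> B) :=
  exists (T : finType) (b : T -> B) (Z : T -> I -> B),
    (forall j, S (Z j)) /\ forall i, y i = \sum_j b j * Z j i ^+ q.

Lemma frob_span0 I (S : set (I -> B)) y : (forall i, y i = 0) -> frob_span S y.
Proof.
move=> y0; exists void, (fun=> 0), (fun=> fun=> 0); split=> [[]|i].
by rewrite y0 big1 // => -[].
Qed.

Lemma frob_spanD I (S : set (I -> B)) y y' z : frob_span S y -> frob_span S y' ->
  (forall i, z i = y i + y' i) -> frob_span S z.
Proof.
move=> [T [b [Z [ZS yE]]]] [T' [b' [Z' [ZS' yE']]]] zE.
exists (T + T')%type, (fun j => match j with inl j => b j | inr j => b' j end).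
exists (fun j => match j with inl j => Z j | inr j => Z' j end).
by split=> [[]//|i]; rewrite big_sumType /= zE yE yE'.
Qed.

Lemma frob_spanZ I (S : set (I -> B)) y z a : frob_span S y ->
  (forall i, z i = a * y i) -> frob_span S z.
Proof.
move=> [T [b [Z [ZS yE]]]] zE; exists T, (fun j => a * b j), Z; split=> // i.
by rewrite zE yE mulr_sumr; apply: eq_bigr => j _; rewrite mulrA.
Qed.

Lemma frob_span_sum I (S : set (I -> B)) (T : finType) (F : T -> I -> B) y :
  (forall j, frob_span S (F j)) -> (forall i, y i = \sum_j F j i) -> frob_span S y.
Proof.
move=> FS yE.
suff H (s : seq T) : frob_span S (fun i => \sum_(j <- s) F j i).
  have [T' [b [Z [ZS e]]]] := H (index_enum T).
  by exists T', b, Z; split=> // i; rewrite yE e.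
elim: s => [|j s IH]; first by apply: frob_span0 => i; rewrite big_nil.
by apply: (frob_spanD (FS j) IH) => i; rewrite big_cons.
Qed.

Definition syz (I : finType) (c : I -> B) : set (I -> B) :=
  [set z | \sum_i z i * c i = 0].

Lemma syz_frob (I : finType) (c z : I -> B) : syz c z -> \sum_i z i ^+ q * c i ^+ q = 0.
Proof.
move=> zc; under eq_bigr do rewrite -exprMn.
by rewrite -frob_sum zc expr0n eqn0Ngt q0.
Qed.

(** The vanishing of Tor_1(B/(c), B), where B is an algebra over itself by
    x |-> x ^ q. *)
Definition frob_flat (I : finType) (c : I -> B) :=
  forall y, \sum_i y i * c i ^+ q = 0 -> frob_span (syz c) y.

(** Write c' = m c and c = n c'. A relation y between the q-th powers of c' gives one
    between those of c; its image under n differs from y by a combination of the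
    rows of 1 - m n, which are relations between the c'. *)
Lemma frob_flat_gens (I I' : finType) (c : I -> B) (c' : I' -> B) :
  ideal_span (range c) = ideal_span (range c') -> frob_flat c -> frob_flat c'.
Proof.
move=> e fc y yc'.
have /choice[m mP] i' : exists a : I -> B, c' i' = \sum_i a i * c i.
  by apply/range_span; rewrite e; apply: ideal_span_gen; exists i'.
have /choice[n nP] i : exists a : I' -> B, c i = \sum_i' a i' * c' i'.
  by apply/range_span; rewrite -e; apply: ideal_span_gen; exists i.
have [|T [b [Z [ZS wE]]]] := fc (fun i => \sum_i' y i' * m i' i ^+ q).
  rewrite -[RHS]yc'; under [RHS]eq_bigr do rewrite mP frob_sum mulr_sumr.
  rewrite exchange_big; apply: eq_bigr => i' _; rewrite mulr_suml.
  by apply: eq_bigr => i _; rewrite exprMn mulrA.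
pose y1 i' := \sum_j b j * (\sum_i Z j i * n i i') ^+ q.
pose y2 i' := \sum_l y l * ((l == i')%:R - \sum_i m l i * n i i') ^+ q.
apply: (@frob_spanD _ _ y1 y2).
- exists T, b, (fun j i' => \sum_i Z j i * n i i'); split=> // j.
  rewrite /syz /= -[RHS](ZS j).
  under [RHS]eq_bigr do rewrite nP mulr_sumr.
  rewrite exchange_big; apply: eq_bigr => i' _; rewrite mulr_suml.
  by apply: eq_bigr => i _; rewrite mulrA.
- exists I', y, (fun l i' => (l == i')%:R - \sum_i m l i * n i i'); split=> // l.
  rewrite /syz /=; under eq_bigr do rewrite mulrBl.
  rewrite sumrB (bigD1 l) //= eqxx mul1r big1 ?addr0 => [|i' /negPf]; last first.
    by rewrite eq_sym => ->; rewrite mul0r.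
  rewrite {1}mP; apply/eqP; rewrite subr_eq0; apply/eqP.
  under [LHS]eq_bigr do rewrite nP mulr_sumr.
  rewrite exchange_big; apply: eq_bigr => i' _; rewrite mulr_suml.
  by apply: eq_bigr => i _; rewrite mulrA.
move=> i'; rewrite /y2.
under [X in _ = _ + X]eq_bigr do rewrite qD frobN mulrDr mulrN.
rewrite big_split sumrN (bigD1 i') //= eqxx expr1n mulr1 big1 ?addr0 => [|l /negPf ->]; last first.
  by rewrite expr0n eqn0Ngt q0 mulr0.
rewrite addrCA [X in _ + X](_ : _ = 0) ?addr0 //.
apply/eqP; rewrite subr_eq0; apply/eqP; rewrite /y1.
under [LHS]eq_bigr do rewrite frob_sum mulr_sumr.
under [RHS]eq_bigr do rewrite frob_sum mulr_sumr.
rewrite exchange_big [RHS]exchange_big; apply: eq_bigr => i _.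
under [LHS]eq_bigr do rewrite exprMn mulrA.
under [RHS]eq_bigr do rewrite exprMn mulrA.
by rewrite -!mulr_suml wE.
Qed.

Definition flat_ideal (J : set B) :=
  forall (I : finType) (c : I -> B), ideal_span (range c) = J -> frob_flat c.

Lemma flat_unit_ideal J : J 1 -> is_ideal J -> flat_ideal J.
Proof.
move=> J1 Ji I c cJ; apply: (@frob_flat_gens unit _ (fun=> 1)).
  rewrite cJ; apply/seteqP; split; first by apply: ideal_span_le => // _ [_ _ <-].
  move=> z _; rewrite -[z]mulr1; case: (ideal_span_ideal (range (fun _ : unit => 1 : B))) => _ _; apply.
  by apply: ideal_span_gen; exists tt.
move=> y; rewrite (bigD1 tt) //= big1 ?addr0 => [|[] //]; rewrite expr1n mulr1 => y0.
by apply: frob_span0 => -[].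
Qed.

Hypothesis nB : is_noetherian B.

Lemma noeth_gens J : is_ideal J -> exists (I : finType) (c : I -> B), ideal_span (range c) = J.
Proof. by move=> /nB[d [g ->]]; exists 'I_d, g. Qed.

Definition colon (J : set B) u : set B := [set z | J (z * u)].

Lemma colon_ideal J u : is_ideal J -> is_ideal (colon J u).
Proof.
move=> [J0 JD JM]; split=> [|a b|a b]; rewrite /colon /=.
- by rewrite mul0r.
- by rewrite mulrDl; apply: JD.
- by rewrite -mulrA; apply: JM.
Qed.

Lemma span_option (I : finType) (c : I -> B) u :
  ideal_span (range (fun o => if o is Some i then c i else u)) =
  ideal_add (ideal_span (range c)) (principal u).
Proof.
have ci := ideal_span_ideal (range c); have ui := principal_ideal u.
apply/seteqP; split.
  apply: ideal_span_le; first exact: ideal_add_ideal.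
  move=> _ [[i|] _ <-]; first by apply: ideal_addl => //; apply: ideal_span_gen; exists i.
  by apply: ideal_addr => //; exists 1; rewrite mul1r.
set f := (fun o : option I => if o is Some i then c i else u); have [f0 fD fM] := ideal_span_ideal (range f).
move=> _ [a [_ [ca [b ->] ->]]]; apply: fD.
  by apply: ideal_span_mono ca => _ [i _ <-]; exists (Some i).
by apply: fM; apply: ideal_span_gen; exists None.
Qed.

(** Tor_1 of the middle term of 0 -> B/(J:u) -> B/J -> B/(J+u) -> 0 vanishes if that
    of both ends does. *)
Lemma flat_extension J u : is_ideal J -> flat_ideal (ideal_add J (principal u)) ->
  flat_ideal (colon J u) -> flat_ideal J.
Proof.
move=> Ji fJu fcol I c cJ y yc.
have := fJu _ (fun o => if o is Some i then c i else u); rewrite span_option cJ.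
move=> /(_ erefl (fun o => if o is Some i then y i else 0)) [].
  by rewrite big_option /= mul0r add0r.
move=> T [b [Z [ZS yE]]].
have Zu j : \sum_i Z j (Some i) * c i = - (Z j None * u).
  have := ZS j; rewrite /syz /= big_option /= => /eqP.
  by rewrite addrC addr_eq0 => /eqP.
have [S [g gJ]] := noeth_gens (colon_ideal u Ji).
have /choice[w wP] k : exists a : I -> B, - (g k * u) = \sum_i a i * c i.
  apply/range_span; rewrite cJ -mulN1r; case: (Ji) => _ _; apply.
  suff : colon J u (g k) by [].
  by rewrite -gJ; apply: ideal_span_gen; exists k.
pose t o := match o with inl j => Z j None | inr k => g k end.
have tJ : ideal_span (range t) = colon J u.
  apply/seteqP; split.
    apply: ideal_span_le; first exact: colon_ideal.
    move=> _ [[j|k] _ <-] /=; last by rewrite -gJ; apply: ideal_span_gen; exists k.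
    rewrite /colon /= -[_ * u]opprK -Zu -mulN1r -cJ.
    case: (ideal_span_ideal (range c)) => _ _; apply; apply: ideal_sum => //.
      exact: ideal_span_ideal.
    move=> i _; case: (ideal_span_ideal (range c)) => _ _; apply.
    by apply: ideal_span_gen; exists i.
  rewrite -gJ; apply: ideal_span_mono => _ [k _ <-]; by exists (inr k).
have [|L [e [s [sS bE]]]] := fcol _ t tJ (fun o => if o is inl j then b j else 0).
  rewrite big_sumType /= [X in _ + X]big1 ?addr0 => [|k _]; last by rewrite mul0r.
  by rewrite -(yE None).
exists L, e, (fun l i => \sum_j s l (inl j) * Z j (Some i) + \sum_k s l (inr k) * w k i).
split=> [l|i].
  have := sS l; rewrite /syz /= big_sumType /= => sl.
  under eq_bigr do rewrite mulrDl.
  rewrite big_split /=.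
  have -> : \sum_i (\sum_j s l (inl j) * Z j (Some i)) * c i =
      \sum_j s l (inl j) * - (Z j None * u).
    under eq_bigr do rewrite mulr_suml.
    rewrite exchange_big; apply: eq_bigr => j _; rewrite -Zu mulr_sumr.
    by apply: eq_bigr => i _; rewrite mulrA.
  have -> : \sum_i (\sum_k s l (inr k) * w k i) * c i = \sum_k s l (inr k) * - (g k * u).
    under eq_bigr do rewrite mulr_suml.
    rewrite exchange_big; apply: eq_bigr => k _; rewrite wP mulr_sumr.
    by apply: eq_bigr => i _; rewrite mulrA.
have {}sl := congr1 (fun v => v * - u) sl.
rewrite mul0r mulrDl !mulr_suml in sl.
by rewrite -[RHS]sl; congr (_ + _); apply: eq_bigr => j _ /=; ring.
have bj j : b j = \sum_l e l * s l (inl j) ^+ q := bE (inl j).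
have gk k : \sum_l e l * s l (inr k) ^+ q = 0 := esym (bE (inr k)).
under eq_bigr do rewrite qD !frob_sum mulrDr !mulr_sumr.
rewrite big_split /= [X in _ + X]exchange_big [X in _ + X]big1 ?addr0 => [|k _]; last first.
  under eq_bigr do rewrite exprMn mulrA.
  by rewrite -mulr_suml gk mul0r.
rewrite exchange_big /= (yE (Some i)); apply: eq_bigr => j _.
rewrite bj mulr_suml; apply: eq_bigr => l _; by rewrite exprMn mulrA.
Qed.

(** The cokernel of s on B/P is B/(P+s), so that Tor_1(B/P, B) is divisible by s^q.
    Being finitely generated, it is killed by one s outside P as soon as each of its
    elements is; so it vanishes. *)
Lemma flat_prime P : is_prime_ideal P ->
  (forall s, ~ P s -> flat_ideal (ideal_add P (principal s))) ->
  (forall (I : finType) (c : I -> B) y, ideal_span (range c) = P ->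
     \sum_i y i * c i ^+ q = 0 ->
     exists2 s, ~ P s & frob_span (syz c) (fun i => s * y i)) ->
  flat_ideal P.
Proof.
move=> Pp fPs loc I c cP; have [Pi P1 PM] := Pp.
pose rel : set (nat -> B) := [set v | \sum_i v (enum_rank i) * c i ^+ q = 0].
have [T [g [gR gs]]] := noeth_fin_module nB #|I| rel.
have /choice[s sP] j : exists s, ~ P s /\ frob_span (syz c) (fun i => s * g j (enum_rank i)).
  by have [s Ps H] := loc _ c (fun i => g j (enum_rank i)) cP (gR j); exists s.
pose t := \prod_j s j.
have Pt : ~ P t.
  rewrite /t; elim/big_ind: _ => // [a b na nb /PM[]//|j _]; by case: (sP j).
have killed y : \sum_i y i * c i ^+ q = 0 -> frob_span (syz c) (fun i => t * y i).
  move=> yc; pose v k := if (k < #|I|)%N =P true is ReflectT kI then y (enum_val (Ordinal kI)) else 0.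
  have vE i : v (enum_rank i) = y i.
    rewrite /v; case: eqP => [kI|[]]; last exact: ltn_ord.
    by congr y; rewrite -[RHS]enum_rankK; congr enum_val; apply: val_inj.
  have [|a aE] := gs v; first by rewrite /rel /=; under eq_bigr do rewrite vE.
  apply: (@frob_span_sum _ _ _ (fun j i => t * (a j * g j (enum_rank i)))) => [j|i].
    apply: (frob_spanZ (a := a j * \prod_(l | l != j) s l) (sP j).2) => i.
    by rewrite /t (bigD1 j) //=; ring.
  by rewrite -vE aE ?ltn_ord // mulr_sumr.
move=> y yc; have := fPs t Pt _ (fun o => if o is Some i then c i else t).
rewrite span_option cP => /(_ erefl (fun o => if o is Some i then y i else 0)) [].
  by rewrite big_option /= mul0r add0r.
move=> L [b [Z [ZS yE]]].
have Zt j : \sum_i Z j (Some i) * c i = - (Z j None * t).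
  have := ZS j; rewrite /syz /= big_option /= => /eqP.
  by rewrite addrC addr_eq0 => /eqP.
have /choice[w wP] j : exists a : I -> B, Z j None = \sum_i a i * c i.
  apply/range_span; rewrite cP.
  suff : P (Z j None * t) by case/PM.
  rewrite -[_ * t]opprK -Zt -mulN1r -cP.
  case: (ideal_span_ideal (range c)) => _ _; apply; apply: ideal_sum => //.
    exact: ideal_span_ideal.
  move=> i _; case: (ideal_span_ideal (range c)) => _ _; apply.
  by apply: ideal_span_gen; exists i.
pose y' i := - \sum_j b j * w j i ^+ q.
have y'c : \sum_i y' i * c i ^+ q = 0.
  under eq_bigr do rewrite mulNr mulr_suml.
  rewrite sumrN exchange_big /= -[RHS]oppr0; congr (- _).
  rewrite [RHS](yE None); apply: eq_bigr => j _.
  rewrite wP frob_sum mulr_sumr; apply: eq_bigr => i _; by rewrite exprMn mulrA.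
apply: (@frob_spanD _ _ (fun i => \sum_j b j * (Z j (Some i) + t * w j i) ^+ q)
  (fun i => t ^+ q.-1 * (t * y' i))).
- exists L, b, (fun j i => Z j (Some i) + t * w j i); split=> // j.
  rewrite /syz /=; under eq_bigr do rewrite mulrDl.
  rewrite big_split /= Zt wP mulr_suml addrC -sumrB big1 // => i _; ring.
- exact: frob_spanZ (killed _ y'c) _.
move=> i; rewrite mulrA -exprSr prednK // /y' mulrN mulr_sumr (yE (Some i)) /=.
rewrite -sumrB; apply: eq_bigr => j _; rewrite qD exprMn; ring.
Qed.

Hypothesis loc : forall (P : set B), is_prime_ideal P ->
  forall (I : finType) (c : I -> B) y, ideal_span (range c) = P ->
     \sum_i y i * c i ^+ q = 0 ->
     exists2 s, ~ P s & frob_span (syz c) (fun i => s * y i).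

(** Noetherian induction: B/J is an extension of quotients by larger ideals if J is
    not prime, and primes are treated by localization. *)
Lemma flat_ideal_all J : is_ideal J -> flat_ideal J.
Proof.
move: J; apply: (noeth_ind nB) => J Ji IH.
case: (pselect (J 1)) => [J1|J1]; first exact: flat_unit_ideal.
have lt_add u : ~ J u -> J `<` ideal_add J (principal u).
  move=> Ju; split; first exact: ideal_addl (principal_ideal u).
  by move=> H; apply/Ju/H; apply: ideal_addr => //; exists 1; rewrite mul1r.
have addI u : is_ideal (ideal_add J (principal u)) := ideal_add_ideal Ji (principal_ideal u).
case: (pselect (exists u v, [/\ J (u * v), ~ J u & ~ J v])) => [[u [v [Juv Ju Jv]]]|np].
  apply: (@flat_extension J v) => //; first by apply: IH => //; exact: lt_add.
  apply: IH; [exact: colon_ideal|split].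
    by move=> z Jz; rewrite /colon /= mulrC; case: Ji => _ _; apply.
  by move=> H; apply: Ju; apply: H.
apply: flat_prime.
- split=> // u v Juv; apply: contrapT => H; apply: np; exists u, v; split=> // ?; apply: H; auto.
- by move=> s Js; apply: IH => //; exact: lt_add.
- apply: loc; split=> // u v Juv; apply: contrapT => H; apply: np.
  by exists u, v; split=> // ?; apply: H; auto.
Qed.

End FrobeniusFlat.
(** * Kunz's theorem *)

(** The relations between the terms of a regular sequence are the Koszul relations,
    and the Koszul relations of the x i ^ q are the q-th powers of those of the
    x i. *)
Lemma frob_flat_regular_local (B : comNzRingType) d (x : 'I_d -> B) q :
  is_noetherian B -> ~ kpow x 1 1 ->
  (forall u, ~ kpow x 1 u -> exists v, v * u = 1) -> has_prime_chain B d ->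
  (0 < q)%N -> (forall a b : B, (a + b) ^+ q = a ^+ q + b ^+ q) ->
  frob_flat q x.
Proof.
move=> nB K1 Kloc dimB q0 qD.
suff H j y : (j <= d)%N -> (forall i : 'I_d, (j <= i)%N -> y i = 0) ->
    \sum_i y i * x i ^+ q = 0 -> frob_span q (syz x) y.
  by move=> y; apply: (H d) => // i; rewrite leqNgt ltn_ord.
elim: j y => [|j IH] y jd yj yx; first by apply: frob_span0 => i; apply: yj.
pose i0 := Ordinal jd.
pose xj := [set x i ^+ q | i in [set i : 'I_d | (i < j)%N]].
have xji := ideal_span_ideal xj.
have : ideal_span xj (y i0 * x i0 ^+ q).
  move: yx; rewrite (bigD1 i0) //= => /eqP; rewrite addr_eq0 => /eqP ->.
  rewrite -mulN1r; case: (xji) => X0 XD XM; apply: (XM).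
  apply: ideal_sum => // i ii0; case: (ltngtP i j) => [ij|ji|ij].
  - by apply/XM/ideal_span_gen; exists i.
  - by rewrite yj // mul0r.
  - by case/eqP: ii0; apply: val_inj.
move=> /(powers_regular (j := i0) nB K1 Kloc dimB)/ideal_spanP[T [a [g [gx y0E]]]].
have /choice[s sP] t : exists i : 'I_d, (i < j)%N /\ x i ^+ q = g t.
  by case: (gx t) => i ij <-; exists i.
have si0 t : s t != i0 by have [+ _] := sP t; apply: contraTneq => ->; rewrite ltnn.
pose Z t i := (i == i0)%:R * x (s t) - (i == s t)%:R * x i0.
have Zx t : syz x (Z t).
  rewrite /syz /=; under eq_bigr do rewrite mulrBl -!mulrA.
  rewrite sumrB (bigD1 i0) //= eqxx mul1r big1 ?addr0 => [|i /negPf ->]; last by rewrite mul0r.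
  rewrite (bigD1 (s t)) //= eqxx mul1r big1 ?addr0 => [|i /negPf ->]; last by rewrite mul0r.
  by rewrite mulrC subrr.
pose y' i := \sum_t a t * Z t i ^+ q.
apply: (@frob_spanD _ _ _ _ y' (fun i => y i - y' i)) => [||i]; last by rewrite addrC subrK.
  by exists T, a, Z.
have q00 : (0 : B) ^+ q = 0 by rewrite expr0n eqn0Ngt q0.
apply: IH; first exact: ltnW.
  move=> i; rewrite leq_eqVlt => /orP[/eqP ji|ji].
    have -> : i = i0 by apply: val_inj.
    apply/eqP; rewrite subr_eq0 y0E; apply/eqP; apply: eq_bigr => t _.
    by rewrite -(sP t).2 /Z eqxx mul1r eq_sym (negPf (si0 t)) mul0r subr0.
  rewrite yj // /y' big1 ?subr0 // => t _; rewrite /Z.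
  have -> : (i == i0) = false by apply: contraTF ji => /eqP ->; rewrite ltnn.
  have -> : (i == s t) = false.
    by apply: contraTF ji => /eqP ->; rewrite -leqNgt; apply/ltnW; case: (sP t).
  by rewrite !mul0r subr0 q00 mulr0.
under eq_bigr do rewrite mulrBl mulr_suml.
rewrite sumrB yx sub0r exchange_big big1 ?oppr0 // => t _ /=.
under eq_bigr do rewrite -mulrA.
by rewrite -mulr_sumr (syz_frob q0 qD (Zx t)) mulr0.
Qed.

Lemma frobD (B : comNzRingType) p e : prime p -> p%:R = 0 :> B ->
  forall a b : B, (a + b) ^+ (p ^ e)%N = a ^+ (p ^ e)%N + b ^+ (p ^ e)%N.
Proof.
move=> pp p0 a b; apply: exprDn_pchar; rewrite pnatX; apply/orP; left.
by rewrite pnatE // inE pp p0 eqxx.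
Qed.

Section LocalizationTheory.
Variables (A : idomainType) (P : set A) (Pp : is_prime_ideal P).
Local Notation AP := (localization Pp).
Local Notation "x %:F" := (FracField.tofrac x).

Lemma loc_emb_proof (a : A) : a%:F \in loc_pred P.
Proof.
apply/asboolP; exists a, 1; rewrite tofrac1 divr1; split=> //.
by case: Pp.
Qed.

Definition loc_emb (a : A) : AP := Localization Pp (loc_emb_proof a).

Lemma loc_emb_is_zmod_morphism : zmod_morphism loc_emb.
Proof. by move=> a b; apply: val_inj; rewrite /= tofracB. Qed.

Lemma loc_emb_is_monoid_morphism : monoid_morphism loc_emb.
Proof. by split=> [|a b]; apply: val_inj; rewrite /= ?tofrac1 ?tofracM. Qed.

HB.instance Definition _ := GRing.isZmodMorphism.Build A AP loc_emb loc_emb_is_zmod_morphism.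
HB.instance Definition _ := GRing.isMonoidMorphism.Build A AP loc_emb loc_emb_is_monoid_morphism.

Lemma loc_emb_inj : injective loc_emb.
Proof. by move=> a b /(congr1 val)/= /eqP; rewrite tofrac_eq => /eqP. Qed.

Lemma loc_fracP (b : AP) : exists a s, ~ P s /\ b * loc_emb s = loc_emb a.
Proof.
have [a [s [Ps e]]] := asboolP _ (valP b); exists a, s; split=> //.
apply: val_inj => /=; rewrite e divfK // tofrac_eq0.
by apply: contra_notN Ps => /eqP ->; case: Pp => -[].
Qed.

Lemma loc_unit s : ~ P s -> exists v, v * loc_emb s = 1.
Proof.
move=> Ps.
have s0 : s%:F != 0 by rewrite tofrac_eq0; apply: contra_notN Ps => /eqP ->; case: Pp => -[].
have vP : 1 / s%:F \in loc_pred P by apply/asboolP; exists 1, s; rewrite tofrac1.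
by exists (Localization Pp vP); apply: val_inj; rewrite /= mul1r mulVf.
Qed.

End LocalizationTheory.

Lemma loc_common_denom (A : idomainType) (P : set A) (Pp : is_prime_ideal P)
    (T : finType) (f : T -> localization Pp) :
  exists2 s, ~ P s & exists a : T -> A, forall j, f j * loc_emb Pp s = loc_emb Pp (a j).
Proof.
have /choice[w wP] j : exists w : A * A, ~ P w.2 /\ f j * loc_emb Pp w.2 = loc_emb Pp w.1.
  by have [a [s H]] := loc_fracP (f j); exists (a, s).
have [Pi P1 PM] := Pp; exists (\prod_j (w j).2).
  by elim/big_ind: _ => // [a b na nb /PM[]//|j _]; case: (wP j).
exists (fun j => (w j).1 * \prod_(l | l != j) (w l).2) => j.
by rewrite (bigD1 j) //= !rmorphM /= mulrA (wP j).2.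
Qed.

(** In the localization at P the c i generate the maximal ideal, as does a regular
    system of parameters; [frob_flat_gens] gives the relations there, and
    denominators are cleared. *)
Lemma regular_frob_flat_at (A : idomainType) (P : set A) (Pp : is_prime_ideal P)
    p e (I : finType) (c : I -> A) y :
  is_regular_local (localization Pp) -> prime p -> p%:R = 0 :> A ->
  ideal_span (range c) = P -> \sum_i y i * c i ^+ (p ^ e)%N = 0 ->
  exists2 s, ~ P s & frob_span (p ^ e) (syz c) (fun i => s * y i).
Proof.
move=> [nB [K [[Ki K1 Kmax] Kuniq [d [[dimB _] [x xK] _]]]]] pp p0 cP yc.
pose em : {rmorphism A -> localization Pp} := loc_emb Pp.
have frac b : exists a s, ~ P s /\ b * em s = em a by exact: loc_fracP.
have unit s : ~ P s -> exists v, v * em s = 1 by exact: loc_unit.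
have denom (T : finType) (f : T -> localization Pp) : exists2 s, ~ P s &
  exists a : T -> A, forall j, f j * em s = em (a j) by exact: loc_common_denom.
have [Pi P1 PM] := Pp; have [P0 PD PMl] := Pi.
pose PB := [set b : localization Pp | exists a s, [/\ P a, ~ P s & b * em s = em a]].
have PBi : is_ideal PB.
  split.
  - by exists 0, 1; rewrite rmorph1 rmorph0 mulr1.
  - move=> b b' [a [s [Pa Ps e1]]] [a' [s' [Pa' Ps' e2]]].
    exists (a * s' + a' * s), (s * s'); split=> [||].
    + by apply: PD; rewrite mulrC; apply: PMl.
    + by case/PM.
    + by rewrite !rmorphD !rmorphM -e1 -e2; ring.
  - move=> b b' [a [s [Pa Ps e1]]]; have [a' [s' [Ps' e2]]] := frac b.
    exists (a' * a), (s' * s); split=> [||]; [exact: PMl|by case/PM|].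
    by rewrite !rmorphM -e1 -e2; ring.
have PBloc b : ~ PB b -> exists v, v * b = 1.
  have [a [s [Ps e1]]] := frac b => nb.
  have [|v va] := unit a; first by move=> Pa; apply: nb; exists a, s.
  by exists (v * em s); rewrite -mulrA [em s * b]mulrC e1.
have PB1 : ~ PB 1.
  by move=> [a [s [Pa Ps]]]; rewrite mul1r => /loc_emb_inj sa; apply: Ps; rewrite sa.
have KPB : PB = K.
  apply: Kuniq; split=> // J Ji J1 PBJ; apply/seteqP; split=> // b Jb.
  apply: contrapT => /PBloc[v vb]; apply: J1; rewrite -vb.
  by case: Ji => _ _; apply.
have Kx : kpow x 1 = PB by rewrite kpow1 -xK KPB.
have q0 : (0 < p ^ e)%N by rewrite expn_gt0 prime_gt0.
have p0B : p%:R = 0 :> localization Pp by rewrite -(rmorph_nat em) p0 rmorph0.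
have qD := frobD e pp p0B.
have flatx : frob_flat (p ^ e) x.
  by apply: frob_flat_regular_local; rewrite ?Kx.
have cPB : ideal_span (range x) = ideal_span (range (em \o c)).
  rewrite -kpow1 Kx; apply/seteqP; split.
    move=> b [a [s [Pa Ps e1]]]; have [f aE] : exists f : I -> A, a = \sum_i f i * c i by apply/range_span; rewrite cP.
    have [v vs] := unit _ Ps.
    have -> : b = v * em a by rewrite -e1 mulrC -mulrA [em s * v]mulrC vs mulr1.
    apply/range_span; exists (fun i => v * em (f i)).
    rewrite aE rmorph_sum mulr_sumr; apply: eq_bigr => i _.
    by rewrite /= rmorphM mulrA.
  apply: ideal_span_le => // _ [i _ <-]; exists (c i), 1; rewrite rmorph1 mulr1; split=> //.
  by move: (cP) => <-; apply: ideal_span_gen; exists i.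
have flatc := frob_flat_gens q0 qD cPB flatx.
have [|T [b [Z [ZS yE]]]] := flatc (em \o y).
  rewrite -[RHS](rmorph0 em) -[in RHS]yc rmorph_sum; apply: eq_bigr => i _.
  by rewrite /= rmorphM rmorphXn.
have [t Pt [b' b'E]] := denom _ b.
have [r Pr [Z' Z'E]] := denom _ (fun u : T * I => Z u.1 u.2).
have ninj u v : em u = em v -> u = v by exact: loc_emb_inj.
exists (t * r ^+ (p ^ e)%N) => [/PM[]// /prime_expr-/(_ Pp)//|].
exists T, b', (fun j i => Z' (j, i)); split=> [j|i].
  apply: ninj; rewrite /= rmorph_sum rmorph0 -[RHS](mul0r (em r)) -[in RHS](ZS j) mulr_suml.
  by apply: eq_bigr => i _; rewrite rmorphM -(Z'E (j, i)) /=; ring.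
apply: ninj; rewrite rmorphM rmorph_sum.
have /= -> := yE i; rewrite mulr_sumr; apply: eq_bigr => j _.
by rewrite !rmorphM !rmorphXn -(Z'E (j, i)) -b'E /= exprMn; ring.
Qed.

(** Kunz's theorem: flatness of Frobenius is checked at each prime, where a regular
    system of parameters is available. *)
Theorem kunz (A : idomainType) p e (I : finType) (c : I -> A) :
  is_regular_ring A -> prime p -> p%:R = 0 :> A -> frob_flat (p ^ e) c.
Proof.
move=> [nA rA] pp p0.
have q0 : (0 < p ^ e)%N by rewrite expn_gt0 prime_gt0.
apply: (flat_ideal_all q0 (frobD e pp p0) nA _ (ideal_span_ideal (range c))) => //.
move=> P Pp J d y; exact: (regular_frob_flat_at (rA P Pp) pp p0).
Qed.

Section Systems.
Variables (B : comNzRingType) (q : nat).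
Hypothesis q0 : (0 < q)%N.
Hypothesis qD : forall a b : B, (a + b) ^+ q = a ^+ q + b ^+ q.
Hypothesis flatB : forall (I : finType) (c : I -> B), frob_flat q c.

(** One equation at a time: if y is a combination, with coefficients b, of q-th powers
    of solutions of the previous equations, then b satisfies an equation with q-th
    powers as coefficients. *)
Lemma frob_flat_system (I K : finType) (M : I -> K -> B) y :
  (forall k, \sum_i y i * M i k ^+ q = 0) ->
  frob_span q [set z | forall k, \sum_i z i * M i k = 0] y.
Proof.
move=> yM.
suff H (s : seq K) : frob_span q [set z | forall k, k \in s -> \sum_i z i * M i k = 0] y.
  have [T [b [Z [ZS yE]]]] := H (index_enum K).
  by exists T, b, Z; split=> // j k; apply: ZS; apply: mem_index_enum.
elim: s => [|k s [T [b [Z [ZS yE]]]]].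
  exists I, y, (fun j i => (i == j)%:R); split=> // i.
  rewrite (bigD1 i) //= eqxx expr1n mulr1 big1 ?addr0 // => j /negPf.
  by rewrite eq_sym => ->; rewrite expr0n eqn0Ngt q0 mulr0.
have [|L [e [W [WS bE]]]] := flatB (c := fun j => \sum_i Z j i * M i k) (y := b).
  rewrite -[RHS](yM k).
  under [LHS]eq_bigr do rewrite (frob_sum q0 qD) mulr_sumr.
  rewrite exchange_big; apply: eq_bigr => i _; rewrite yE mulr_suml.
  by apply: eq_bigr => j _; rewrite exprMn mulrA.
exists L, e, (fun l i => \sum_j W l j * Z j i); split=> [l k'|i]; last first.
  rewrite yE; under [RHS]eq_bigr do rewrite (frob_sum q0 qD) mulr_sumr.
  rewrite exchange_big; apply: eq_bigr => j _; rewrite bE mulr_suml.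
  by apply: eq_bigr => l _; rewrite exprMn mulrA.
have -> : \sum_i (\sum_j W l j * Z j i) * M i k' = \sum_j W l j * \sum_i Z j i * M i k'.
  under eq_bigr do rewrite mulr_suml; rewrite exchange_big; apply: eq_bigr => j _.
  by rewrite mulr_sumr; apply: eq_bigr => i _; rewrite mulrA.
rewrite in_cons => /orP[/eqP ->|ks]; first exact: WS.
by rewrite big1 // => j _; rewrite ZS // mulr0.
Qed.

End Systems.
(** * The Frobenius map of a polynomial ring *)

Section FrobeniusFlatMpoly.
Variables (A : comNzRingType) (m q : nat).
Local Notation R := {mpoly A[m]}.
Hypothesis q0 : (0 < q)%N.
Hypothesis qD : forall a b : A, (a + b) ^+ q = a ^+ q + b ^+ q.
Hypothesis qDR : forall a b : R, (a + b) ^+ q = a ^+ q + b ^+ q.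

Definition small_exp (a : 'X_{1..m}) := [forall i, (a i < q)%N].

Lemma small_expP (a : 'X_{1..m}) : reflect (forall i, (a i < q)%N) (small_exp a).
Proof. exact: forallP. Qed.

Lemma exp_euclid (a a' g g' : 'X_{1..m}) : small_exp a -> small_exp a' ->
  ((a + g *+ q)%MM == (a' + g' *+ q)%MM) = (a == a') && (g == g').
Proof.
move=> /small_expP sa /small_expP sa'; apply/eqP/andP => [e|[/eqP-> /eqP->//]].
have e' i : (a i = a' i /\ g i = g' i)%N.
  have := congr1 (fun b : 'X_{1..m} => b i) e; rewrite !mnmDE !mulmnE => ei.
  have ea : a i = a' i by have := congr1 (modn^~ q) ei; rewrite /= (addnC (a i)) (addnC (a' i)) !modnMDl !modn_small.
  split=> //; move: ei; rewrite ea => /addnI/eqP.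
  by rewrite eqn_pmul2r // => /eqP.
by split; apply/eqP/mnmP => i; case: (e' i).
Qed.

Lemma mpoly_frob (h : R) :
  h ^+ q = \sum_(b <- msupp h) h@_b ^+ q *: 'X_[b *+ q].
Proof.
rewrite {1}[h]mpolyE (frob_sum q0 qDR); apply: eq_bigr => b _.
by rewrite exprZn mpolyXn.
Qed.

Lemma mcoeff_frob (h : R) (a a' g : 'X_{1..m}) : small_exp a -> small_exp a' ->
  ('X_[a'] * h ^+ q)@_(a + g *+ q)%MM = (a' == a)%:R * h@_g ^+ q.
Proof.
move=> sa sa'; rewrite mpoly_frob mulr_sumr raddf_sum /=.
transitivity (\sum_(b <- msupp h) (a' == a)%:R * (b == g)%:R * h@_b ^+ q).
  apply: eq_bigr => b _; rewrite -scalerAr mcoeffZ -mpolyXD mcoeffX exp_euclid //.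
  by rewrite -natrM mulnb mulrC.
case: (boolP (g \in msupp h)) => gh.
  rewrite (bigD1_seq g) ?msupp_uniq //= eqxx mulr1 big1 ?addr0 // => b /negPf ->.
  by rewrite mulr0 mul0r.
rewrite (memN_msupp_eq0 gh) expr0n eqn0Ngt q0 mulr0 big_seq big1 // => b bh.
by case: (eqVneq b g) => [e|]; [rewrite -e bh in gh|rewrite mulr0 mul0r].
Qed.

Definition small_of (f : {ffun 'I_m -> 'I_q}) : 'X_{1..m} := [multinom (f i : nat) | i < m].

Lemma small_ofP f : small_exp (small_of f).
Proof. by apply/small_expP => i; rewrite mnmE. Qed.

Lemma small_of_inj : injective small_of.
Proof.
by move=> f g /mnmP e; apply/ffunP => i; apply: val_inj; have := e i; rewrite !mnmE.
Qed.

(** R is free over the subring of polynomials in the X_i^q, with the monomials of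
    small exponents as a basis. *)
Lemma mpoly_frob_decomp (f : R) N : (msize f <= N)%N ->
  f = \sum_a \sum_(g : 'X_{1..m < N})
        f@_(small_of a + g *+ q)%MM *: ('X_[small_of a] * 'X_[g] ^+ q).
Proof.
move=> fN; apply/mpolyP => t.
pose a0 : {ffun 'I_m -> 'I_q} := [ffun i => Ordinal (ltn_pmod (t i) q0)].
pose g0 : 'X_{1..m} := [multinom (t i %/ q)%N | i < m].
have tE : t = (small_of a0 + g0 *+ q)%MM.
  by apply/mnmP => i; rewrite mnmDE mulmnE !mnmE ffunE /= addnC -divn_eq.
rewrite raddf_sum /=.
have cE a (g : 'X_{1..m < N}) :
    (f@_(small_of a + g *+ q)%MM *: ('X_[small_of a] * 'X_[g] ^+ q))@_t
      = if (a == a0) && (g == g0 :> 'X_{1..m}) then f@_t else 0.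
  rewrite mcoeffZ mpolyXn -mpolyXD mcoeffX tE exp_euclid ?small_ofP //.
  rewrite (inj_eq small_of_inj); case: andP => [[/eqP -> /eqP ->]|]; by rewrite ?mulr1 ?mulr0.
rewrite (bigD1 a0) //= [X in _ + X]big1 ?addr0 => [|a /negPf na]; last first.
  by rewrite raddf_sum big1 // => g _; rewrite /= cE na.
rewrite raddf_sum /=; under eq_bigr do rewrite cE eqxx /=.
case: (ltnP (mdeg g0) N) => gN.
  rewrite (bigD1 (BMultinom gN)) //= eqxx big1 ?addr0 // => g gn.
  by rewrite ifF //; apply: contraNF gn => /eqP e; rewrite -(inj_eq val_inj) /= e eqxx.
rewrite big1 => [|g _]; last first.
  by case: eqP => // e; have := bmdeg g; rewrite e ltnNge gN.
apply/memN_msupp_eq0/msize_mdeg_ge; apply: leq_trans fN _; apply: leq_trans gN _.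
by rewrite tE mdegD mdegMn; apply: leq_trans (leq_addl _ _); rewrite leq_pmulr.
Qed.

Hypothesis flatA : forall (I : finType) (c : I -> A), frob_flat q c.

(** The coefficients of the y i whose exponents have a given residue modulo q satisfy
    a linear system over A with q-th powers as coefficients, and Frobenius is flat on
    A. That b is constant and the exponents a are small is what will bound degrees. *)
Lemma frob_flat_mpoly (I K : finType) (M : I -> K -> R) (y : I -> R) :
  (forall k, \sum_i y i * M i k ^+ q = 0) ->
  exists (T : finType) (b : T -> A) (a : T -> 'X_{1..m}) (Z : T -> I -> R),
    [/\ forall j, small_exp (a j), forall j k, \sum_i Z j i * M i k = 0 &
        forall i, y i = \sum_j b j *: ('X_[a j] * Z j i ^+ q)].
Proof.
move=> yM; pose N := (\max_i msize (y i))%N.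
have yN i : (msize (y i) <= N)%N by rewrite /N (bigD1 i) //= leq_maxl.
pose D := (\max_(u : I * 'X_{1..m < N} * K) msize ('X_[u.1.2] * M u.1.1 u.2))%N.
have DP i (g : 'X_{1..m < N}) k : (msize ('X_[g] * M i k) <= D)%N.
  by rewrite /D (bigD1 (i, g, k)) //= leq_maxl.
have sys (a : {ffun 'I_m -> 'I_q}) : exists w : {T : finType & T -> A * (I * 'X_{1..m < N} -> A)},
    (forall j (k : K * 'X_{1..m < D}),
       \sum_u (projT2 w j).2 u * ('X_[u.2] * M u.1 k.1)@_k.2 = 0) /\
    forall i (g : 'X_{1..m < N}), (y i)@_(small_of a + g *+ q)%MM =
        \sum_j (projT2 w j).1 * (projT2 w j).2 (i, g) ^+ q.
  have [|T [b [Z [ZS yE]]]] := frob_flat_system q0 qD flatA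
    (M := fun (u : I * 'X_{1..m < N}) (k : K * 'X_{1..m < D}) => ('X_[u.2] * M u.1 k.1)@_k.2)
    (y := fun u => (y u.1)@_(small_of a + u.2 *+ q)%MM).
    move=> [k dl]; rewrite -(pair_big xpredT xpredT (fun i (g : 'X_{1..m < N}) =>
      (y i)@_(small_of a + g *+ q)%MM * ('X_[g] * M i k)@_dl ^+ q)) /=.
    have := congr1 (mcoeff (small_of a + dl *+ q)%MM) (yM k).
    rewrite mcoeff0 raddf_sum /= => e; rewrite -[RHS]e; apply: eq_bigr => i _.
    rewrite [in RHS](mpoly_frob_decomp (yN i)) mulr_suml raddf_sum /=.
    rewrite (bigD1 a) //= [X in _ + X]big1 ?addr0 => [|a' na]; last first.
      rewrite mulr_suml raddf_sum big1 //= => g _.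
      rewrite -scalerAl -mulrA -exprMn mcoeffZ mcoeff_frob ?small_ofP //.
      by rewrite (inj_eq small_of_inj) (negPf na) mul0r mulr0.
    rewrite mulr_suml raddf_sum /=; apply: eq_bigr => g _.
    rewrite -scalerAl -mulrA -exprMn mcoeffZ mcoeff_frob ?small_ofP //.
    by rewrite eqxx mul1r.
  exists (existT _ T (fun j => (b j, Z j))); split=> // i g.
  exact: (yE (i, g)).
have [w wP] := choice sys.
exists {a : {ffun 'I_m -> 'I_q} & projT1 (w a)}.
exists (fun t => (projT2 (w (tag t)) (tagged t)).1), (fun t => small_of (tag t)).
exists (fun t i => \sum_g (projT2 (w (tag t)) (tagged t)).2 (i, g) *: 'X_[g]).
split=> [t|[a j] k|i] /=; first exact: small_ofP.
  transitivity (\sum_i \sum_g (projT2 (w a) j).2 (i, g) *: ('X_[g] * M i k)).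
    apply: eq_bigr => i _; rewrite mulr_suml.
    by apply: eq_bigr => g _; rewrite scalerAl.
  rewrite (pair_big xpredT xpredT (fun i g => (projT2 (w a) j).2 (i, g) *: ('X_[g] * M i k))) /=.
  apply/mpolyP => dl; rewrite mcoeff0 raddf_sum /=.
  case: (ltnP (mdeg dl) D) => dD.
    rewrite -[RHS]((wP a).1 j (k, BMultinom dD)); apply: eq_bigr => -[i g] _ /=.
    by rewrite mcoeffZ.
  rewrite big1 // => -[i g] _ /=; rewrite mcoeffZ memN_msupp_eq0 ?mulr0 //.
  by apply: msize_mdeg_ge; apply: leq_trans dD.
rewrite [LHS](mpoly_frob_decomp (yN i)).
rewrite -(sig_big_dep (fun=> true) (fun _ _ => true) (fun a j => (projT2 (w a) j).1 *:
  ('X_[small_of a] * (\sum_g (projT2 (w a) j).2 (i, g) *: 'X_[g]) ^+ q))) /=.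
apply: eq_bigr => a _.
under [RHS]eq_bigr do rewrite (frob_sum q0 qDR) mulr_sumr scaler_sumr.
rewrite exchange_big; apply: eq_bigr => g _ /=.
rewrite (wP a).2 scaler_suml; apply: eq_bigr => j _.
by rewrite exprZn -scalerAr scalerA.
Qed.

End FrobeniusFlatMpoly.
(** * Homogeneous components *)

(** Sums over this range of degrees stand for sums over all degrees. *)
Definition int_range (M : nat) : seq int := [seq i%:Z - M%:Z | i <- iota 0 M.*2.+1].

Lemma int_range_uniq M : uniq (int_range M).
Proof. by rewrite map_inj_uniq ?iota_uniq // => i j /addIr[]. Qed.

Lemma mem_int_range M (n : int) : (`|n| <= M)%N -> n \in int_range M.
Proof.
move=> nM; apply/mapP; exists (absz (n + M%:Z)); last by lia.
by rewrite mem_iota; lia.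
Qed.

Section Components.
Variables (A : idomainType) (m : nat).
Local Notation R := {mpoly A[m]}.
Local Notation piece := (@mpoly_piece A m).

Definition mcomp (n : int) (f : R) : R :=
  if n is Posz d then pihomog mdeg d f else 0.

Lemma mcoeff_mcomp n f t : (mcomp n f)@_t = (n == Posz (mdeg t))%:R * f@_t.
Proof.
case: n => [d|d]; last by rewrite /= mcoeff0 mul0r.
rewrite /= pihomogE raddf_sum /=; under eq_bigr do rewrite mcoeffZ mcoeffX.
rewrite eqz_nat; case: (boolP (t \in msupp f)) => tf; last first.
  rewrite (memN_msupp_eq0 tf) mulr0 big_seq_cond big1 // => u /andP[uf _].
  by case: eqP => [e|]; [rewrite -e uf in tf|rewrite mulr0].
rewrite big_mkcond (bigD1_seq t) ?msupp_uniq //= eqxx mulr1 big1 ?addr0 => [|u /negPf ->].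
  by rewrite eq_sym; case: eqP; rewrite ?mul1r ?mul0r.
by rewrite mulr0; case: ifP.
Qed.

Lemma pieceE n f : piece n f <-> forall t, f@_t != 0 -> n = Posz (mdeg t).
Proof.
case: n => [d|d] /=; split=> [H t ft|H].
- by congr Posz; symmetry; apply: (dhomog_mf H); rewrite mcoeff_msupp.
- by apply/dhomogP => t; rewrite mcoeff_msupp => /H[].
- by move: ft; rewrite H mcoeff0 eqxx.
- by apply/mpolyP => t; rewrite mcoeff0; apply/eqP; apply: contraT => /H.
Qed.

Lemma mcomp_piece n f : piece n (mcomp n f).
Proof.
apply/pieceE => t; rewrite mcoeff_mcomp; case: (eqVneq n (Posz (mdeg t))) => // _.
by rewrite mul0r eqxx.
Qed.

Lemma mcomp_id n f : piece n f -> mcomp n f = f.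
Proof.
move=> /pieceE H; apply/mpolyP => t; rewrite mcoeff_mcomp.
have [-> |/H ->] := eqVneq f@_t 0; first by rewrite mulr0.
by rewrite eqxx mul1r.
Qed.

Lemma mcomp_is_linear n : linear (mcomp n).
Proof.
move=> a f g; apply/mpolyP => t.
by rewrite mcoeffD mcoeffZ !mcoeff_mcomp mcoeffD mcoeffZ; ring.
Qed.

HB.instance Definition _ n :=
  GRing.isLinear.Build A {mpoly A[m]} {mpoly A[m]} _ (mcomp n) (mcomp_is_linear n).

Lemma mcompMr k n f g : piece k g -> mcomp (n + k) (f * g) = mcomp n f * g.
Proof.
case: k => [d|d] /= gd; last by rewrite gd !mulr0 raddf0.
case: n => [e|e]; first exact: pihomogMr.
rewrite mul0r; case E: (Negz e + d%:Z) => [l|//].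
rewrite /= (@pihomog_partitionE _ _ mdeg (msize f) f) // mulr_suml raddf_sum big1 //= => i _.
apply: (@pihomog_ne0 _ _ _ (i + d)%N); first by lia.
by apply: dhomogM => //; apply: pihomogP.
Qed.

Lemma mcompMl k n f g : piece k g -> mcomp (k + n) (g * f) = g * mcomp n f.
Proof. by move=> kg; rewrite addrC mulrC mcompMr // mulrC. Qed.

Lemma mcomp_total (M : nat) (d : int) f : (msize f + `|d| <= M)%N ->
  f = \sum_(t <- int_range M) mcomp (t + d) f.
Proof.
move=> fM; apply/mpolyP => u; rewrite raddf_sum /=.
under eq_bigr do rewrite mcoeff_mcomp.
have [-> |fu] := eqVneq f@_u 0; first by rewrite big1 // => t _; rewrite mulr0.
have us : (mdeg u < msize f)%N by apply: msize_mdeg_lt; rewrite mcoeff_msupp.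
rewrite (bigD1_seq ((mdeg u)%:Z - d)) ?int_range_uniq //=; last by apply: mem_int_range; lia.
rewrite subrK eqxx mul1r big1 ?addr0 // => t tu.
by case: eqP => [e|]; [case/eqP: tu; rewrite -e addrK|rewrite mul0r].
Qed.

Lemma pieceM k n f g : piece k f -> piece n g -> piece (k + n) (f * g).
Proof. exact: mpoly_pieceZ. Qed.

Lemma piece0 n : piece n 0.
Proof. exact: mpoly_piece0. Qed.

Lemma pieceN n f : piece n f -> piece n (- f).
Proof. by move=> nf; rewrite -[- f]add0r; apply: mpoly_pieceB => //; apply: piece0. Qed.

Lemma pieceD n f g : piece n f -> piece n g -> piece n (f + g).
Proof. by move=> nf ng; rewrite -[g]opprK; apply: mpoly_pieceB => //; apply: pieceN. Qed.

Lemma piece_sum n (T : Type) (s : seq T) (P : pred T) (F : T -> R) :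
  (forall j, P j -> piece n (F j)) -> piece n (\sum_(j <- s | P j) F j).
Proof.
move=> FP; apply: (big_ind (piece n)) => //; first exact: piece0.
by move=> f g; apply: pieceD.
Qed.

Lemma piece_exp k f q : piece k f -> piece (k * q%:Z) (f ^+ q).
Proof.
move=> kf; elim: q => [|q IH].
  by rewrite mulr0 expr0 /=; apply: dhomog1.
by rewrite exprS intS mulrDr mulr1; apply: pieceM.
Qed.

End Components.

Section GradedModuleTheory.
Variables (S : comNzRingType) (Sdeg : int -> set S).
Implicit Types (M N : gradedModule Sdeg).

Lemma gm_pieceN M n (x : M) : gm_piece n x -> gm_piece n (- x).
Proof. by move=> nx; rewrite -[- x]add0r; apply: gm_pieceB => //; apply: gm_piece0. Qed.

Lemma gm_pieceD M n (x y : M) : gm_piece n x -> gm_piece n y -> gm_piece n (x + y).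
Proof. by move=> nx ny; rewrite -[y]opprK; apply: gm_pieceB => //; apply: gm_pieceN. Qed.

Lemma gm_piece_sum M n (T : Type) (s : seq T) (P : pred T) (F : T -> M) :
  (forall j, P j -> gm_piece n (F j)) -> gm_piece n (\sum_(j <- s | P j) F j).
Proof.
move=> FP; apply: (big_ind (@gm_piece _ _ M n)) => //; first exact: gm_piece0.
by move=> f g; apply: gm_pieceD.
Qed.

(** Repeated degrees are merged, and n is added if needed. *)
Lemma gm_span_uniq M (x : M) (n : int) : exists (s : seq int) (f : int -> M),
  [/\ uniq s, n \in s, forall k, gm_piece k (f k) & x = \sum_(k <- s) f k].
Proof.
have [s [f [fP ->]]] := gm_span x.
exists (undup (n :: s)), (fun k => f k *+ count_mem k s).
split=> [||k|]; [exact: undup_uniq|by rewrite mem_undup mem_head| |].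
  elim: (count_mem k s) => [|c IH]; first exact: gm_piece0.
  by rewrite mulrS; apply: gm_pieceD.
have sub : {subset s <= undup (n :: s)} by move=> k ks; rewrite mem_undup in_cons ks orbT.
move: (undup _) (undup_uniq (n :: s)) sub => u uu; elim: s => [|k s IH] sub.
  by rewrite big_nil big1 // => k _; rewrite mulr0n.
rewrite big_cons IH; last by move=> l ls; apply: sub; rewrite in_cons ls orbT.
have ku : k \in u by apply: sub; rewrite mem_head.
under [RHS]eq_bigr do rewrite /= mulrnDr; rewrite big_split /=; congr (_ + _).
rewrite (bigD1_seq k) //= eqxx mulr1n big1 ?addr0 // => l lk.
by rewrite eq_sym (negPf lk) mulr0n.
Qed.

Lemma gm_component M (x : M) n s (f : int -> M) : gm_piece n x -> uniq s ->
  n \in s -> (forall k, gm_piece k (f k)) -> x = \sum_(k <- s) f k -> f n = x.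
Proof.
move=> nx us ns fP e.
pose g k := f k - (if k == n then x else 0).
have gP k : gm_piece k (g k).
  by apply: gm_pieceB => //; case: eqP => [->//|_]; apply: gm_piece0.
have g0 : \sum_(k <- s) g k = 0.
  rewrite sumrB -e (bigD1_seq n) //= eqxx big1 ?addr0 ?subrr // => k /negPf ->.
  by [].
have := gm_indep us gP g0 ns; rewrite /g eqxx => /eqP.
by rewrite subr_eq0 => /eqP.
Qed.

(** Take the component of degree n of any preimage. *)
Lemma gm_homog_preim M N (f : {linear M -> N}) y z n : is_graded f ->
  f y = z -> gm_piece n z -> exists2 y', gm_piece n y' & f y' = z.
Proof.
move=> fgr fy nz; have [s [g [us ns gP yE]]] := gm_span_uniq y n.
exists (g n) => //; apply: (@gm_component N z n s (fun k => f (g k))) => //.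
  by move=> k; apply: fgr.
by rewrite -fy yE linear_sum.
Qed.

End GradedModuleTheory.
(** * Graded injectivity and free modules *)

Section FreeGraded.
Variables (A : idomainType) (m : nat).
Local Notation R := {mpoly A[m]}.
Local Notation piece := (@mpoly_piece A m).

Variables (r : nat) (dg : 'I_r -> int).
Definition free_piece (n : int) : set 'rV[R]_r :=
  [set v | forall k, piece (n - dg k) (v 0 k)].

Lemma free_piece0 n : free_piece n 0.
Proof. by move=> k; rewrite mxE; apply: piece0. Qed.

Lemma free_pieceB n v w : free_piece n v -> free_piece n w -> free_piece n (v - w).
Proof. by move=> nv nw k; rewrite !mxE; apply: mpoly_pieceB. Qed.

Lemma free_pieceZ k n a v : piece k a -> free_piece n v -> free_piece (k + n) (a *: v).
Proof. by move=> ka nv l; rewrite mxE -addrA; apply: pieceM. Qed.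

Lemma free_span (v : 'rV[R]_r) : exists (s : seq int) (f : int -> 'rV[R]_r),
  (forall n, free_piece n (f n)) /\ v = \sum_(n <- s) f n.
Proof.
pose M := (\max_k (msize (v ord0 k) + absz (- dg k)))%N.
exists (int_range M), (fun n => \row_k mcomp (n - dg k) (v 0 k)); split.
  by move=> n k; rewrite mxE; apply: mcomp_piece.
apply/rowP => k; rewrite summxE; under eq_bigr do rewrite mxE.
by apply: mcomp_total; rewrite /M (bigD1 k) //= leq_maxl.
Qed.

Lemma free_indep (s : seq int) (f : int -> 'rV[R]_r) : uniq s ->
  (forall n, free_piece n (f n)) -> \sum_(n <- s) f n = 0 ->
  forall n, n \in s -> f n = 0.
Proof.
move=> us fP e n ns; apply/rowP => k; rewrite mxE.
have := congr1 (fun v : 'rV[R]_r => mcomp (n - dg k) (v 0 k)) e.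
rewrite summxE mxE raddf_sum raddf0 (bigD1_seq n) //= mcomp_id; last exact: fP.
rewrite big1 ?addr0 // => l ln; apply/mpolyP => t; rewrite mcoeff_mcomp mcoeff0.
have [->|ft] := eqVneq (f l 0 k)@_t 0; first by rewrite mulr0.
have [H _] := pieceE (l - dg k) (f l 0 k); have {H}e' := H (fP l k) t ft.
by rewrite -e' (inj_eq (addIr _)) eq_sym (negPf ln) mul0r.
Qed.

Definition free_graded : gradedModule piece :=
  @GradedModule R piece 'rV[R]_r free_piece free_piece0 free_pieceB free_pieceZ
    free_span free_indep.

Variables (n : nat) (g : 'I_n -> 'rV[R]_r) (deg : 'I_n -> int).
Hypothesis gdeg : forall k, free_piece (deg k) (g k).

Definition span_pred : {pred 'rV[R]_r} :=
  fun v => `[< exists a : 'I_n -> R, v = \sum_k a k *: g k >].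

Lemma span_submod_closed : submod_closed span_pred.
Proof.
split=> [|c v w /asboolP[a ->] /asboolP[b ->]]; apply/asboolP.
  by exists (fun=> 0); rewrite big1 // => k _; rewrite scale0r.
exists (fun k => c * a k + b k); rewrite scaler_sumr -big_split.
by apply: eq_bigr => k _; rewrite scalerDl scalerA.
Qed.

Record span_type := SpanType { span_val : 'rV[R]_r; _ : span_val \in span_pred }.
HB.instance Definition _ := [isSub of span_type for span_val].
HB.instance Definition _ := [Choice of span_type by <:].
HB.instance Definition _ :=
  GRing.SubChoice_isSubLmodule.Build R 'rV[R]_r span_pred span_type span_submod_closed.

Definition sub_piece (k : int) : set span_type := [set u | free_piece k (val u)].

Lemma sub_piece0 k : sub_piece k 0.
Proof. by rewrite /sub_piece /mkset raddf0; apply: free_piece0. Qed.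

Lemma sub_pieceB k u v : sub_piece k u -> sub_piece k v -> sub_piece k (u - v).
Proof. by rewrite /sub_piece /mkset raddfB; apply: free_pieceB. Qed.

Lemma sub_pieceZ k l a u : piece k a -> sub_piece l u -> sub_piece (k + l) (a *: u).
Proof. by rewrite /sub_piece /mkset linearZ; apply: free_pieceZ. Qed.

Lemma sub_span (u : span_type) : exists (s : seq int) (f : int -> span_type),
  (forall k, sub_piece k (f k)) /\ u = \sum_(k <- s) f k.
Proof.
have [a uE] := asboolP _ (valP u).
pose M := (\max_k (msize (a k) + absz (- deg k)))%N.
have fP t : \sum_k mcomp (t - deg k) (a k) *: g k \in span_pred.
  by apply/asboolP; exists (fun k => mcomp (t - deg k) (a k)).
exists (int_range M), (fun t => SpanType (fP t)); split=> [t|].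
  apply: (@gm_piece_sum _ _ free_graded) => k _ /=.
  by rewrite -{1}(subrK (deg k) t); apply: free_pieceZ => //; apply: mcomp_piece.
apply: val_inj; rewrite raddf_sum /= uE exchange_big; apply: eq_bigr => k _.
rewrite -scaler_suml; congr (_ *: _).
by apply: mcomp_total; rewrite /M (bigD1 k) //= leq_maxl.
Qed.

Lemma sub_indep (s : seq int) (f : int -> span_type) : uniq s ->
  (forall n, sub_piece n (f n)) -> \sum_(n <- s) f n = 0 ->
  forall n, n \in s -> f n = 0.
Proof.
move=> us fP e k ks; apply: val_inj; rewrite raddf0.
apply: (free_indep (f := fun n => val (f n)) us fP _ ks).
by have := congr1 val e; rewrite raddf_sum raddf0.
Qed.

Definition span_graded : gradedModule piece :=
  @GradedModule R piece span_type sub_piece sub_piece0 sub_pieceB sub_pieceZ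
    sub_span sub_indep.

(** Extend along the inclusion of the graded submodule spanned by the g k: the
    condition on relations makes g k |-> z k well defined on it, and replacing
    coefficients by homogeneous components shows that degrees are preserved. *)
Lemma injective_extend (Q : gradedModule piece) (z : 'I_n -> Q) :
  is_graded_injective Q -> (forall k, gm_piece (deg k) (z k)) ->
  (forall a : 'I_n -> R, \sum_k a k *: g k = 0 -> \sum_k a k *: z k = 0) ->
  exists h : {linear free_graded -> Q}, is_graded h /\ forall k, h (g k) = z k.
Proof.
move=> Qinj zdeg gz.
have /choice[a aP] (u : span_type) : exists a : 'I_n -> R, val u = \sum_k a k *: g k.
  exact: asboolP _ (valP u).
pose f (u : span_graded) : Q := \sum_k a u k *: z k.
have fE u (b : 'I_n -> R) : val (u : span_type) = \sum_k b k *: g k -> f u = \sum_k b k *: z k.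
  move=> ub; apply/eqP; rewrite -subr_eq0 -sumrB; apply/eqP.
  under eq_bigr do rewrite -scalerBl; apply: gz.
  under eq_bigr do rewrite scalerBl; by rewrite sumrB -ub -aP subrr.
have flin : linear f.
  move=> c u v; rewrite (fE _ (fun k => c * a u k + a v k)).
    rewrite scaler_sumr -big_split; apply: eq_bigr => k _.
    by rewrite scalerDl scalerA.
  rewrite [LHS]linearP /= !aP scaler_sumr -big_split; apply: eq_bigr => k _.
  by rewrite scalerDl scalerA.
pose fl : {linear span_graded -> Q} := HB.pack f (GRing.isLinear.Build _ _ _ _ f flin).
pose jl : {linear span_graded -> free_graded} := (val : span_type -> 'rV[R]_r).
have [|||h [hg hE]] := Qinj span_graded free_graded jl fl.
- by move=> k u.
- exact: val_inj.
- move=> l u lu /=; rewrite (fE _ (fun k => mcomp (l - deg k) (a u k))).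
    apply: gm_piece_sum => k _; rewrite -{1}(subrK (deg k) l).
    by apply: gm_pieceZ => //; apply: mcomp_piece.
  apply/rowP => i; have := congr1 (fun v : 'rV[R]_r => v 0 i) (aP u).
  rewrite !summxE => e; rewrite -(mcomp_id (lu i)) e raddf_sum /=.
  apply: eq_bigr => k _; rewrite !mxE -(mcompMr _ _ (gdeg k i)).
  by congr mcomp; ring.
have gS k : g k \in span_pred.
  apply/asboolP; exists (fun l => (l == k)%:R).
  by rewrite (bigD1 k) //= eqxx scale1r big1 ?addr0 // => l /negPf ->; rewrite scale0r.
exists h; split=> // k; rewrite -[g k]/(jl (SpanType (gS k))) hE /=.
rewrite (fE _ (fun l => (l == k)%:R)).
  by rewrite (bigD1 k) //= eqxx scale1r big1 ?addr0 // => l /negPf ->; rewrite scale0r.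
by rewrite (bigD1 k) //= eqxx scale1r big1 ?addr0 // => l /negPf ->; rewrite scale0r.
Qed.

End FreeGraded.
(** * Graded free resolutions and the Frobenius functor *)

Section Resolutions.
Variables (A : idomainType) (m : nat).
Local Notation R := {mpoly A[m]}.
Local Notation piece := (@mpoly_piece A m).
Implicit Types (r : nat -> nat) (D : nat -> nat -> nat -> R) (dg : nat -> nat -> int).

(** The graded free resolution ... -> R^(r 2) -> R^(r 1) -> R -> R/J, with basis
    elements of degree dg; D j is the matrix of a differential acting on row vectors.
    Indexing by nat, with bounds, avoids casts between dimensions. *)
Record resolves (J : set R) r D dg : Prop := Resolves {
  res_r0 : r 0%N = 1%N;
  res_dg0 : dg 0%N 0%N = 0;
  res_hom : forall j k k', (k < r j.+1)%N -> (k' < r j)%N ->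
    piece (dg j.+1 k - dg j k') (D j k k');
  res_cpx : forall j k k', (k < r j.+2)%N -> (k' < r j)%N ->
    \sum_(l < r j.+1) D j.+1 k l * D j l k' = 0;
  res_exact : forall j (v : nat -> R),
    (forall k', (k' < r j)%N -> \sum_(k < r j.+1) v k * D j k k' = 0) ->
    exists u : nat -> R, forall k, (k < r j.+1)%N -> v k = \sum_(l < r j.+2) u l * D j.+1 l k;
  res_aug : forall x, J x <-> exists u : nat -> R, x = \sum_(k < r 1%N) u k * D 0%N k 0%N
}.

(** Replace the coefficients by their components of the expected degree. *)
Lemma row_homog J r D dg j t (v u : nat -> R) : resolves J r D dg ->
  (forall k, (k < r j)%N -> piece (t - dg j k) (v k)) ->
  (forall k, (k < r j)%N -> v k = \sum_(l < r j.+1) u l * D j l k) ->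
  exists u' : nat -> R, (forall l, piece (t - dg j.+1 l) (u' l)) /\
    forall k, (k < r j)%N -> v k = \sum_(l < r j.+1) u' l * D j l k.
Proof.
move=> res vt vE; exists (fun l => mcomp (t - dg j.+1 l) (u l)); split=> [l|k kr].
  exact: mcomp_piece.
rewrite -(mcomp_id (vt k kr)) vE // raddf_sum; apply: eq_bigr => l _ /=.
have Dh := res_hom res (ltn_ord l) kr.
by rewrite -(mcompMr _ _ Dh); congr mcomp; ring.
Qed.

Lemma homogeneous_gens (I : set R) : is_noetherian R ->
  is_homogeneous_ideal piece I -> exists (d : nat) (g : nat -> R) (dg : nat -> int),
    (forall k, (k < d)%N -> piece (dg k) (g k)) /\
    forall x, I x <-> exists u : nat -> R, x = \sum_(k < d) u k * g k.
Proof.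
move=> nR [Ii Ih]; pose G := I `&` [set a | exists n, piece n a].
have [T [g [gG gs]]] := noeth_fin_gen nR G.
have /choice[dg dgP] j : exists n, piece n (g j) by case: (gG j).
exists #|T|, (fun k => if insub k is Some i then g (enum_val (i : 'I_#|T|)) else 0).
exists (fun k => if insub k is Some i then dg (enum_val (i : 'I_#|T|)) else 0); split=> [k kT|x].
  by rewrite insubT; apply: dgP.
split=> [|[u ->]]; last first.
  apply: ideal_sum => // k _; rewrite valK; case: (Ii) => _ _; apply.
  by case: (gG (enum_val k)).
rewrite Ih => /(@ideal_span_le _ _ [set x | exists a : T -> R, x = \sum_j a j * g j]) [].
- split=> [|_ _ [a ->] [b ->]|c _ [a ->]] /=.
  + by exists (fun=> 0); rewrite big1 // => j _; rewrite mul0r.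
  + by exists (fun j => a j + b j); rewrite -big_split; apply: eq_bigr => j _; rewrite mulrDl.
  + by exists (fun j => c * a j); rewrite mulr_sumr; apply: eq_bigr => j _; rewrite mulrA.
- by move=> y /gs.
move=> a ->; exists (fun k => if insub k is Some i then a (enum_val (i : 'I_#|T|)) else 0).
rewrite (reindex (@enum_val T predT)) /=; last exact: onW_bij (enum_val_bij T).
by apply: eq_bigr => k _; rewrite !valK.
Qed.

(** The homogeneous components of a syzygy are syzygies, so that finitely many
    homogeneous ones generate. *)
Lemma homogeneous_syzygies (n1 n0 : nat) (D : nat -> nat -> R) (d1 d0 : nat -> int) :
  is_noetherian R ->
  (forall k k', (k < n1)%N -> (k' < n0)%N -> piece (d1 k - d0 k') (D k k')) ->
  exists (n2 : nat) (D' : nat -> nat -> R) (d2 : nat -> int),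
  [/\ forall k k', (k < n2)%N -> (k' < n1)%N -> piece (d2 k - d1 k') (D' k k'),
      forall k k', (k < n2)%N -> (k' < n0)%N -> \sum_(l < n1) D' k l * D l k' = 0 &
      forall v : nat -> R, (forall k', (k' < n0)%N -> \sum_(k < n1) v k * D k k' = 0) ->
        exists u : nat -> R, forall k, (k < n1)%N -> v k = \sum_(l < n2) u l * D' l k].
Proof.
move=> nR Dh.
pose G := [set v : nat -> R | (exists t, forall k, (k < n1)%N -> piece (t - d1 k) (v k)) /\
  forall k', (k' < n0)%N -> \sum_(k < n1) v k * D k k' = 0].
have [T [g [gG gs]]] := noeth_fin_module nR n1 G.
have /choice[dg dgP] j : exists t, forall k, (k < n1)%N -> piece (t - d1 k) (g j k).
  by case: (gG j).
exists #|T|, (fun k => if insub k is Some i then g (enum_val (i : 'I_#|T|)) else fun=> 0).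
exists (fun k => if insub k is Some i then dg (enum_val (i : 'I_#|T|)) else 0).
split=> [k k' kT k'n|k k' kT k'n|v vD].
- by rewrite insubT; apply: dgP.
- by rewrite insubT; case: (gG (enum_val (Ordinal kT))) => _; apply.
pose M := (\max_(k < n1) (msize (v k) + absz (- d1 k)))%N.
pose vt t k := mcomp (t - d1 k) (v k).
have vtG t : G (vt t).
  split; first by exists t => k _; apply: mcomp_piece.
  move=> k' k'n; have := congr1 (mcomp (t - d0 k')) (vD k' k'n).
  rewrite raddf_sum raddf0 => e; rewrite -[RHS]e; apply: eq_bigr => k _ /=.
  have Dkk := Dh k k' (ltn_ord k) k'n.
  by rewrite -(mcompMr _ _ Dkk); congr mcomp; ring.
have /choice[a aP] t : exists a : T -> R, forall k, (k < n1)%N -> vt t k = \sum_j a j * g j k.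
  exact: gs (vtG t).
exists (fun k => if insub k is Some i then \sum_(t <- int_range M) a t (enum_val (i : 'I_#|T|)) else 0).
move=> k kn; transitivity (\sum_(t <- int_range M) vt t k).
  by apply: mcomp_total; rewrite /M (bigD1 (Ordinal kn)) //= leq_maxl.
under eq_bigr do rewrite aP //.
rewrite exchange_big (reindex (@enum_val T predT)) /=; last exact: onW_bij (enum_val_bij T).
by apply: eq_bigr => l _; rewrite !valK mulr_suml.
Qed.

Lemma resolution_exists (I : set R) : is_noetherian R -> is_homogeneous_ideal piece I ->
  exists r D dg, resolves I r D dg.
Proof.
move=> nR Ih; have [d [g [dg0 [gh gI]]]] := homogeneous_gens nR Ih.
pose stage := ((nat * (nat -> int)) * (nat * (nat -> int) * (nat -> nat -> R)))%type.
pose ok (s : stage) := forall k k', (k < s.2.1.1)%N -> (k' < s.1.1)%N ->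
  piece (s.2.1.2 k - s.1.2 k') (s.2.2 k k').
have /choice[nxt nxtP] (s : stage) : exists w : nat * (nat -> int) * (nat -> nat -> R),
    ok s ->
    [/\ forall k k', (k < w.1.1)%N -> (k' < s.2.1.1)%N -> piece (w.1.2 k - s.2.1.2 k') (w.2 k k'),
      forall k k', (k < w.1.1)%N -> (k' < s.1.1)%N -> \sum_(l < s.2.1.1) w.2 k l * s.2.2 l k' = 0 &
      forall v : nat -> R, (forall k', (k' < s.1.1)%N -> \sum_(k < s.2.1.1) v k * s.2.2 k k' = 0) ->
        exists u : nat -> R, forall k, (k < s.2.1.1)%N -> v k = \sum_(l < w.1.1) u l * w.2 l k].
  case: (pselect (ok s)) => sok; last by exists s.2.
  by have [n2 [D' [d2 H]]] := homogeneous_syzygies nR sok; exists (n2, d2, D').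
pose s0 : stage := ((1%N, fun=> 0), (d, dg0, fun k _ => g k)).
pose st := fix st j : stage := if j is j'.+1 then ((st j').2.1, nxt (st j')) else s0.
have stok j : ok (st j).
  elim: j => [|j IH]; first by move=> k k' /= kd _; rewrite subr0; apply: gh.
  by have [H _ _] := nxtP _ IH; move=> k k'; apply: H.
exists (fun j => (st j).1.1), (fun j => (st j).2.2), (fun j => (st j).1.2); split=> //.
- by move=> j k k'; have [_ H _] := nxtP _ (stok j); exact: (H k k').
- by move=> j v vD; have [_ _ H] := nxtP _ (stok j); exact: (H v vD).
Qed.

Section Frobenius.
Variable q : nat.
Hypothesis q0 : (0 < q)%N.
Hypothesis qD : forall a b : A, (a + b) ^+ q = a ^+ q + b ^+ q.
Hypothesis qDR : forall a b : R, (a + b) ^+ q = a ^+ q + b ^+ q.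
Hypothesis flatA : forall (I : finType) (c : I -> A), frob_flat q c.

Definition frob_mx (D : nat -> nat -> nat -> R) j k l := D j k l ^+ q.

Definition frob_ideal (J : set R) := ideal_span [set x ^+ q | x in J].

(** Base change along the flat Frobenius map: raising the entries to the power q turns
    a resolution of R/J into one of R/J^[q]. *)
Lemma resolves_frob J r D dg : resolves J r D dg ->
  resolves (frob_ideal J) r (frob_mx D) (fun j k => dg j k * q%:Z).
Proof.
move=> res; split; first exact: res_r0 res.
- by rewrite (res_dg0 res) mul0r.
- move=> j k k' kr k'r; rewrite -mulrBl; apply: piece_exp; exact: res_hom res _ _ _ _ _.
- move=> j k k' kr k'r; rewrite /frob_mx; under eq_bigr do rewrite -exprMn.
  by rewrite -(frob_sum q0 qDR) (res_cpx res) // expr0n eqn0Ngt q0.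
- move=> j v vD.
  have [|T [b [a [Z [_ ZS vE]]]]] := frob_flat_mpoly q0 qD qDR flatA
    (M := fun (k : 'I_(r j.+1)) (k' : 'I_(r j)) => D j k k') (y := fun k => v k).
    by move=> k'; apply: vD.
  pose Zn t k := if insub k is Some i then Z t i else 0.
  have ZnE t (k : 'I_(r j.+1)) : Zn t k = Z t k by rewrite /Zn valK.
  have /choice[u uP] t : exists u : nat -> R,
      forall k, (k < r j.+1)%N -> Zn t k = \sum_(l < r j.+2) u l * D j.+1 l k.
    apply: (res_exact res) => k' k'r; rewrite -[RHS](ZS t (Ordinal k'r)).
    by apply: eq_bigr => k _; rewrite ZnE.
  exists (fun l => \sum_t b t *: ('X_[a t] * u t l ^+ q)) => k kr.
  rewrite -[k]/(val (Ordinal kr)) vE.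
  under [RHS]eq_bigr do rewrite mulr_suml.
  rewrite exchange_big; apply: eq_bigr => t _.
  rewrite -ZnE uP // (frob_sum q0 qDR) mulr_sumr scaler_sumr.
  by apply: eq_bigr => l _; rewrite exprMn mulrA scalerAl.
move=> x; split=> [|[u ->]].
  move=> /(@ideal_span_le _ _ [set x | exists u : nat -> R, x = \sum_(k < r 1%N) u k * D 0%N k 0%N ^+ q]) [].
  - split=> [|_ _ [a ->] [b ->]|c _ [a ->]] /=.
    + by exists (fun=> 0); rewrite big1 // => j _; rewrite mul0r.
    + by exists (fun j => a j + b j); rewrite -big_split; apply: eq_bigr => j _; rewrite mulrDl.
    + by exists (fun j => c * a j); rewrite mulr_sumr; apply: eq_bigr => j _; rewrite mulrA.
  - move=> _ [y /(res_aug res)[u ->] <-]; exists (fun k => u k ^+ q).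
    by rewrite (frob_sum q0 qDR); apply: eq_bigr => k _; rewrite exprMn.
  - by move=> u ->; exists u.
apply: ideal_sum; first exact: ideal_span_ideal.
move=> k _; case: (ideal_span_ideal [set x ^+ q | x in J]) => _ _; apply.
apply: ideal_span_gen; exists (D 0%N k 0%N) => //.
apply/(res_aug res); exists (fun l : nat => (l == k)%:R).
rewrite (bigD1 k) //= eqxx mul1r big1 ?addr0 // => l lk.
have -> : (l == k :> nat) = false by rewrite (inj_eq val_inj) (negPf lk).
by rewrite mul0r.
Qed.

End Frobenius.

(** That th 0 0 0 = 1 says that the map of resolutions lifts R/J' -> R/J. *)
Record chain_map r' D' dg' r D dg (th : nat -> nat -> nat -> R) : Prop := ChainMap {
  cm_0 : th 0%N 0%N 0%N = 1;
  cm_hom : forall j k l, (k < r' j)%N -> (l < r j)%N -> piece (dg' j k - dg j l) (th j k l);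
  cm_comm : forall j k k', (k < r' j.+1)%N -> (k' < r j)%N ->
    \sum_(l < r j.+1) th j.+1 k l * D j l k' = \sum_(l < r' j) D' j k l * th j l k'
}.

Lemma chain_map_frob q r' D' dg' r D dg th : (0 < q)%N ->
  (forall a b : R, (a + b) ^+ q = a ^+ q + b ^+ q) ->
  chain_map r' D' dg' r D dg th ->
  chain_map r' (frob_mx q D') (fun j k => dg' j k * q%:Z)
            r (frob_mx q D) (fun j k => dg j k * q%:Z) (frob_mx q th).
Proof.
move=> q0 qDR cm; split; first by rewrite /frob_mx (cm_0 cm) expr1n.
- move=> j k l kr lr; rewrite -mulrBl; apply: piece_exp; exact: cm_hom cm _ _ _ _ _.
- move=> j k k' kr k'r; rewrite /frob_mx.
  under eq_bigr do rewrite -exprMn; under [RHS]eq_bigr do rewrite -exprMn.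
  by rewrite -!(frob_sum q0 qDR) (cm_comm cm).
Qed.

(** The usual lifting along the resolution of R/J, homogeneous by [row_homog]. *)
Lemma chain_map_exists J J' r' D' dg' r D dg : J' `<=` J ->
  resolves J' r' D' dg' -> resolves J r D dg ->
  exists th, chain_map r' D' dg' r D dg th.
Proof.
move=> J'J res' res.
pose hom j (t : nat -> nat -> R) := forall k l, (k < r' j)%N -> (l < r j)%N ->
  piece (dg' j k - dg j l) (t k l).
pose good j (t : nat -> nat -> R) := hom j t /\ forall k, (k < r' j.+1)%N ->
  exists u : nat -> R, forall k', (k' < r j)%N ->
    \sum_(l < r' j) D' j k l * t l k' = \sum_(l < r j.+1) u l * D j l k'.
have /choice[nxt nxtP] (jt : nat * (nat -> nat -> R)) : exists t' : nat -> nat -> R,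
    good jt.1 jt.2 -> good jt.1.+1 t' /\
    forall k k', (k < r' jt.1.+1)%N -> (k' < r jt.1)%N ->
      \sum_(l < r jt.1.+1) t' k l * D jt.1 l k' = \sum_(l < r' jt.1) D' jt.1 k l * jt.2 l k'.
  case: jt => j t /=; case: (pselect (good j t)) => [[th tE]|]; last by exists t.
  have /choice[t' t'P] k : exists u : nat -> R, (k < r' j.+1)%N ->
      (forall l, piece (dg' j.+1 k - dg j.+1 l) (u l)) /\
      forall k', (k' < r j)%N -> \sum_(l < r' j) D' j k l * t l k' = \sum_(l < r j.+1) u l * D j l k'.
    case: (ltnP k (r' j.+1)) => kr; last by exists (fun=> 0).
    have [u uE] := tE k kr.
    have [k' k'r|u' H] := row_homog (t := dg' j.+1 k) res _ uE; last by exists u'.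
    apply: piece_sum => l _.
    have := pieceM (res_hom res' kr (ltn_ord l)) (th l k' (ltn_ord l) k'r).
    by congr (piece _ _); ring.
  exists t' => _; have tc k k' : (k < r' j.+1)%N -> (k' < r j)%N ->
      \sum_(l < r j.+1) t' k l * D j l k' = \sum_(l < r' j) D' j k l * t l k'.
    by move=> kr k'r; have [_ H] := t'P k kr; rewrite H.
  split=> //; split=> [k l kr _|k kr]; first by case: (t'P k kr).
  apply: (res_exact res (v := fun k' => \sum_(l < r' j.+1) D' j.+1 k l * t' l k')) => k'' k''r.
  transitivity (\sum_(l < r' j.+1) D' j.+1 k l * \sum_(l' < r' j) D' j l l' * t l' k'').
    under eq_bigr do rewrite mulr_suml.
    rewrite exchange_big; apply: eq_bigr => l _ /=.
    rewrite -tc // mulr_sumr; apply: eq_bigr => i _; by rewrite mulrA.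
  under eq_bigr do rewrite mulr_sumr.
  rewrite exchange_big big1 // => l' _ /=.
  under eq_bigr do rewrite mulrA; by rewrite -mulr_suml (res_cpx res') ?mul0r.
pose ts := fix ts j := if j is j'.+1 then nxt (j', ts j') else fun _ _ : nat => 1 : R.
have ts_good j : good j (ts j).
  elim: j => [|j IH]; last by case: (nxtP (j, ts j) IH).
  split=> [k l|k kr]; rewrite ?(res_r0 res) ?(res_r0 res').
    rewrite !ltnS !leqn0 => /eqP -> /eqP ->; rewrite (res_dg0 res) (res_dg0 res') subrr.
    exact: dhomog1.
  have : J (D' 0%N k 0%N).
    apply: J'J; apply/(res_aug res'); exists (fun l : nat => (l == k)%:R).
    rewrite (bigD1 (Ordinal kr)) //= eqxx mul1r big1 ?addr0 // => l lk.
    have -> : (l == k :> nat) = false by rewrite -[k]/(val (Ordinal kr)) (inj_eq val_inj) (negPf lk).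
    by rewrite mul0r.
  move=> /(res_aug res)[u uE]; exists u => k'; rewrite !ltnS leqn0 => /eqP ->.
  by rewrite big_ord_recl big_ord0 /= addr0 mulr1.
exists ts; split=> // [j k l|j k k' kr k'r].
  by case: (ts_good j) => H _; apply: H.
by have [_ H] := nxtP (j, ts j) (ts_good j); apply: H.
Qed.

End Resolutions.
(** * Comparing injective and free resolutions *)

Section Zigzag.
Variables (A : idomainType) (m : nat).
Local Notation R := {mpoly A[m]}.
Local Notation piece := (@mpoly_piece A m).
Local Notation M := (mpoly_module A m).

(** A column vector with n entries in V is a homomorphism from R^n to V; act D is
    composition with the matrix D. *)
Definition act (V : lmodType R) (D : nat -> nat -> R) n (z : nat -> V) k : V :=
  \sum_(k' < n) D k k' *: z k'.

(** The homomorphism z has degree t on the free module with basis degrees dg. *)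
Definition homog_at (V : gradedModule piece) (dg : nat -> int) n (t : int) (z : nat -> V) :=
  forall k, (k < n)%N -> gm_piece (t + dg k) (z k).

Lemma act_ext (V : lmodType R) D n (z z' : nat -> V) k :
  (forall l, (l < n)%N -> z l = z' l) -> act D n z k = act D n z' k.
Proof. by move=> e; apply: eq_bigr => l _; rewrite e. Qed.

Lemma act_lin (V : lmodType R) D n (z z' : nat -> V) a k :
  act D n (fun l => z l + a *: z' l) k = act D n z k + a *: act D n z' k.
Proof.
rewrite /act scaler_sumr -big_split; apply: eq_bigr => l _ /=.
by rewrite scalerDr !scalerA [a * _]mulrC.
Qed.

Lemma act_map (V W : lmodType R) (f : {linear V -> W}) D n z k :
  f (act D n z k) = act D n (fun l => f (z l)) k.
Proof. by rewrite linear_sum; apply: eq_bigr => l _; rewrite linearZ. Qed.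

Lemma act_act (V : lmodType R) D D' n n' (z : nat -> V) k :
  act D n (act D' n' z) k = \sum_(l < n') (\sum_(i < n) D k i * D' i l) *: z l.
Proof.
rewrite /act; under eq_bigr do rewrite scaler_sumr.
rewrite exchange_big; apply: eq_bigr => l _ /=.
by rewrite scaler_suml; apply: eq_bigr => i _; rewrite scalerA.
Qed.

Lemma act0 (V : lmodType R) D n (z : nat -> V) k :
  (forall l, (l < n)%N -> z l = 0) -> act D n z k = 0.
Proof. by move=> z0; rewrite /act big1 // => l _; rewrite z0 ?scaler0. Qed.

Lemma act_homog (V : gradedModule piece) D n n' (dg dg' : nat -> int) t (z : nat -> V) :
  (forall k k', (k < n')%N -> (k' < n)%N -> piece (dg' k - dg k') (D k k')) ->
  homog_at dg n t z -> homog_at dg' n' t (act D n z).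
Proof.
move=> Dh zt k kn; apply: gm_piece_sum => l _.
have -> : t + dg' k = (dg' k - dg l) + (t + dg l) by ring.
by apply: gm_pieceZ; [apply: Dh|apply: zt].
Qed.

Variable E : injectiveResolution M.

Section OneResolution.
Variables (J : set R) (r : nat -> nat) (D : nat -> nat -> nat -> R) (dg : nat -> nat -> int).
Hypothesis res : resolves J r D dg.

Local Notation actD j := (act (D j) (r j)).

Lemma actD_homog (V : gradedModule piece) j t (z : nat -> V) :
  homog_at (dg j) (r j) t z -> homog_at (dg j.+1) (r j.+1) t (actD j z).
Proof. apply: act_homog; exact: res_hom res j. Qed.

Lemma actDD (V : lmodType R) j (z : nat -> V) k : (k < r j.+2)%N ->
  actD j.+1 (actD j z) k = 0.
Proof.
move=> kr; rewrite act_act big1 // => l _.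
by rewrite (res_cpx res) ?scale0r.
Qed.

(** Exactness of Hom(-, Q) on the free resolution: z defines a map on the image of D j,
    which extends to the free module. *)
Lemma hom_exact (Q : gradedModule piece) j t (z : nat -> Q) : is_graded_injective Q ->
  homog_at (dg j.+1) (r j.+1) t z ->
  (forall k, (k < r j.+2)%N -> actD j.+1 z k = 0) ->
  exists w, homog_at (dg j) (r j) t w /\ forall k, (k < r j.+1)%N -> z k = actD j w k.
Proof.
move=> Qinj zt zD.
pose g (k : 'I_(r j.+1)) : 'rV[R]_(r j) := \row_k' D j k k'.
have gh (k : 'I_(r j.+1)) : free_piece (fun k' : 'I_(r j) => t + dg j k') (t + dg j.+1 k) (g k).
  move=> k'; rewrite mxE.
  have -> : t + dg j.+1 k - (t + dg j k') = dg j.+1 k - dg j k' by ring.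
  exact: res_hom res j _ _ (ltn_ord k) (ltn_ord k').
have [k|a aD|h [hg hE]] := injective_extend gh (z := fun k => z k) Qinj; first exact: zt.
  pose an k := if insub k is Some i then a i else 0.
  have anE (k : 'I_(r j.+1)) : an k = a k by rewrite /an valK.
  have [k' k'r|u uE] := res_exact res (v := an) (j := j).
    have := congr1 (fun v : 'rV[R]_(r j) => v 0 (Ordinal k'r)) aD.
    rewrite summxE mxE => e; rewrite -[RHS]e; apply: eq_bigr => k _.
    by rewrite anE !mxE.
  transitivity (\sum_(l < r j.+2) u l *: actD j.+1 z l); last first.
    by rewrite big1 // => l _; rewrite zD ?scaler0.
  under eq_bigr do rewrite -anE uE // scaler_suml.
  rewrite exchange_big; apply: eq_bigr => l _ /=; rewrite scaler_sumr.
  by apply: eq_bigr => k _; rewrite scalerA.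
pose w k : Q := if insub k is Some i then h (delta_mx 0 (i : 'I_(r j))) else 0.
have wE (k : 'I_(r j)) : w k = h (delta_mx 0 k) by rewrite /w valK.
exists w; split=> [k kr|k kr].
  rewrite -[k]/(val (Ordinal kr)) wE; apply: hg => i; rewrite mxE eqxx /=.
  case: eqP => [->|_]; last exact: piece0.
  by rewrite subrr /=; apply: dhomog1.
rewrite -[k]/(val (Ordinal kr)) -hE {1}[g _]row_sum_delta linear_sum.
by apply: eq_bigr => i _; rewrite linearZ -wE mxE.
Qed.

Lemma res_lift0 (n : nat) (dg0 : nat -> int) t (z : nat -> E 0%N) : homog_at dg0 n t z ->
  (forall k, (k < n)%N -> ir_diff E 0 (z k) = 0) ->
  exists v : nat -> M, homog_at dg0 n t v /\ forall k, (k < n)%N -> ir_aug E (v k) = z k.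
Proof.
move=> zt zd.
have /choice[v vP] k : exists v : M, (k < n)%N -> gm_piece (t + dg0 k) v /\ ir_aug E v = z k.
  case: (ltnP k n) => kn; last by exists 0.
  have [y yE] := (ir_exact0 (z k)).1 (zd k kn).
  by have [v vt vE] := gm_homog_preim (ir_aug_graded E) yE (zt k kn); exists v.
by exists v; split=> k kn; case: (vP k kn).
Qed.

Lemma res_lift l (n : nat) (dg0 : nat -> int) t (z : nat -> E l.+1) : homog_at dg0 n t z ->
  (forall k, (k < n)%N -> ir_diff E l.+1 (z k) = 0) ->
  exists v : nat -> E l, homog_at dg0 n t v /\ forall k, (k < n)%N -> ir_diff E l (v k) = z k.
Proof.
move=> zt zd.
have /choice[v vP] k : exists v : E l, (k < n)%N -> gm_piece (t + dg0 k) v /\ ir_diff E l v = z k.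
  case: (ltnP k n) => kn; last by exists 0.
  have [y yE] := (ir_exactS (z k)).1 (zd k kn).
  by have [v vt vE] := gm_homog_preim (ir_diff_graded (i := l)) yE (zt k kn); exists v.
by exists v; split=> k kn; case: (vP k kn).
Qed.

(** The staircase in the double complex Hom(G_j, E^l), between a vector x with
    entries in E^l at column j and a vector v with entries in the ring at column
    j + l: each step lifts along the differential of E and then applies that
    of G. *)
Fixpoint zigzag (t : int) l j : (nat -> E l) -> (nat -> M) -> Prop :=
  match l return (nat -> E l) -> (nat -> M) -> Prop with
  | 0 => fun x v => forall k, (k < r j)%N -> x k = ir_aug E (v k)
  | l'.+1 => fun x v => exists y : nat -> E l',
      [/\ homog_at (dg j) (r j) t y, forall k, (k < r j)%N -> ir_diff E l' (y k) = x k &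
          zigzag t j.+1 (actD j y) v]
  end.

Lemma zigzag_ext t l j (x x' : nat -> E l) v v' : zigzag t j x v ->
  (forall k, (k < r j)%N -> x k = x' k) -> (forall k, (k < r (l + j))%N -> v k = v' k) ->
  zigzag t j x' v'.
Proof.
elim: l j x x' => [|l IH] j x x' /=.
  by move=> H xx vv k kr; rewrite -xx // -vv // H.
move=> [y [yt yx H]] xx vv; exists y; split=> // [k kr|]; first by rewrite -xx // yx.
by apply: IH H _ _ => // k; rewrite addnS; apply: vv.
Qed.

Lemma zigzag_lin t l j (x x' : nat -> E l) v v' (a : R) : piece 0 a ->
  zigzag t j x v -> zigzag t j x' v' ->
  zigzag t j (fun k => x k + a *: x' k) (fun k => v k + a *: v' k).
Proof.
move=> a0; elim: l j x x' => [|l IH] j x x' /=.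
  by move=> H H' k kr; rewrite linearD linearZ H // H'.
move=> [y [yt yx H]] [y' [yt' yx' H']]; exists (fun k => y k + a *: y' k); split=> [k kr|k kr|].
- apply: gm_pieceD; first exact: yt.
  by rewrite -[t + _]add0r; apply: gm_pieceZ => //; apply: yt'.
- by rewrite linearD linearZ yx // yx'.
- apply: zigzag_ext (IH _ _ _ H H') _ _ => // k _; by rewrite act_lin.
Qed.

(** Lift x along the differential of E, apply that of G, and repeat; the result is
    again a cocycle killed by the next differential of G. *)
Lemma zigzag_total t l j (x : nat -> E l) : homog_at (dg j) (r j) t x ->
  (forall k, (k < r j)%N -> ir_diff E l (x k) = 0) ->
  (forall k, (k < r j.+1)%N -> actD j x k = 0) ->
  exists v, homog_at (dg (l + j)%N) (r (l + j)%N) t v /\ zigzag t j x v.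
Proof.
elim: l j x => [|l IH] j x xt xd xD.
  by have [v [vt vE]] := res_lift0 xt xd; exists v; split=> //= k kr; rewrite vE.
have [y [yt yE]] := res_lift xt xd.
have [k kr|k kr|v] := IH j.+1 _ (actD_homog yt).
- by rewrite act_map -[RHS](xD k kr); apply: act_ext => i ir; rewrite yE.
- exact: actDD.
by rewrite addnS => -[vt H]; exists v; split=> //; exists y.
Qed.

(** After one step the condition on x holds again, two differentials of G having
    composition zero; at the end the augmentation of E is injective. *)
Lemma zigzag_closed t l j (x : nat -> E l) v : zigzag t j x v ->
  (forall k, (k < r j.+1)%N -> actD j x k = 0) ->
  forall k, (k < r (l + j).+1)%N -> actD (l + j)%N v k = 0.
Proof.
elim: l j x => [|l IH] j x /=.
  move=> H xD k kr; apply: (@ir_aug_inj _ _ _ E); rewrite linear0 act_map -[RHS](xD k kr).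
  by apply: act_ext => i ir; rewrite H.
move=> [y [_ _ H]] _ k kr; rewrite addSnnS in kr *.
by apply: (IH _ _ H) => // k' k'r; apply: actDD.
Qed.

(** The staircase is built from its end, by exactness of Hom(G, E^l) in G. *)
Lemma zigzag_onto t l j v : homog_at (V := M) (dg (l + j)%N) (r (l + j)%N) t v ->
  (forall k, (k < r (l + j).+1)%N -> actD (l + j)%N v k = 0) ->
  exists x : nat -> E l, [/\ homog_at (dg j) (r j) t x,
    forall k, (k < r j)%N -> ir_diff E l (x k) = 0,
    forall k, (k < r j.+1)%N -> actD j x k = 0 & zigzag t j x v].
Proof.
elim: l j v => [|l IH] j v vt vD.
  exists (fun k => ir_aug E (v k)); split=> // [k kr|k kr|k kr].
  - by apply: ir_aug_graded; apply: vt.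
  - by apply/ir_exact0; exists (v k).
  - by rewrite -(act_map (ir_aug E)) vD // linear0.
have [x' [xt xd xD H]] : exists x : nat -> E l, [/\ homog_at (dg j.+1) (r j.+1) t x,
    forall k, (k < r j.+1)%N -> ir_diff E l (x k) = 0,
    forall k, (k < r j.+2)%N -> actD j.+1 x k = 0 & zigzag t j.+1 x v].
  by apply: IH; rewrite addnS -addSn.
have [y [yt yE]] := hom_exact (ir_injective (i := l)) xt xD.
exists (fun k => ir_diff E l (y k)); split=> [k kr|k kr|k kr|].
- by apply: ir_diff_graded; apply: yt.
- by apply/ir_exactS; exists (y k).
- by rewrite -(act_map (ir_diff E l)) -yE ?xd.
- exists y; split=> //; exact: zigzag_ext H _ _.
Qed.

(** By induction the next step of the staircase is the differential of some y' killed
    by the differential of G, hence y' comes from some y2; subtract the differential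
    of y2 from the lift of x. *)
Lemma zigzag_boundary t l j (x : nat -> E l.+1) v : zigzag t j x v ->
  homog_at (dg (l + j).+1) (r (l + j).+1) t v ->
  (exists u, forall k, (k < r (l + j).+1)%N -> v k = actD (l + j)%N u k) ->
  exists y : nat -> E l, [/\ homog_at (dg j) (r j) t y,
    forall k, (k < r j)%N -> ir_diff E l (y k) = x k &
    forall k, (k < r j.+1)%N -> actD j y k = 0].
Proof.
elim: l j x => [|l IH] j x.
  move=> [y [yt yx H]] vt [u uE].
  pose u' k : M := mcomp (t + dg j k) (u k).
  have u'E k : (k < r j.+1)%N -> v k = actD j u' k.
    move=> kr; have /= vk := vt k kr; rewrite -(mcomp_id vk) uE // raddf_sum.
    apply: eq_bigr => i _ /=; have Dh := res_hom res kr (ltn_ord i).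
    transitivity (mcomp (dg j.+1 k - dg j i + (t + dg j i)) (D j k i * u i)).
      by congr mcomp; change (t + dg j.+1 k = dg j.+1 k - dg j i + (t + dg j i)); ring.
    exact: mcompMl.
  exists (fun k => y k - ir_aug E (u' k)); split=> [k kr|k kr|k kr].
  - apply: gm_pieceB; first exact: yt.
    by apply: ir_aug_graded; apply: mcomp_piece.
  - rewrite linearB yx //= [X in _ - X](_ : _ = 0) ?subr0 //.
    by apply/ir_exact0; exists (u' k).
  - transitivity (actD j (fun k => y k + (-1) *: ir_aug E (u' k)) k).
      by apply: act_ext => i _; rewrite scaleN1r.
    rewrite act_lin -(act_map (ir_aug E)) -u'E // scaleN1r; have /= -> := H k kr.
    by rewrite subrr.
move=> [y [yt yx H]] vt [u uE].
have [||y' [yt' yE' yD']] := IH _ _ H.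
- by rewrite addnS -addSn.
- by exists u; rewrite addnS -addSn.
have [y2 [yt2 yE2]] := hom_exact (ir_injective (i := l)) yt' yD'.
exists (fun k => y k - ir_diff E l (y2 k)); split=> [k kr|k kr|k kr].
- apply: gm_pieceB; first exact: yt.
  by apply: ir_diff_graded; apply: yt2.
- rewrite linearB yx //= [X in _ - X](_ : _ = 0) ?subr0 //.
  by apply/ir_exactS; exists (y2 k).
- transitivity (actD j (fun k => y k + (-1) *: ir_diff E l (y2 k)) k).
    by apply: act_ext => i _; rewrite scaleN1r.
  by rewrite act_lin -(act_map (ir_diff E l)) -yE2 // scaleN1r yE' // subrr.
Qed.

(** Two lifts of x differ by the differential of some u, and then act D u shows that
    the next step of the staircase is again the differential of a vector killed by
    G. *)
Lemma zigzag_coboundary t l j (x : nat -> E l.+1) v (y0 : nat -> E l) : zigzag t j x v ->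
  (forall k, (k < r j)%N -> ir_diff E l (y0 k) = x k) ->
  (forall k, (k < r j.+1)%N -> actD j y0 k = 0) ->
  exists u : nat -> M, forall k, (k < r (l + j).+1)%N -> v k = actD (l + j)%N u k.
Proof.
elim: l j x y0 => [|l IH] j x y0 [y [_ yx H]] y0x y0D.
  have /choice[u uP] k : exists u : M, (k < r j)%N -> ir_aug E u = y k - y0 k.
    case: (ltnP k (r j)) => kr; last by exists 0.
    have [|u uE] := (@ir_exact0 _ _ _ E (y k - y0 k)).1; last by exists u.
    by rewrite linearB /= yx // y0x // subrr.
  exists u => k kr; apply: (@ir_aug_inj _ _ _ E); rewrite act_map.
  have /= <- := H k kr; rewrite -[LHS]subr0 -[X in _ - X](y0D k kr).
  transitivity (actD j (fun k => y k + (-1) *: y0 k) k).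
    by rewrite act_lin scaleN1r.
  by apply: act_ext => i ir; rewrite scaleN1r uP.
have /choice[u uP] k : exists u : E l, (k < r j)%N -> ir_diff E l u = y k - y0 k.
  case: (ltnP k (r j)) => kr; last by exists 0.
  have [|u uE] := (@ir_exactS _ _ _ E l (y k - y0 k)).1; last by exists u.
  by rewrite linearB /= yx // y0x // subrr.
have [k kr|k kr|w wE] := IH _ _ (actD j u) H.
- rewrite act_map; transitivity (actD j (fun k => y k + (-1) *: y0 k) k).
    by apply: act_ext => i ir; rewrite scaleN1r uP.
  by rewrite act_lin y0D // scaler0 addr0.
- exact: actDD.
by exists w; rewrite addSnnS.
Qed.

End OneResolution.

(** A chain map commutes with the differentials of E and of the resolutions. *)
Lemma zigzag_chain_map t r D dg r' D' dg' th l j (x : nat -> E l) v :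
  chain_map r' D' dg' r D dg th -> zigzag r D dg t j x v ->
  zigzag r' D' dg' t j (act (th j) (r j) x) (act (th (l + j)%N) (r (l + j)%N) v).
Proof.
move=> cm; elim: l j x => [|l IH] j x.
  by move=> H k kr; rewrite act_map; apply: act_ext => i ir; apply: H.
move=> [y [yt yx H]]; exists (act (th j) (r j) y); split=> [|k kr|].
- by apply: act_homog yt => k k' kr kr'; apply: (cm_hom cm).
- by rewrite act_map; apply: act_ext => i ir; apply: yx.
apply: zigzag_ext (IH _ _ H) _ _ => // k kr; last by rewrite addnS.
rewrite !act_act; apply: eq_bigr => i _; congr (_ *: _).
exact: (cm_comm cm).
Qed.

End Zigzag.
(** * The Frobenius action on local cohomology *)

Lemma frob_mxM (A : idomainType) (m : nat) (q q' : nat) (D : nat -> nat -> nat -> {mpoly A[m]}) :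
  frob_mx q (frob_mx q' D) = frob_mx (q' * q) D.
Proof. by apply: funext => j; apply: funext => k; apply: funext => l; rewrite /frob_mx exprM. Qed.

Section LocalCohomologyFrobenius.
Variables (A : idomainType) (p m : nat).
Local Notation R := {mpoly A[m]}.
Local Notation piece := (@mpoly_piece A m).
Local Notation M := (mpoly_module A m).
Hypothesis A_regular : is_regular_ring A.
Hypothesis p_prime : prime p.
Hypothesis p0 : p%:R = 0 :> A.

Variables (I : set R) (r : nat -> nat) (D : nat -> nat -> nat -> R) (dg : nat -> nat -> int).
Hypothesis I_ideal : is_ideal I.
Hypothesis res : resolves I r D dg.

Lemma q_gt0 e : (0 < p ^ e)%N. Proof. by rewrite expn_gt0 prime_gt0. Qed.

Lemma qDA e (a b : A) : (a + b) ^+ (p ^ e)%N = a ^+ (p ^ e)%N + b ^+ (p ^ e)%N.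
Proof. exact: frobD. Qed.

Lemma qDR e (a b : R) : (a + b) ^+ (p ^ e)%N = a ^+ (p ^ e)%N + b ^+ (p ^ e)%N.
Proof. by apply: frobD => //; rewrite -mpolyC_nat p0 mpolyC0. Qed.

Lemma A_flat e (J : finType) (c : J -> A) : frob_flat (p ^ e) c.
Proof. exact: kunz. Qed.

(** By flatness of Frobenius, the differentials of a resolution of R / I^[p^e]. *)
Definition Dq e := frob_mx (p ^ e) D.
Definition dgq e j k := dg j k * (p ^ e)%N%:Z.

Lemma resq e : resolves (frob_ideal (p ^ e) I) r (Dq e) (dgq e).
Proof. exact: resolves_frob (q_gt0 e) (@qDA e) (@qDR e) (@A_flat e) _ _ _ _ res. Qed.

Lemma frob_chain_map e f th : chain_map r (Dq f) (dgq f) r D dg th ->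
  chain_map r (Dq (f + e)) (dgq (f + e)) r (Dq e) (dgq e) (frob_mx (p ^ e) th).
Proof.
move=> cm; have := chain_map_frob (q_gt0 e) (@qDR e) cm.
rewrite /Dq frob_mxM -expnD; congr chain_map.
by apply: funext => j; apply: funext => k; rewrite /dgq expnD PoszM mulrA.
Qed.

Lemma frob_chain_map_exists f : exists th, chain_map r (Dq f) (dgq f) r D dg th.
Proof.
apply: (chain_map_exists _ (resq f) res).
apply: ideal_span_le => // _ [x Ix <-]; rewrite -(prednK (q_gt0 f)) exprSr.
by case: I_ideal => _ _; apply.
Qed.

Section Torsion.
Variable V : gradedModule piece.

Lemma ideal_power_gens n : ideal_power I n = kpow (fun k : 'I_(r 1%N) => D 0%N k 0%N) n.
Proof.
rewrite -ideal_power_kpow; congr ideal_power.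
apply/seteqP; split=> x.
  by move=> /(res_aug res)[u ->]; apply/range_span; exists (fun k : 'I_(r 1%N) => u k).
move=> /range_span[a ->]; apply: ideal_sum => // k _; case: (I_ideal) => _ _; apply.
apply/(res_aug res); exists (fun l : nat => (l == k)%:R).
rewrite (bigD1 k) //= eqxx mul1r big1 ?addr0 // => l lk.
have -> : (l == k :> nat) = false by rewrite (inj_eq val_inj) (negPf lk).
by rewrite mul0r.
Qed.

Lemma ideal_power_exp (S : comNzRingType) (J : set S) n a : J a -> ideal_power J n (a ^+ n).
Proof.
move=> Ja; apply: ideal_span_gen; exists (fun=> a) => //.
by rewrite prodr_const card_ord.
Qed.

(** I^[q] is contained in I^q, and q = p^e exceeds e. *)
Lemma torsion_frob (x : V) : torsion I x -> exists e0, forall e, (e0 <= e)%N ->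
  forall k, (k < r 1%N)%N -> Dq e 0%N k 0%N *: x = 0.
Proof.
move=> [n nx]; exists n => e ne k kr; rewrite /Dq /frob_mx.
have nq : (n <= p ^ e)%N.
  by apply: leq_trans ne _; apply/ltnW/ltn_expl/prime_gt1.
rewrite -(subnK nq) exprD -scalerA nx ?scaler0 //; apply: ideal_power_exp.
apply/(res_aug res); exists (fun l : nat => (l == k)%:R).
rewrite (bigD1 (Ordinal kr)) //= eqxx mul1r big1 ?addr0 // => l lk.
have -> : (l == k :> nat) = false by rewrite -[k]/(val (Ordinal kr)) (inj_eq val_inj) (negPf lk).
by rewrite mul0r.
Qed.

(** A monomial of degree above r q in r generators of I is divisible by the q-th
    power of one of them, so that I^[q] contains a power of I. *)
Lemma frob_torsion e (x : V) :
  (forall k, (k < r 1%N)%N -> Dq e 0%N k 0%N *: x = 0) -> torsion I x.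
Proof.
move=> xk; exists (r 1%N * p ^ e).+1 => a; rewrite ideal_power_gens => -[f fn <-].
rewrite [f]mpolyE raddf_sum big_seq /= scaler_suml big1 // => b bf.
have degb := dhomog_mf fn bf; have [k qk] : exists k : 'I_(r 1%N), (p ^ e <= b k)%N.
  apply: contrapT => nk; have : (mdeg b <= r 1%N * p ^ e)%N.
    rewrite mdegE -[X in (X * _)%N]card_ord -sum_nat_const leq_sum // => k _.
    by rewrite leqNgt; apply: contra_notN nk => /ltnW H; exists k.
  by rewrite degb ltnn.
have le : (U_(k) *+ p ^ e <= b)%MM.
  apply/mnm_lepP => l; rewrite mulmnE mnm1E; case: eqP => [<-|_]; last by rewrite mul0n.
  by rewrite mul1n.
rewrite /= mevalZ -(submK le) mpolyXD mevalM monU mulrA -scalerA.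
by rewrite [X in _ *: X]xk ?scaler0.
Qed.

Lemma torsion_lin (x y : V) a : torsion I x -> torsion I y -> torsion I (x + a *: y).
Proof.
move=> [n nx] [n' ny]; exists (maxn n n') => b Ib.
have sub k : (k <= maxn n n')%N -> ideal_power I k b.
  by move: Ib; rewrite !ideal_power_gens => + H; apply: kpow_le.
rewrite scalerDr (nx b (sub _ (leq_maxl _ _))) scalerA mulrC -scalerA.
by rewrite (ny b (sub _ (leq_maxr _ _))) scaler0 addr0.
Qed.

End Torsion.

Variables (E : injectiveResolution M) (i' : nat).
Local Notation top := i'.+1.
Local Notation bd := (@lc_boundary _ _ I M E top).
Local Notation coc := (@lc_cocycle_deg _ _ I M E top).

Lemma bd_lin x y a : bd x -> bd y -> bd (x + a *: y).
Proof.
move=> [x' tx <-] [y' ty <-]; exists (x' + a *: y'); first exact: torsion_lin.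
by rewrite linearD linearZ.
Qed.

Lemma act_col0 (V : lmodType R) (D0 : nat -> nat -> R) (x : nat -> V) k :
  act D0 (r 0%N) x k = D0 k 0%N *: x 0%N.
Proof. by rewrite /act (res_r0 res) big_ord_recl big_ord0 addr0. Qed.

Lemma lt_r0 k : (k < r 0)%N -> k = 0%N.
Proof. by rewrite (res_r0 res) ltnS leqn0 => /eqP. Qed.

Lemma dgq0 e : dgq e 0%N 0%N = 0.
Proof. by rewrite /dgq (res_dg0 res) mul0r. Qed.

(** v represents the class of the cocycle x in H^i(Hom(G, R)), for G the resolution
    of R / I^[p^e]; local cohomology is the limit of these groups over e. *)
Definition represents e t (x : E top) (v : nat -> M) :=
  zigzag r (Dq e) (dgq e) t 0 (fun _ : nat => x) v.

Definition homog_vec e t (v : nat -> M) := homog_at (dgq e top) (r top) t v.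
Definition closed_vec e (v : nat -> M) :=
  forall k, (k < r top.+1)%N -> act (Dq e top) (r top) v k = 0.
Definition bound_vec e (v : nat -> M) :=
  exists u, forall k, (k < r top)%N -> v k = act (Dq e i') (r i') u k.

Lemma represents_total t x : coc t x -> exists e0, forall e, (e0 <= e)%N ->
  exists v, [/\ homog_vec e t v, closed_vec e v & represents e t x v].
Proof.
move=> [[tx dx] xt]; have [e0 H] := torsion_frob tx; exists e0 => e ee.
have xD k : (k < r 1%N)%N -> act (Dq e 0%N) (r 0%N) (fun _ : nat => x) k = 0.
  by move=> kr; rewrite act_col0 H.
have xh : homog_at (dgq e 0%N) (r 0%N) t (fun _ : nat => x).
  by move=> k /lt_r0 ->; rewrite dgq0 addr0.
have [v [vt xv]] := zigzag_total (resq e) xh (fun _ _ => dx) xD.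
have vD := zigzag_closed (resq e) xv xD.
by rewrite addn0 in vt vD; exists v.
Qed.

Lemma represents_onto e t v : homog_vec e t v -> closed_vec e v ->
  exists2 x, coc t x & represents e t x v.
Proof.
move=> vt vD.
have [||x [xt xd xD xv]] := zigzag_onto E (resq e) (l := top) (j := 0) (t := t) (v := v).
- by rewrite addn0.
- by rewrite addn0.
have r00 : (0 < r 0)%N by rewrite (res_r0 res).
exists (x 0%N); last by apply: zigzag_ext xv _ _ => // k /lt_r0 ->.
split; last by have := xt 0%N r00; rewrite dgq0 addr0.
split; last exact: xd.
by apply: (@frob_torsion _ e) => k kr; rewrite -(act_col0 (Dq e 0%N)) xD.
Qed.

Lemma represents_bd e t x v : represents e t x v -> homog_vec e t v ->
  bound_vec e v -> bd x.
Proof.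
move=> xv vt vb; have [||y [_ yx yD]] := zigzag_boundary (resq e) xv.
- by rewrite addn0.
- by rewrite addn0.
have r00 : (0 < r 0)%N by rewrite (res_r0 res).
exists (y 0%N); last exact: yx.
by apply: (@frob_torsion _ e) => k kr; rewrite -(act_col0 (Dq e 0%N)) yD.
Qed.

Lemma represents_chain_map e f t x v th :
  chain_map r (Dq f) (dgq f) r (Dq e) (dgq e) th ->
  represents e t x v -> represents f t x (act (th top) (r top) v).
Proof.
move=> cm xv; have := zigzag_chain_map cm xv; rewrite addn0 => H.
apply: zigzag_ext H _ _ => // k /lt_r0 ->.
by rewrite act_col0 (cm_0 cm) scale1r.
Qed.

(** If x is the differential of y, take f such that I^[p^(f+e)] kills y. *)
Lemma represents_coboundary e t x v : represents e t x v -> bd x ->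
  exists f th, chain_map r (Dq f) (dgq f) r D dg th /\
    bound_vec (f + e) (act (frob_mx (p ^ e) th top) (r top) v).
Proof.
move=> xv [y ty yx]; have [f H] := torsion_frob ty.
have [th cm] := frob_chain_map_exists f; exists f, th; split=> //.
have := zigzag_coboundary (resq (f + e))
  (represents_chain_map (frob_chain_map e cm) xv) (y0 := fun=> y).
rewrite addn0; apply=> [k _|k kr]; first exact: yx.
by rewrite act_col0 H // leq_addr.
Qed.

Lemma represents_lin e t x x' v v' a : piece 0 a ->
  represents e t x v -> represents e t x' v' ->
  represents e t (x + a *: x') (fun k => v k + a *: v' k).
Proof. move=> a0; exact: zigzag_lin. Qed.

Lemma pieceC (a : A) : piece 0 (a%:MP : R).
Proof. by rewrite /= -[a%:MP]mulr1 mul_mpolyC; apply/rpredZ/dhomog1. Qed.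

(** Subtracting the combination of the vs from v leaves 0, which represents x minus a
    combination of boundaries. *)
Lemma bd_combination e t (W : eqType) (S : seq W) (b : W -> A) (vs : W -> nat -> M) x v :
  represents e t x v -> homog_vec e t v ->
  (forall k, (k < r top)%N -> v k = \sum_(s <- S) (b s)%:MP *: vs s k) ->
  (forall s, s \in S -> exists2 y, represents e t y (vs s) & bd y) -> bd x.
Proof.
move=> xv vt vE vsP.
have /choice[y yP] s : exists y, s \in S -> represents e t y (vs s) /\ bd y.
  case: (boolP (s \in S)) => sS; last by exists 0.
  by have [y ? ?] := vsP s sS; exists y.
have bd0 : bd 0.
  exists 0; last by rewrite linear0.
  by exists 0%N => a _; rewrite scaler0.
have [rep bdy] : represents e t (x + \sum_(s <- S) (- b s)%:MP *: y s)
    (fun k => v k + \sum_(s <- S) (- b s)%:MP *: vs s k) /\ bd (\sum_(s <- S) (- b s)%:MP *: y s).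
  elim: S {vE vsP} yP => [|s S IH] yP.
    rewrite big_nil addr0; split=> //; apply: zigzag_ext xv _ _ => // k _.
    by rewrite big_nil addr0.
  have [|rep bdy] := IH; first by move=> s' s'S; apply: yP; rewrite in_cons s'S orbT.
  have [ys bs] := yP s (mem_head _ _); split; last first.
    by rewrite big_cons addrC; apply: bd_lin.
  have := represents_lin (pieceC (- b s)) rep ys.
  rewrite big_cons -addrA [X in x + X]addrC => H.
  apply: zigzag_ext H _ _ => // k _.
  by rewrite big_cons -addrA [X in v k + X]addrC.
have vz k : (k < r top)%N -> v k + \sum_(s <- S) (- b s)%:MP *: vs s k = 0.
  move=> kr; rewrite vE // -big_split big1 // => s _ /=.
  by rewrite -scalerDl -mpolyCD subrr mpolyC0 scale0r.
have H := represents_bd rep.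
have bx : bd (x + \sum_(s <- S) (- b s)%:MP *: y s).
  apply: H => [k kr|]; first by rewrite vz //; apply: gm_piece0.
  by exists (fun=> 0) => k kr; rewrite vz // act0.
have := bd_lin (-1) bx bdy.
by rewrite scaleN1r addrK.
Qed.

Lemma represents_scale e t x v a : represents e t x v ->
  represents e t (a%:MP *: x) (fun k => a%:MP *: v k).
Proof.
move=> xv; have := represents_lin (pieceC (a - 1)) xv xv.
have aE (V : lmodType R) (y : V) : y + (a - 1)%:MP *: y = a%:MP *: y.
  by rewrite mpolyCB mpolyC1 scalerBl scale1r addrC subrK.
by rewrite aE => H; apply: zigzag_ext H _ _ => // k _; rewrite aE.
Qed.

Lemma Dq0 : Dq 0 = D.
Proof. by apply: funext => j; apply: funext => k; apply: funext => l; rewrite /Dq /frob_mx expn0 expr1. Qed.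

Lemma dgq_0 : dgq 0 = dg.
Proof. by apply: funext => j; apply: funext => k; rewrite /dgq expn0 mulr1. Qed.

(** X^a times the image of w under the e-th iterate of Frobenius, from H^i(Hom(G, R))
    for R/I to the same for R / I^[p^e]. *)
Definition twist e (a : 'X_{1..m}) (w : nat -> M) : nat -> M :=
  fun k => ('X_[a] * (w k : R) ^+ (p ^ e)%N : R).

Lemma act_twist D0 n e a w k :
  act (fun i j => D0 i j ^+ (p ^ e)%N) n (twist e a w) k =
  ('X_[a] * (act D0 n w k : R) ^+ (p ^ e)%N : R) :> M.
Proof.
rewrite [act D0 n w k in RHS]/act.
rewrite (frob_sum (q_gt0 e) (@qDR e)) mulr_sumr; apply: eq_bigr => l _.
rewrite /twist; change (D0 k l ^+ (p ^ e) * ('X_[a] * (w l : R) ^+ (p ^ e)) =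
  'X_[a] * (D0 k l * (w l : R)) ^+ (p ^ e) :> R).
by rewrite exprMn; ring.
Qed.

Lemma twist_homog e a t w : homog_vec 0 t w ->
  homog_vec e (t * (p ^ e)%N%:Z + (mdeg a)%:Z) (twist e a w).
Proof.
rewrite /homog_vec dgq_0 => wt k kr.
have -> : t * (p ^ e)%N%:Z + (mdeg a)%:Z + dgq e top k =
    (mdeg a)%:Z + (t + dg top k) * (p ^ e)%N%:Z by rewrite /dgq; ring.
apply: pieceM; first by rewrite /= dhomogX.
exact: piece_exp (wt k kr).
Qed.

Lemma twist_closed e a w : closed_vec 0 w -> closed_vec e (twist e a w).
Proof.
rewrite /closed_vec Dq0 => wD k kr.
by rewrite [LHS]act_twist wD // expr0n eqn0Ngt q_gt0 mulr0.
Qed.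

(** A class of degree t in H^i(Hom(G, R)), for R/I, that survives in the limit. *)
Definition seed t w x :=
  [/\ homog_vec 0 t w, closed_vec 0 w, coc t x, represents 0 t x w & ~ bd x].

(** If w becomes a boundary for R / I^[p^f], then its twist becomes one for
    R / I^[p^(f+e)]. *)
Lemma twist_bd e a t w x y : homog_vec 0 t w -> represents 0 t x w -> bd x ->
  represents e (t * (p ^ e)%N%:Z + (mdeg a)%:Z) y (twist e a w) -> bd y.
Proof.
move=> wt xw bx yw; have [f [th [cm [u uE]]]] := represents_coboundary xw bx.
rewrite addn0 in uE; have cme := frob_chain_map e cm.
have th1 : frob_mx (p ^ 0) th = th.
  by apply: funext => j; apply: funext => k; apply: funext => l; rewrite /frob_mx expn0 expr1.
rewrite th1 in uE.
apply: (represents_bd (represents_chain_map cme yw)).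
  apply: (act_homog (dg := dgq e top) (n' := r top)); last exact: twist_homog.
  by move=> k k' kr k'r; apply: (cm_hom cme).
exists (twist e a u) => k kr; rewrite [LHS]act_twist uE // -act_twist.
apply: eq_bigr => l _; congr (_ *: _).
by rewrite /Dq /frob_mx expnD exprM.
Qed.

Lemma mcomp_other n n' (f : R) : piece n f -> n != n' -> mcomp n' f = 0.
Proof.
move=> /pieceE H nn'; apply/mpolyP => t; rewrite mcoeff_mcomp mcoeff0.
have [->|/H e] := eqVneq f@_t 0; first by rewrite mulr0.
by rewrite -e eq_sym (negPf nn') mul0r.
Qed.

(** By flatness a closed vector for R / I^[p^e] is a combination of twists of closed
    vectors for R/I, homogeneous of the degrees that fit; one term of the combination
    survives, and then so does the vector that it is a twist of. *)
Lemma seed_exists x c : coc c x -> ~ bd x -> exists e0, forall e, (e0 <= e)%N ->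
  exists (t : int) (a : 'X_{1..m}) w y,
    [/\ small_exp (p ^ e) a, t * (p ^ e)%N%:Z + (mdeg a)%:Z = c & seed t w y].
Proof.
move=> xc nbx; have [e0 H] := represents_total xc; exists e0 => e /H[v [vc vD xv]].
have [k|T [b [a [Z [aS ZS vE]]]]] := frob_flat_mpoly (q_gt0 e) (@qDA e) (@qDR e) (@A_flat e)
    (M := fun (k' : 'I_(r top)) (k : 'I_(r top.+1)) => D top k k') (y := fun k' => v k').
  rewrite -[RHS](vD k (ltn_ord k)); apply: eq_bigr => k' _.
  by rewrite mulrC.
pose Zn j k := if insub k is Some i then Z j i else 0.
have ZnE j (k : 'I_(r top)) : Zn j k = Z j k by rewrite /Zn valK.
pose N := (\max_(u : T * 'I_(r top)) (msize (Zn u.1 u.2) + absz (dg top u.2)))%N.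
pose w (s : T * int) (k : nat) : M := mcomp (s.2 + dg top k) (Zn s.1 k).
have wh s : homog_vec 0 s.2 (w s).
  by rewrite /homog_vec dgq_0 => k _; apply: mcomp_piece.
have wD s : closed_vec 0 (w s).
  rewrite /closed_vec Dq0 => k kr.
  have := congr1 (mcomp (s.2 + dg top.+1 k)) (ZS s.1 (Ordinal kr)).
  rewrite raddf_sum raddf0 => e1; rewrite -[RHS]e1; apply: eq_bigr => i _ /=.
  have Dh := res_hom res kr (ltn_ord i).
  rewrite -ZnE /w /= mulrC.
  transitivity (mcomp ((dg top.+1 k - dg top i) + (s.2 + dg top i)) (D top k i * Zn s.1 i)).
    by rewrite (mcompMl _ _ Dh).
  by congr mcomp; ring.
pose ok (s : T * int) := s.2 * (p ^ e)%N%:Z + (mdeg (a s.1))%:Z == c.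
pose S := [seq s <- [seq (j, t) | j <- enum T, t <- int_range N] | ok s].
have vS k : (k < r top)%N -> v k = \sum_(s <- S) (b s.1)%:MP *: twist e (a s.1) (w s) k.
  move=> kr; have := vc k kr; move=> /= vk.
  rewrite -(mcomp_id vk) -[k in v k]/(val (Ordinal kr)) vE raddf_sum /=.
  rewrite big_filter [RHS]big_mkcond big_allpairs /= big_enum; apply: eq_bigr => j _.
  have -> : Z j (Ordinal kr) = \sum_(t <- int_range N) w (j, t) k.
    rewrite -ZnE /=; apply: mcomp_total.
    by rewrite /N (bigD1 (j, Ordinal kr)) //= leq_maxl.
  rewrite (frob_sum (q_gt0 e) (@qDR e)) mulr_sumr scaler_sumr raddf_sum /=.
  apply: eq_bigr => t _.
  have th := twist_homog e (a j) (wh (j, t)) kr.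
  rewrite linearZ /= -[mcomp _ _]/(mcomp (c + dgq e top k) (twist e (a j) (w (j, t)) k)).
  rewrite /ok /=; case: eqP => [tc|/eqP tc].
    rewrite mcomp_id; last by rewrite -tc; apply: th.
    by rewrite -mul_mpolyC.
  rewrite (mcomp_other th) ?scaler0 //.
  by apply: contra_neq tc => /addIr.
have [s [okS ns]] : exists s, ok s /\ forall y, represents e c y (twist e (a s.1) (w s)) -> ~ bd y.
  apply: contrapT => ns; apply: nbx; apply: (bd_combination xv vc vS) => s.
  rewrite mem_filter => /andP[oks _]; apply: contrapT => nb; apply: ns.
  by exists s; split=> // y yw by'; apply: nb; exists y.
move/eqP: okS => tc.
have [||y yc yw] := @represents_onto e c (twist e (a s.1) (w s)).
- by rewrite -tc; apply: twist_homog.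
- exact: twist_closed.
have [x' x'c x'w] := represents_onto (wh s) (wD s).
exists s.2, (a s.1), (w s), x'; split=> //; split=> // bx'.
apply: (ns y yw); apply: (twist_bd (e := e) (a := a s.1) (wh s) x'w bx').
by rewrite tc.
Qed.

(** If s kills X^a F^e(w) then, by flatness, s X^a is a combination of elements X^b g^q
    with b small and g killing w. Its coefficient at X^a only involves the terms with
    b = a, through the constant terms of the g; these kill w too, since all is
    homogeneous. *)
Lemma seed_annihilator e t (a : 'X_{1..m}) w x c s : seed t w x -> small_exp (p ^ e) a ->
  t * (p ^ e)%N%:Z + (mdeg a)%:Z = c ->
  (forall y, coc c y -> bd (s%:MP *: y)) ->
  ideal_span [set g ^+ (p ^ e)%N | g in [set g : A | bd (g%:MP *: x)]] s.
Proof.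
move=> [wt wD xt xw nx] aS tc kill.
have tw := twist_homog e a wt; have tD := twist_closed e a wD.
have [y yc yw] := represents_onto tw tD; rewrite tc in yc.
have [f [th [cm [u uE]]]] := represents_coboundary (represents_scale s yw) (kill y yc).
pose thw : nat -> M := act (th top) (r top) w.
have thE k : (k < r top)%N -> s%:MP * ('X_[a] * (thw k : R) ^+ (p ^ e)%N) =
    \sum_(k' < r i') u k' * Dq f i' k k' ^+ (p ^ e)%N.
  move=> kr; have := uE k kr.
  have -> : act (frob_mx (p ^ e) th top) (r top) (fun k => s%:MP *: twist e a w k) k =
      s%:MP *: act (frob_mx (p ^ e) th top) (r top) (twist e a w) k.
    rewrite /act scaler_sumr; apply: eq_bigr => i _.
    exact: (mulrCA (frob_mx (p ^ e) th top k i) s%:MP (twist e a w i : R)).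
  rewrite [X in s%:MP *: X]act_twist => e1.
  transitivity (act (Dq (f + e) i') (r i') u k : R); first exact: e1.
  apply: eq_bigr => l _; rewrite mulrC.
  by rewrite /Dq /frob_mx expnD exprM.
have [k|T [b [a' [Z [aS' ZS yE]]]]] := frob_flat_mpoly (q_gt0 e) (@qDA e) (@qDR e) (@A_flat e)
    (M := fun (o : option 'I_(r i')) (k : 'I_(r top)) =>
      if o is Some k' then Dq f i' k k' else (thw k : R))
    (y := fun o => if o is Some k' then - (u k' : R) else s%:MP * 'X_[a]).
  rewrite big_option /= -mulrA thE //; under [X in _ + X]eq_bigr do rewrite mulNr.
  by rewrite sumrN subrr.
have cm0 : chain_map r (Dq f) (dgq f) r (Dq 0) (dgq 0) th by rewrite Dq0 dgq_0.
have xth := represents_chain_map cm0 xw.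
have g0 j : bd (((Z j None)@_(0%MM))%:MP *: x).
  have cth : homog_at (dgq f top) (r top) t thw.
    apply: (act_homog (dg := dg top) (n' := r top)).
      by move=> k k' kr k'r; apply: (cm_hom cm).
    by rewrite /homog_vec dgq_0 in wt.
  apply: (represents_bd (represents_scale _ xth)).
    by move=> k kr; rewrite -[t + _]add0r; apply: gm_pieceZ (pieceC _) (cth k kr).
  pose zn k := if insub k is Some i then - mcomp (t + dgq f i' k) (Z j (Some (i : 'I_(r i')))) else 0.
  exists zn => k kr.
  have := congr1 (mcomp (t + dgq f top k)) (ZS j (Ordinal kr)).
  rewrite big_option /= raddfD raddf_sum raddf0 /= => /eqP; rewrite addr_eq0 => /eqP e1.
  transitivity (mcomp (t + dgq f top k) (Z j None * (thw k : R)) : M).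
    rewrite -[X in mcomp X]add0r [0 + _]add0r.
    have := mcompMr 0 (Z j None) (cth k kr); rewrite add0r => -> /=.
    congr (_ * _); rewrite pihomogE.
    apply/mpolyP => d; rewrite mcoeffC raddf_sum /=.
    have := mcoeff_mcomp 0 (Z j None) d; rewrite /= pihomogE raddf_sum /= => ->.
    rewrite eqz_nat [(0%N == _)]eq_sym mdeg_eq0; case: eqP => [->|_]; first by rewrite mulr1 mul1r.
    by rewrite mulr0 mul0r.
  rewrite e1 -sumrN; apply: eq_bigr => l _; rewrite /zn valK.
  have Dh := res_hom (resq f) kr (ltn_ord l).
  rewrite scalerN; congr (- _).
  transitivity (mcomp ((dgq f top k - dgq f i' l) + (t + dgq f i' l)) (Dq f i' k l * Z j (Some l))).
    by rewrite mulrC; congr mcomp; ring.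
  by rewrite (mcompMl _ _ Dh).
have := congr1 (mcoeff (a + 0 *+ (p ^ e)%N)%MM) (yE None).
rewrite raddf_sum /=.
have -> : (a + 0 *+ (p ^ e)%N)%MM = a by apply/mnmP => i; rewrite mnmDE mulmnE mnm0E mul0n addn0.
rewrite mul_mpolyC mcoeffZ mcoeffX eqxx mulr1 => ->.
apply: ideal_sum; first exact: ideal_span_ideal.
move=> j _; rewrite mcoeffZ.
have := mcoeff_frob (q_gt0 e) (@qDR e) (Z j None) 0%MM aS (aS' j).
have -> : (a + 0 *+ (p ^ e)%N)%MM = a by apply/mnmP => i; rewrite mnmDE mulmnE mnm0E mul0n addn0.
move=> ->; rewrite mulrA; case: (ideal_span_ideal [set g ^+ (p ^ e)%N | g in [set g : A | bd (g%:MP *: x)]]) => _ _; apply.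
by apply: ideal_span_gen; exists (Z j None)@_(0%MM) => //; apply: g0.
Qed.

End LocalCohomologyFrobenius.
(** * Components of local cohomology *)

Lemma krull_domain (A : idomainType) (J : set A) s : is_noetherian A -> is_ideal J ->
  ~ J 1 -> s != 0 -> exists n, ~ ideal_power J n s.
Proof.
move=> nA Ji J1 s0; apply: contrapT => H; have [d [g gJ]] := nA J Ji.
have [||k Jk] := krull_intersection (x := g) nA (N := [set 0]) (v := s).
- split=> [//|_ _ -> ->|a _ ->] /=; by rewrite ?addr0 ?mulr0.
- move=> n; exists 0, s; rewrite add0r; split=> //.
  by rewrite -ideal_power_kpow -gJ; apply: contrapT => nn; apply: H; exists n.
move/eqP; rewrite mulf_eq0 (negPf s0) orbF subr_eq0 => /eqP k1.
by apply: J1; rewrite k1 gJ -kpow1.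
Qed.

Lemma ideal_power_mono (B : comNzRingType) (J : set B) n n' : is_noetherian B -> is_ideal J ->
  (n <= n')%N -> ideal_power J n' `<=` ideal_power J n.
Proof.
move=> nB Ji nn'; have [d [g gJ]] := nB J Ji.
by rewrite gJ !ideal_power_kpow; apply: kpow_le.
Qed.

Theorem theorem1p8 (A : idomainType) (p : nat) (k : fieldType)
    (iota : {rmorphism k -> A}) (m : nat) (I : set {mpoly A[m]})
    (E : injectiveResolution (mpoly_module A m)) (i : nat) (c : int) :
  is_regular_ring A ->
  p \in [pchar k] ->
  (1 <= m)%N ->
  is_homogeneous_ideal (@mpoly_piece A m) I ->
  (exists2 a : A, a != 0 & I a%:MP) ->
  lc_neq0 I E i c ->
  ~ lc_fin_gen I E i (@mpolyC m A) c.
Proof.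
move=> Areg /andP[pp /eqP pk] _ Ih [a a0 Ia] [x xc nbx] [d [z [zc zgen]]].
have p0 : p%:R = 0 :> A by rewrite -(rmorph_nat iota) pk rmorph0.
have nA := Areg.1; have nR := noeth_mpoly (n := m) nA.
have Ii : is_ideal I by case: Ih.
have [r [D [dg res]]] := resolution_exists nR Ih.
case: i x xc nbx d z zc zgen => [|i] x xc nbx d z zc zgen.
  (* H^0 vanishes, R being a domain *)
  apply: nbx; have [[[n nx] dx] _] := xc.
  have [y yx] := (ir_exact0 x).1 dx; rewrite -yx /=.
  have /eqP : (a ^+ n)%:MP * (y : {mpoly A[m]}) = 0.
    apply: (@ir_aug_inj _ _ _ E); rewrite linear0 -[(_ * _ : {mpoly A[m]})]/((a ^+ n)%:MP *: y) linearZ yx.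
    by apply: nx; rewrite rmorphXn; apply: ideal_power_exp.
  rewrite mulf_eq0 mpolyC_eq0 expf_eq0 (negPf a0) andbF /= => /eqP ->.
  by rewrite linear0.
have bd0 : lc_boundary I (0 : E i.+1).
  by exists 0; rewrite ?linear0 //; exists 0%N => b _; rewrite scaler0.
have tors_mul (y : E i.+1) s : lc_boundary I y -> lc_boundary I (s%:MP *: y).
  by move=> by'; rewrite -[s%:MP *: y]add0r; apply: (bd_lin Ii res) by'.
(* finitely many generators, each killed by a power of a as it is I-torsion *)
have [N Nkill] : exists N, forall y : E i.+1, lc_cocycle_deg I c y ->
    lc_boundary I ((a ^+ N)%:MP *: y).
  have /choice[n nP] j : exists n, (a ^+ n)%:MP *: z j = 0.
    have [[[n H] _] _] := zc j; exists n; rewrite rmorphXn; apply: H.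
    exact: ideal_power_exp.
  pose N := (\max_j n j)%N; exists N => y /zgen[b H].
  have -> : (a ^+ N)%:MP *: y = (a ^+ N)%:MP *: (y - \sum_j (b j)%:MP *: z j).
    rewrite scalerBr scaler_sumr big1 ?subr0 // => j _.
    have nN : (n j <= N)%N by rewrite /N (bigD1 j) //= leq_maxl.
    rewrite scalerA mulrC -scalerA -(subnK nN) exprD mpolyCM -[X in _ *: X]scalerA nP.
    by rewrite !scaler0.
  exact: tors_mul.
have sN0 : a ^+ N != 0 by rewrite expf_neq0.
pose sd := seed p I r D dg (E := E) (i' := i).
(* the annihilator of a surviving class is proper, so its powers leave a ^+ N *)
have annI (y : E i.+1) : is_ideal [set g : A | lc_boundary I (g%:MP *: y)].
  split=> [|g g' bg bg'|g g' bg] /=.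
  - by rewrite mpolyC0 scale0r.
  - by rewrite mpolyCD scalerDl -[_ *: y in X in _ + X]scale1r; apply: (bd_lin Ii res).
  - by rewrite mpolyCM -scalerA; apply: tors_mul.
have /choice[n nP] t : exists n, (exists w y, sd t w y) ->
    exists w y, sd t w y /\ ~ ideal_power [set g : A | lc_boundary I (g%:MP *: y)] n (a ^+ N).
  case: (pselect (exists w y, sd t w y)) => [[w [y wy]]|]; last by exists 0%N.
  have [|n nJ] := krull_domain nA (annI y) _ sN0; last by exists n => _; exists w, y.
  by rewrite /= mpolyC1 scale1r; case: wy.
have [e0 e0P] := seed_exists Areg pp p0 Ii res xc nbx.
pose L := (absz c + m)%N.
pose n1 := (\sum_(t <- int_range L) n t)%N.
pose e := (e0 + n1)%N.
have [t [al [w [y [alS tc wy]]]]] := e0P e (leq_addr _ _).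
have [w' [y' [wy' nJ]]] := nP t (ex_intro _ w (ex_intro _ y wy)).
have q0 : (0 < p ^ e)%N by rewrite expn_gt0 prime_gt0.
(* t p^e + |al| = c with al_i < p^e bounds t independently of e *)
have tL : t \in int_range L.
  have dal : (mdeg al <= m * p ^ e)%N.
    rewrite mdegE -[X in (X * _)%N]card_ord -sum_nat_const leq_sum // => j _.
    by apply: ltnW; have /small_expP := alS; apply.
  apply: mem_int_range; rewrite /L -(leq_pmul2r q0).
  have : (absz (t * (p ^ e)%N%:Z)%R <= absz c + mdeg al)%N by rewrite -tc; lia.
  rewrite abszM /= => H; apply: leq_trans H _; rewrite mulnDl leq_add //.
  by rewrite leq_pmulr.
have nte : (n t <= p ^ e)%N.
  have nn1 : (n t <= n1)%N by rewrite /n1 (bigD1_seq t) ?int_range_uniq //= leq_addr.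
  apply: leq_trans (ltnW (ltn_expl e (prime_gt1 pp))).
  by apply: leq_trans nn1 (leq_addl _ _).
apply: nJ.
have := seed_annihilator Areg pp p0 Ii res wy' alS tc Nkill.
apply: ideal_span_le; first exact: ideal_span_ideal.
move=> _ [g bg <-]; apply: (ideal_power_mono nA _ nte); last exact: ideal_power_exp.
exact: annI.
Qed.
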